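(* Let $q:[0,\pi]\to\mathbb{R}$ be a potential admitting an absolutely convergent Fourier cosine expansion $$q(x)=\frac{q_0}{2}+\sum_{k=1}^\infty q_k\cos(kx),\qquad q_k=\frac{2}{\pi}\int_0^\pi q(x)\cos(kx)\,dx\quad (k=0,1,2,\dots).$$ Let $\lambda_1<\lambda_2\le\cdots$ be the eigenvalues of $-u''+qu=\lambda u$ on $(0,\pi)$ with Dirichlet conditions $u(0)=u(\pi)=0$, and let $\mu_0<\mu_1\le\cdots$ be the eigenvalues of $-u''+qu=\mu u$ on $(0,\pi)$ with Neumann conditions $u'(0)=u'(\pi)=0$. Suppose that $\mu_0>0$. Then for all $n\ge1$ and $s>0$, $$\sum_{k=1}^n\lambda_k^{-s}+\sum_{k=0}^n\mu_k^{-s}\ \ge\ 2\sum_{k=1}^n\left[k^2+\frac1\pi\int_0^\pi q(x)\,dx\right]^{-s}+\left[\frac1\pi\int_0^\pi q(x)\,dx\right]^{-s}.$$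
   Context: The eigenvalue problems are understood in the usual weak sense (form domains $H^1_0(0,\pi)$ and $H^1(0,\pi)$ respectively). Eigenvalues are listed in increasing order and repeated according to multiplicity; Dirichlet eigenvalues are numbered from $1$ and Neumann eigenvalues from $0$. *)

(* Defs.v *)
From mathcomp Require Import all_boot all_order all_algebra.
From mathcomp Require Import all_classical all_reals all_analysis.
Import Order.TTheory GRing.Theory Num.Theory.
Import numFieldNormedType.Exports.

Set Implicit Arguments.
Unset Strict Implicit.
Unset Printing Implicit Defensive.

Local Open Scope classical_set_scope.
Local Open Scope card_scope.
Local Open Scope ring_scope.

(* Functions on (0, pi) are represented by total functions R -> R whose values
   outside the interval are irrelevant; elements of L^2, H^1 and H^1_0 are
   functions, to be compared up to equality almost everywhere. *)
Definition I0pi (R : realType) : set R := `]0, pi[%classic.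
Arguments I0pi R : clear implicits.

Definition int_I0pi (R : realType) (f : R -> R) : R :=
  \int[@lebesgue_measure R]_(x in I0pi R) f x.

Definition eq_ae (R : realType) (u v : R -> R) : Prop :=
  ae_eq (@lebesgue_measure R) (I0pi R) u v.

Definition L2 (R : realType) : set (R -> R) :=
  [set u : R -> R | measurable_fun (I0pi R) u /\
    (@lebesgue_measure R).-integrable (I0pi R) (EFin \o (fun x => u x ^+ 2))].

(* C^1_c(0, pi), the test functions in Brezis' definition of W^{1,p} and
   W^{1,p}_0 on an interval; taking C^oo_c instead gives the same spaces. *)
Definition test_function (R : realType) : set (R -> R) :=
  [set phi : R -> R |
    [/\ forall x, derivable phi x 1,
        continuous (derive1 phi),
        compact (closure [set x | phi x != 0]) &
        closure [set x | phi x != 0] `<=` I0pi R]].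

Definition weak_derivative (R : realType) (u du : R -> R) : Prop :=
  forall phi, test_function phi ->
    int_I0pi (fun x => u x * derive1 phi x) = - int_I0pi (fun x => du x * phi x).

Definition H1_pair (R : realType) (u du : R -> R) : Prop :=
  [/\ L2 u, L2 du & weak_derivative u du].

Definition H1 (R : realType) : set (R -> R) :=
  [set u : R -> R | exists du, H1_pair u du].

(* the closure of C^1_c(0, pi) in H^1(0, pi) *)
Definition H10 (R : realType) : set (R -> R) :=
  [set u : R -> R | exists du, H1_pair u du /\
    exists phi : nat -> R -> R, (forall n, test_function (phi n)) /\
      (fun n => int_I0pi (fun x => (u x - phi n x) ^+ 2)
              + int_I0pi (fun x => (du x - derive1 (phi n) x) ^+ 2))
        @ \oo --> (0 : R)].

(* The weak solutions, in the form domain V, of - u'' + q u = t u; V = H10 gives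
   the Dirichlet and V = H1 the Neumann problem. *)
Definition eigenspace_on (R : realType) (V : set (R -> R)) (q : R -> R) (t : R) :
    set (R -> R) :=
  [set u : R -> R | V u /\ exists du, H1_pair u du /\
    forall v dv, V v -> H1_pair v dv ->
      int_I0pi (fun x => du x * dv x + q x * u x * v x)
      = t * int_I0pi (fun x => u x * v x)].

(* E has dimension d modulo equality almost everywhere *)
Definition has_dim_ae (R : realType) (E : set (R -> R)) (d : nat) : Prop :=
  exists e : 'I_d -> R -> R,
    [/\ forall i, E (e i),
        forall c : 'I_d -> R,
          eq_ae (fun x => \sum_(i < d) c i * e i x) (fun=> 0) ->
          forall i, c i = 0 &
        forall u, E u -> exists c : 'I_d -> R,
          eq_ae u (fun x => \sum_(i < d) c i * e i x)].

(* lam m, lam m.+1, ... (entries below m are ignored) is the nondecreasing list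
   of the eigenvalues, each t occurring as many times as the dimension of its
   eigenspace; in particular a t that is not an eigenvalue does not occur. *)
Definition eigenvalue_list (R : realType) (V : set (R -> R)) (q : R -> R)
    (m : nat) (lam : nat -> R) : Prop :=
  (forall j k, (m <= j <= k)%N -> lam j <= lam k) /\
  (forall t, exists d : nat,
     [set k : nat | (m <= k)%N /\ lam k = t] #= `I_d /\
     has_dim_ae (eigenspace_on V q t) d).

Definition dirichlet_eigenvalues (R : realType) (q : R -> R) (lam : nat -> R) :=
  eigenvalue_list (@H10 R) q 1 lam.

Definition neumann_eigenvalues (R : realType) (q : R -> R) (mu : nat -> R) :=
  eigenvalue_list (@H1 R) q 0 mu.

Definition cos_fourier_coeff (R : realType) (q : R -> R) (k : nat) : R :=
  2 / pi * \int[@lebesgue_measure R]_(x in `[0, pi]) (q x * cos (k%:R * x)).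

Definition abs_cvg_cos_expansion (R : realType) (q : R -> R) : Prop :=
  cvgn (series (fun k => `|cos_fourier_coeff q k|)) /\
  forall x, x \in `[0, pi] ->
    (fun n => cos_fourier_coeff q 0 / 2
            + \sum_(1 <= k < n) cos_fourier_coeff q k * cos (k%:R * x)) @ \oo --> q x.

Definition mean_value (R : realType) (q : R -> R) : R :=
  pi^-1 * \int[@lebesgue_measure R]_(x in `[0, pi]) q x.

(* Main.v *)
Require Import Defs.
From mathcomp Require Import all_boot all_order all_algebra.
From mathcomp Require Import all_classical all_reals all_analysis.
From mathcomp Require Import measurable_realfun.
From mathcomp Require Import ring lra.
Import Order.TTheory GRing.Theory Num.Theory.
Import numFieldNormedType.Exports.

Set Implicit Arguments.
Unset Strict Implicit.
Unset Printing Implicit Defensive.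

Local Open Scope classical_set_scope.
Local Open Scope ring_scope.

(** Let m be the mean of q, and consider the matrix of - u'' + q u in the orthonormal
   sines for the Dirichlet problem, in the orthonormal cosines for the Neumann
   problem. Because sin^2 + cos^2 = 1, the two diagonal entries of frequency k >= 1
   add up to 2 (k^2 + m), while the Neumann entry of frequency 0 is m
   (diagonal_sum, neumann_matrix00). The function t |-> t^-s is convex and
   decreasing on the positive reals. Midpoint convexity (powR_neg_midpoint) bounds
   the right-hand side of the theorem by the sum of t^-s over the diagonal entries
   in question, and it remains to compare diagonal entries with eigenvalues: the
   sum of t^-s over n diagonal entries is at most the sum over the n lowest
   eigenvalues.

   For a finite symmetric matrix this is an inequality of Peierls
   (galerkin_level): the squared coordinates of the orthonormal eigenvectors
   express each diagonal entry as a mean of eigenvalues, Jensen's inequality applies,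
   and a rearrangement argument pushes the total weights to the lowest eigenvalues.

   The infinite matrix is reached by truncation (galerkin_limit). The eigenvalue
   equation forces the coordinates of all truncated eigenvectors below a multiple
   of 1 / (1 + k^2), so that limits along an ultrafilter exist coordinate by
   coordinate and keep orthonormality, the eigenvalue equation and the Peierls
   inequality; call nu the limits of the eigenvalues. The absolutely convergent
   cosine series of q makes the rows of its matrix absolutely summable, and the limit
   eigenvectors are then coefficient sequences of C^1 functions. These are weak
   eigenfunctions (mode_sum_eigenspace), by completeness of the trigonometric
   system (cosn_complete, sinn_complete). Orthonormal eigenfunctions are linearly
   independent, so that counting dimensions gives lam (m + k) <= nu k for the list
   lam of all eigenvalues (eigenvalue_list_le). As t^-s decreases, this inequality
   suffices, provided that the eigenvalues are positive.

   Positivity is assumed for the Neumann problem, and nu 0 >= mu 0 > 0 follows. It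
   reaches the Dirichlet problem because a function of H^1_0 is a competitor in the
   Neumann problem: its energy is at least nu 0 times its squared norm
   (rayleigh_H10), which applied to an eigenfunction gives lam 1 >= nu 0. *)

(** * Eigenvectors of a real symmetric matrix *)

Section dot.
Context {R : realType} {N : nat}.
Implicit Types (x y z : 'rV[R]_N) (A : 'M[R]_N).

Definition dot x y : R := \sum_k x 0 k * y 0 k.

Lemma dotC x y : dot x y = dot y x.
Proof. by apply: eq_bigr => k _; rewrite mulrC. Qed.

Lemma dotDl x y z : dot (x + y) z = dot x z + dot y z.
Proof. by rewrite -big_split; apply: eq_bigr => k _; rewrite mxE mulrDl. Qed.

Lemma dotZl a x y : dot (a *: x) y = a * dot x y.
Proof. by rewrite mulr_sumr; apply: eq_bigr => k _; rewrite mxE mulrA. Qed.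

Lemma dotDr x y z : dot z (x + y) = dot z x + dot z y.
Proof. by rewrite dotC dotDl !(dotC _ z). Qed.

Lemma dotZr a x y : dot x (a *: y) = a * dot x y.
Proof. by rewrite dotC dotZl dotC. Qed.

Lemma dotNl x y : dot (- x) y = - dot x y.
Proof. by rewrite -scaleN1r dotZl mulN1r. Qed.

Lemma dot_ge0 x : 0 <= dot x x.
Proof. by apply: sumr_ge0 => k _; rewrite -expr2 sqr_ge0. Qed.

Lemma dot_eq0 x : dot x x = 0 -> x = 0.
Proof.
move=> /eqP; rewrite psumr_eq0 => [/allP h|k _]; last by rewrite -expr2 sqr_ge0.
apply/rowP => k; rewrite mxE; apply/eqP.
by have /implyP := h k (mem_index_enum k); rewrite mulf_eq0 orbb; apply.
Qed.

Lemma dot_sym A x y : A^T = A -> dot (x *m A) y = dot x (y *m A).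
Proof.
move=> As; rewrite /dot.
under eq_bigr do rewrite mxE mulr_suml.
rewrite exchange_big /=; apply: eq_bigr => k _.
rewrite mxE mulr_sumr; apply: eq_bigr => l _.
by rewrite -[in A k l]As mxE; ring.
Qed.

Lemma dot_coord x k : x 0 k ^+ 2 <= dot x x.
Proof.
rewrite /dot (bigD1 k)//= -expr2 lerDl.
by apply: sumr_ge0 => l _; rewrite -expr2 sqr_ge0.
Qed.

End dot.

Lemma form_continuous (R : realType) (N : nat) (A B : 'M[R]_N) :
  continuous (fun x : 'rV[R]_N => dot (x *m A) (x *m B)).
Proof.
apply: continuous_big => [|k _]; first exact: add_continuous.
have h (C : 'M[R]_N) : continuous (fun x : 'rV[R]_N => (x *m C) 0 k).
  under eq_fun do rewrite mxE.
  apply: continuous_big => [|l _ x]; first exact: add_continuous.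
  by apply: continuousM; [exact: coord_continuous|exact: cst_continuous].
by move=> x; apply: continuousM; exact: h.
Qed.

Lemma dot_continuous (R : realType) (N : nat) (v : 'rV[R]_N) :
  continuous (fun x : 'rV[R]_N => dot x v).
Proof.
apply: continuous_big => [|k _ x]; first exact: add_continuous.
by apply: continuousM; [exact: coord_continuous|exact: cst_continuous].
Qed.

Lemma orthogonal_unit (R : realType) (N m : nat) (u : nat -> 'rV[R]_N) :
  (m < N)%N -> exists x, dot x x = 1 /\ forall i, (i < m)%N -> dot x (u i) = 0.
Proof.
move=> mN; pose M : 'M[R]_(N, m) := \matrix_(k, i) u i 0 k.
have /rowV0Pn[x xM x0] : kermx M != 0.
  rewrite kermx_eq0 -row_leq_rank -ltnNge.
  by apply: leq_ltn_trans mN; exact: rank_leq_col.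
have d0 : 0 < dot x x.
  by rewrite lt0r dot_ge0 andbT; apply: contra_neq x0 => /dot_eq0.
exists ((Num.sqrt (dot x x))^-1 *: x); split=> [|i im].
  rewrite dotZl dotZr mulrA -expr2 exprVn sqr_sqrtr ?(ltW d0)//.
  by rewrite mulVf ?gt_eqF.
rewrite dotZl; suff -> : dot x (u i) = 0 by rewrite mulr0.
move/sub_kermxP : xM => /matrixP/(_ 0 (Ordinal im)).
by rewrite !mxE => xM; rewrite -[RHS]xM; apply: eq_bigr => k _; rewrite mxE.
Qed.

(** The first-order condition at a minimum, along one line. *)
Lemma quad_ge0_lin0 (R : realType) (b c : R) :
  (forall t, 0 <= 2 * t * b + t ^+ 2 * c) -> b = 0.
Proof.
move=> h; have c0 : 0 <= c by have := h 1; have := h (-1); nra.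
have [//|b0] := eqVneq b 0.
have := h (- b / (c + 1)).
have -> : 2 * (- b / (c + 1)) * b + (- b / (c + 1)) ^+ 2 * c =
  - (b ^+ 2 * (c + 2)) / (c + 1) ^+ 2 by field; lra.
have b2 : 0 < b ^+ 2 by rewrite exprn_even_gt0.
rewrite pmulr_lge0 ?invr_gt0; last by nra.
by nra.
Qed.

(** The vectors competing here form a closed part of the unit sphere, hence a
   compact set; homogeneity extends the minimality to vectors of any length. *)
Lemma constrained_min (R : realType) (N m : nat) (A : 'M[R]_N)
    (u : nat -> 'rV[R]_N) : (m < N)%N ->
  exists c : 'rV[R]_N, [/\ dot c c = 1,
    forall i, (i < m)%N -> dot c (u i) = 0 &
    forall x, (forall i, (i < m)%N -> dot x (u i) = 0) ->
      dot (c *m A) c * dot x x <= dot (x *m A) x].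
Proof.
move=> mN.
pose S : set 'rV[R]_N :=
  [set x | dot x x = 1 /\ forall i, (i < m)%N -> dot x (u i) = 0].
have S0 : S !=set0 by have [x] := orthogonal_unit u mN; exists x.
have cS : compact S.
  apply: bounded_closed_compact.
    exists 1; split=> // M M1 x [x1 _] /=.
    apply: (le_trans _ (ltW M1)); rewrite [leLHS]mx_normrE.
    apply/bigmax_leP; split => //= -[i k] _ /=.
    rewrite ord1 -(@ler_pXn2r _ 2)// ?nnegrE// expr1n -normrX ger0_norm ?sqr_ge0//.
    by rewrite -x1 dot_coord.
  have -> : S = (fun x : 'rV[R]_N => dot (x *m 1%:M) (x *m 1%:M)) @^-1` [set 1] `&`
      \bigcap_(i in [set i | (i < m)%N]) (fun x => dot x (u i)) @^-1` [set 0].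
    by apply/seteqP; split=> x /=; rewrite mulmx1.
  apply: closedI; last apply: closed_bigI => i _.
    apply: preimage_closed; last exact: closed_eq.
    by move=> x _; exact: form_continuous.
  apply: preimage_closed; last exact: closed_eq.
  by move=> x _; exact: dot_continuous.
have cf : {within S, continuous (fun x => dot (x *m A) x)}.
  apply: continuous_subspaceT => x; have := @form_continuous R N A 1%:M x.
  by under eq_fun do rewrite mulmx1.
have [c cS1 cmin] := compact_EVT_min S0 cS cf.
move: cS1; rewrite inE => -[c1 cu]; exists c; split=> // x xu.
have [x0|x0] := eqVneq (dot x x) 0.
  by rewrite x0 mulr0 (dot_eq0 x0) mul0mx dot_ge0.
have xp : 0 < dot x x by rewrite lt0r x0 dot_ge0.
set r := (Num.sqrt (dot x x))^-1.
have r2 : r ^+ 2 = (dot x x)^-1 by rewrite exprVn sqr_sqrtr ?(ltW xp).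
have : (r *: x) \in S.
  rewrite inE; split=> [|i im]; last by rewrite dotZl xu ?mulr0.
  by rewrite dotZl dotZr mulrA -expr2 r2 mulVf.
move=> /cmin; rewrite -scalemxAl dotZl dotZr mulrA -expr2 r2.
by rewrite mulrC ler_pdivlMr.
Qed.

Definition orthonormal_below (R : realType) N m (u : nat -> 'rV[R]_N) :=
  forall i j, (i < m)%N -> (j < m)%N -> dot (u i) (u j) = (i == j)%:R.

(** Each vector minimises the quadratic form among the unit vectors orthogonal to
   the previous ones; the eigenvalues then come out in increasing order. *)
Lemma greedy_eigenvectors (R : realType) (N m : nat) (A : 'M[R]_N) :
  A^T = A -> (m <= N)%N ->
  exists (u : nat -> 'rV[R]_N) (nu : nat -> R),
  [/\ orthonormal_below m u,
      forall i, (i < m)%N -> u i *m A = nu i *: u i,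
      forall i j, (i <= j)%N -> (j < m)%N -> nu i <= nu j &
      forall i x, (i < m)%N -> (forall j, (j < m)%N -> dot x (u j) = 0) ->
        nu i * dot x x <= dot (x *m A) x].
Proof.
move=> As; elim: m => [_|m IH mN]; first by exists (fun=> 0), (fun=> 0); split.
have [u [nu [ou eu mu lu]]] := IH (ltnW mN).
have [c [c1 cu cmin]] := constrained_min A u mN.
pose nuc := dot (c *m A) c.
have ec : c *m A = nuc *: c.
  apply/eqP; rewrite -subr_eq0; apply/eqP.
  (* By symmetry of A the residual r is orthogonal to the previous vectors, so
     that the minimum can be varied in the direction r; the first variation is
     the squared length of r. *)
  have [r rE] : exists r, r = c *m A - nuc *: c by eexists.
  rewrite -rE.
  have ru i : (i < m)%N -> dot r (u i) = 0.
    move=> im; rewrite rE dotDl dotNl dotZl cu// mulr0 subr0.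
    by rewrite dot_sym// eu// dotZr cu ?mulr0.
  apply: dot_eq0; apply: (@quad_ge0_lin0 _ _ (dot (r *m A) r - nuc * dot r r)).
  move=> t; have := cmin (c + t *: r); rewrite -subr_ge0.
  have xu i : (i < m)%N -> dot (c + t *: r) (u i) = 0.
    by move=> im; rewrite dotDl dotZl cu// ru// mulr0 addr0.
  move=> /(_ xu); congr (_ <= _).
  rewrite mulmxDl -scalemxAl !(dotDl, dotDr, dotZl, dotZr) -/nuc.
  have -> : dot (r *m A) c = dot (c *m A) r by rewrite dot_sym// dotC.
  have -> : dot r r = dot (c *m A) r - nuc * dot c r.
    by rewrite {1}rE dotDl dotNl dotZl.
  by rewrite c1 (dotC r c); ring.
exists (fun i => if i == m then c else u i).
exists (fun i => if i == m then nuc else nu i).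
split.
- move=> i j; rewrite ltnS [(i <= m)%N]leq_eqVlt ltnS [(j <= m)%N]leq_eqVlt.
  case: (eqVneq i m) => [->|im]; case: (eqVneq j m) => [->|jm] //= il jl.
  + by rewrite cu// eq_sym (negbTE jm).
  + by rewrite dotC cu ?(negbTE im).
  + exact: ou.
- move=> i; rewrite ltnS leq_eqVlt; case: (eqVneq i m) => //= im il.
  exact: eu.
- move=> i j ij; rewrite ltnS leq_eqVlt.
  case: (eqVneq j m) => [jm _|jm /= jl]; last first.
    case: (eqVneq i m) => [im|im]; last exact: mu.
    by move: ij; rewrite im leqNgt jl.
  case: (eqVneq i m) => // im.
  have il : (i < m)%N by rewrite ltn_neqAle im -jm.
  by have := lu i c il cu; rewrite c1 mulr1.
- move=> i x il xu.
  have xu' j : (j < m)%N -> dot x (u j) = 0.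
    by move=> jm; have := xu j (ltnW jm); rewrite (ltn_eqF jm).
  case: (eqVneq i m) => [_|im]; first exact: cmin.
  by apply: lu => //; rewrite ltn_neqAle im -ltnS.
Qed.

(** * Convex functions of the diagonal entries *)

(** Weights in [0, 1] of total mass n do best when they sit on the n largest
   values: with the threshold G = g n.-1, no term of
   sum_j (p j - (j < n)) * (g j - G) is positive. *)
Lemma rearrangement (R : realType) (N n : nat) (g p : nat -> R) :
  (n <= N)%N -> (forall i j, (i <= j)%N -> (j < N)%N -> g j <= g i) ->
  (forall j, (j < N)%N -> 0 <= p j <= 1) -> \sum_(j < N) p j = n%:R ->
  \sum_(j < N) p j * g j <= \sum_(j < n) g j.
Proof.
move=> nN gmono p01 sp; set G := g n.-1.
have cut (h : nat -> R) : \sum_(j < n) h j = \sum_(j < N) (j < n)%:R * h j :> R.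
  rewrite (big_ord_widen_cond N xpredT (fun j => h j) nN) big_mkcond /=.
  by apply: eq_bigr => j _; case: ifP => _; rewrite ?mul1r ?mul0r.
rewrite cut.
have : \sum_(j < N) (p j - (j < n)%:R) * (g j - G) <= 0.
  apply: sumr_le0 => j _; have /andP[p0 p1] := p01 j (ltn_ord j).
  case: ltnP => jn /=.
    rewrite mulr_le0_ge0 ?subr_le0// subr_ge0; apply: gmono; last first.
      by apply: leq_trans nN; case: (n) jn.
    by case: (n) jn => // m; rewrite ltnS.
  rewrite subr0 mulr_ge0_le0// subr_le0; apply: gmono => //.
  exact: leq_trans (leq_pred _) jn.
have -> : \sum_(j < N) (p j - (j < n)%:R) * (g j - G) =
    \sum_(j < N) p j * g j - \sum_(j < N) (j < n)%:R * g j
    - G * (\sum_(j < N) p j - \sum_(j < N) (j < n)%:R).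
  rewrite -!sumrB mulr_sumr -sumrB; apply: eq_bigr => j _; ring.
have -> : \sum_(j < N) ((j < n)%:R : R) = n%:R.
  have := cut (fun=> 1); under [X in _ = X -> _]eq_bigr do rewrite mulr1.
  by move=> <-; rewrite sumr_const card_ord.
by rewrite sp subrr mulr0 subr0 subr_le0.
Qed.

(** Convexity, in the form that Jensen's inequality uses. *)
Definition supporting_lines (R : realType) (D : set R) (g : R -> R) :=
  forall d, D d -> exists s, forall y, D y -> g d + s * (y - d) <= g y.

(** The last clause is an inequality of Peierls type. A diagonal entry is the mean of
   the eigenvalues with the weights x j k ^+ 2, which sum to 1 over j. Jensen's
   inequality bounds g (a k k) by the mean of the g (nu j); after summation over
   k < n the eigenvalue nu j carries the weight sum_(k < n) x j k ^+ 2 in [0, 1],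
   and the rearrangement lemma applies. *)
Lemma galerkin_level (R : realType) (a : nat -> nat -> R) (N : nat) :
  (forall k l, a k l = a l k) ->
  exists (x : nat -> nat -> R) (nu : nat -> R),
  [/\ forall i j, (i < N)%N -> (j < N)%N ->
        \sum_(k < N) x i k * x j k = (i == j)%:R,
      forall j k, (j < N)%N -> (k < N)%N ->
        \sum_(l < N) a k l * x j l = nu j * x j k,
      forall i j, (i <= j)%N -> (j < N)%N -> nu i <= nu j,
      forall y : nat -> R, (0 < N)%N -> nu 0%N * (\sum_(k < N) y k ^+ 2) <=
        \sum_(k < N) \sum_(l < N) a k l * y k * y l &
      forall (D : set R) (g : R -> R) n, (n <= N)%N ->
        (forall j, (j < N)%N -> D (nu j)) ->
        (forall k, (k < n)%N -> D (a k k)) ->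
        (forall y z, D y -> D z -> y <= z -> g z <= g y) ->
        supporting_lines D g ->
        \sum_(k < n) g (a k k) <= \sum_(j < n) g (nu j)].
Proof.
move=> asym; pose A : 'M[R]_N := \matrix_(k, l) a k l.
have As : A^T = A by apply/matrixP => k l; rewrite !mxE asym.
have [u [nu [ou eu mu lu]]] := greedy_eigenvectors As (leqnn N).
pose U : 'M[R]_N := \matrix_(i, k) u i 0 k.
have UU : U *m U^T = 1%:M.
  apply/matrixP => i j; rewrite !mxE -(ou i j)//.
  by apply: eq_bigr => k _; rewrite !mxE.
have UA : U *m A = diag_mx (\row_j nu j) *m U.
  apply/matrixP => i k; rewrite mul_diag_mx !mxE.
  have /matrixP/(_ 0 k) := eu i (ltn_ord i); rewrite !mxE => <-.
  by apply: eq_bigr => l _; rewrite !mxE.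
have UtU : U^T *m U = 1%:M by apply: mulmx1C.
have AE : A = U^T *m (diag_mx (\row_j nu j) *m U) by rewrite -UA mulmxA UtU mul1mx.
have aE (k l : 'I_N) : a k l = \sum_(j < N) nu j * u j 0 k * u j 0 l.
  have /matrixP/(_ k l) := AE; rewrite !mxE => ->; apply: eq_bigr => j _.
  rewrite mul_diag_mx !mxE; ring.
have colE (k l : 'I_N) : \sum_(j < N) u j 0 k * u j 0 l = (k == l)%:R.
  have /matrixP/(_ k l) := UtU; rewrite !mxE => <-; apply: eq_bigr => j _.
  by rewrite !mxE.
pose x i k := if insub k is Some k' then u i 0 (k' : 'I_N) else 0.
have xE i (k : 'I_N) : x i k = u i 0 k by rewrite /x valK.
exists x, nu; split => //.
- move=> i j iN jN; rewrite -(ou i j)//.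
  by apply: eq_bigr => k _; rewrite !xE.
- move=> j k jN kN; have /matrixP/(_ 0 (Ordinal kN)) := eu j jN.
  rewrite !mxE -(xE j (Ordinal kN)) => <-; apply: eq_bigr => l _.
  by rewrite !mxE xE asym mulrC.
- move=> y N0.
  have formE (b : nat -> R) :
      \sum_(k < N) \sum_(l < N) (\sum_(j < N) b j * u j 0 k * u j 0 l) * y k * y l
      = \sum_(j < N) b j * (\sum_(k < N) u j 0 k * y k) ^+ 2.
    transitivity (\sum_(k < N) \sum_(j < N) \sum_(l < N)
        b j * (u j 0 k * y k) * (u j 0 l * y l)).
      apply: eq_bigr => k _; rewrite exchange_big; apply: eq_bigr => l _ /=.
      by rewrite !mulr_suml; apply: eq_bigr => j _; ring.
    rewrite exchange_big; apply: eq_bigr => j _ /=.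
    rewrite expr2 mulr_suml mulr_sumr; apply: eq_bigr => k _.
    by rewrite !mulr_sumr; apply: eq_bigr => l _; ring.
  have -> : \sum_(k < N) y k ^+ 2 = \sum_(j < N) 1 * (\sum_(k < N) u j 0 k * y k) ^+ 2.
    rewrite -(formE (fun=> 1)); apply: eq_bigr => k _.
    under eq_bigr do under eq_bigr do rewrite mul1r.
    under eq_bigr do rewrite colE.
    rewrite (bigD1 k)//= eqxx big1 ?addr0; first by rewrite mul1r.
    by move=> l /negbTE lk; rewrite eq_sym lk !mul0r.
  under [leRHS]eq_bigr do under eq_bigr do rewrite aE.
  rewrite formE mulr_sumr; apply: ler_sum => j _.
  by rewrite mul1r ler_wpM2r ?sqr_ge0// mu.
- move=> D g n nN Dnu Da gmono gD.
  pose p j := \sum_(k < n) x j k ^+ 2.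
  have tot (k : 'I_N) : \sum_(j < N) x j k ^+ 2 = 1.
    have := colE k k; rewrite eqxx mulr1n => <-.
    by apply: eq_bigr => j _; rewrite xE.
  have jensen k : (k < n)%N -> g (a k k) <= \sum_(j < N) x j k ^+ 2 * g (nu j).
    move=> kn; pose k' := Ordinal (leq_trans kn nN).
    have [s gs] := gD _ (Da k kn).
    have -> : g (a k k) = \sum_(j < N) x j k ^+ 2 * (g (a k k) + s * (nu j - a k k)).
      have -> : \sum_(j < N) x j k ^+ 2 * (g (a k k) + s * (nu j - a k k)) =
          (g (a k k) - s * a k k) * (\sum_(j < N) x j k ^+ 2)
          + s * \sum_(j < N) nu j * u j 0 k' * u j 0 k'.
        rewrite !mulr_sumr -big_split; apply: eq_bigr => j _ /=.
        rewrite -(xE j k') /=; ring.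
      by rewrite (tot k') -aE /=; ring.
    by apply: ler_sum => j _; rewrite ler_wpM2l ?sqr_ge0// gs//; exact: Dnu.
  apply: le_trans (ler_sum _ (fun (k : 'I_n) _ => jensen k (ltn_ord k))) _.
  rewrite exchange_big /=.
  rewrite (eq_bigr (fun j : 'I_N => p j * g (nu j))); last first.
    by move=> j _; rewrite mulr_suml.
  apply: (@rearrangement _ N n (fun j => g (nu j)) p) => //.
  + by move=> i j ij jN; apply: gmono; [exact/Dnu/(leq_ltn_trans ij)|exact: Dnu|exact: mu].
  + move=> j jN; rewrite sumr_ge0//=; last by move=> k _; exact: sqr_ge0.
    have <- : \sum_(k < N) x j k ^+ 2 = 1.
      have := ou j j jN jN; rewrite eqxx mulr1n => <-.
      by apply: eq_bigr => k _; rewrite xE.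
    rewrite /p (big_ord_widen_cond N xpredT (fun k => x j k ^+ 2) nN) big_mkcond /=.
    by apply: ler_sum => k _; case: ifP; rewrite ?sqr_ge0.
  + rewrite exchange_big /= (eq_bigr (fun=> 1)) ?sumr_const ?card_ord//.
    by move=> k _; rewrite (tot (widen_ord nN k)).
Qed.

(** * The Galerkin limit *)

(** A limit along one fixed ultrafilter on the indices does the work of a
   diagonal extraction of subsequences. *)
Lemma ultra_bounded_cvg (R : realType) (T : Type) (U : set_system T) (f : T -> R)
    (M : R) : UltraFilter U -> (\forall t \near U, `|f t| <= M) ->
  f t @[t --> U] --> lim (f t @[t --> U]).
Proof.
move=> UU fM; apply/cvg_ex.
have fK : (f @ U) `[- M, M]%classic.
  by near=> t; rewrite /= in_itv /= -ler_norml; near: t.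
have [p [_ pc]] := @segment_compact R (- M) M (f @ U) _ fK.
exists p => V Vp; have [//|nV] := in_ultra_setVsetC (f @^-1` V) UU.
by have [y [nVy Vy]] := pc (~` V) V nV Vp.
Unshelve. all: by end_near. Qed.

(** A summable sequence that dominates, up to a constant, the coordinates of the
   eigenvectors of all truncated matrices. *)
Definition weight (R : realType) (k : nat) : R := (1 + k%:R ^+ 2)^-1.

Lemma weight_ge0 (R : realType) k : 0 <= weight R k.
Proof. by rewrite invr_ge0 addr_ge0// sqr_ge0. Qed.

Lemma weight_le1 (R : realType) k : weight R k <= 1.
Proof. by rewrite invf_le1 ?ltr_pwDl ?sqr_ge0// lerDl sqr_ge0. Qed.

(** Since weight R k is at most 4 / ((k + 1) (k + 2)), the sum telescopes. *)
Lemma sum_weight_le (R : realType) M N :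
  \sum_(M <= k < N) weight R k <= 4 / M.+1%:R.
Proof.
have [MN|NM] := leqP M N; last by rewrite big_geq ?(ltnW NM)// divr_ge0.
suff : \sum_(M <= k < N) weight R k <= 4 / M.+1%:R - 4 / N.+1%:R.
  by move=> /le_trans; apply; rewrite gerBl divr_ge0.
elim: N MN => [|N IH] MN.
  by move: MN; rewrite leqn0 => /eqP ->; rewrite big_geq// subrr.
move: MN; rewrite leq_eqVlt => /predU1P[->|]; first by rewrite big_geq// subrr.
rewrite ltnS => MN; rewrite big_nat_recr//=.
apply: le_trans (lerD (IH MN) (lexx _)) _.
rewrite -lerBrDl.
have -> : 4 / M.+1%:R - 4 / N.+2%:R - (4 / M.+1%:R - 4 / N.+1%:R) =
    4 / (N.+1%:R * N.+2%:R) :> R.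
  have -> : N.+2%:R = N.+1%:R + 1 :> R by rewrite -natr1.
  have [N0 M0] : 0 <= N%:R :> R /\ 0 <= M%:R :> R by [].
  by field; apply/and3P; split; apply: lt0r_neq0; lra.
rewrite /weight -!natr1; have n0 : 0 <= N%:R :> R by [].
move: (N%:R : R) n0 => t t0.
rewrite -[X in X <= _]mul1r ler_pdivrMr; last by nra.
rewrite mulrAC ler_pdivlMr; last by rewrite mulr_gt0; lra.
have := sqr_ge0 (t - 1); nra.
Qed.

Lemma sum_weight_ord_le (R : realType) N : \sum_(k < N) weight R k <= 4.
Proof.
by rewrite -(big_mkord xpredT (weight R)) (le_trans (sum_weight_le _ _ _))// divr1.
Qed.

Definition galerkin_matrix (R : realType) (kap : nat -> R) (Q : nat -> nat -> R)
  (k l : nat) : R := (k == l)%:R * kap k + Q k l.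

(** The form is tested on a unit coordinate vector. *)
Lemma form_diagonal_ge (R : realType) (a : nat -> nat -> R) (nu : R) (k : nat) :
  (forall K (y : nat -> R), nu * (\sum_(k < K) y k ^+ 2) <=
     \sum_(k < K) \sum_(l < K) a k l * y k * y l) -> nu <= a k k.
Proof.
move=> /(_ k.+1 (fun l => (l == k)%:R)).
rewrite big_ord_recr /= eqxx expr1n big1 ?add0r ?mulr1; last first.
  by move=> l _; rewrite (ltn_eqF (ltn_ord l)) expr0n.
move=> /le_trans; apply; rewrite big_ord_recr /= big1 ?add0r; last first.
  move=> l _; rewrite big1// => i _.
  by rewrite (ltn_eqF (ltn_ord l)) mulr0 mul0r.
rewrite big_ord_recr /= big1 ?add0r ?eqxx ?mulr1// => l _.
by rewrite (ltn_eqF (ltn_ord l)) mulr0.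
Qed.

(** A bound for the j-th eigenvalue that does not depend on the truncation. *)
Definition nu_bound (R : realType) (kap : nat -> R) (Q : nat -> nat -> R) (B : R)
    (j : nat) : R :=
  \sum_(k < j.+1) `|galerkin_matrix kap Q k k| + j.+1%:R * B.

Section galerkin.
Context {R : realType}.
Variables (kap : nat -> R) (Q : nat -> nat -> R) (B : R).
Hypothesis kap_ge : forall k, k%:R ^+ 2 <= kap k.
Hypothesis Qsym : forall k l, Q k l = Q l k.
Hypothesis QB : forall k N, \sum_(l < N) `|Q k l| <= B.

Local Notation a := (galerkin_matrix kap Q).
Local Notation nubound := (nu_bound kap Q B).

Let B0 : 0 <= B. Proof. by have := QB 0 0; rewrite big_ord0. Qed.

Let kap0 k : 0 <= kap k. Proof. exact: le_trans (sqr_ge0 _) (kap_ge k). Qed.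

Lemma sum_row_galerkin (k N : nat) (x : nat -> R) : (k < N)%N ->
  \sum_(l < N) a k l * x l = kap k * x k + \sum_(l < N) Q k l * x l.
Proof.
move=> kN; rewrite /galerkin_matrix; under eq_bigr do rewrite mulrDl.
rewrite big_split /=; congr (_ + _).
rewrite (bigD1 (Ordinal kN))//= eqxx mul1r big1 ?addr0// => l.
by rewrite -val_eqE /= eq_sym => /negbTE ->; rewrite !mul0r.
Qed.

Lemma sum_col_le k N : \sum_(l < N) `|Q l k| <= B.
Proof. by under eq_bigr do rewrite Qsym; exact: QB. Qed.

(** Schur's test. *)
Lemma schur_bound N (x : nat -> R) :
  - B * \sum_(k < N) x k ^+ 2 <= \sum_(k < N) \sum_(l < N) Q k l * x l * x k.
Proof.
have h : \sum_(k < N) \sum_(l < N) `|Q k l| * x k ^+ 2 <= B * \sum_(k < N) x k ^+ 2.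
  rewrite mulr_sumr; apply: ler_sum => k _.
  by rewrite -mulr_suml ler_wpM2r ?sqr_ge0.
have h' : \sum_(k < N) \sum_(l < N) `|Q k l| * x l ^+ 2 <= B * \sum_(k < N) x k ^+ 2.
  rewrite exchange_big /=; apply: le_trans _ h; apply: ler_sum => k _.
  by apply: ler_sum => l _; rewrite Qsym.
have : \sum_(k < N) \sum_(l < N) `|Q k l| * x k ^+ 2
   + \sum_(k < N) \sum_(l < N) `|Q k l| * x l ^+ 2
   + 2 * \sum_(k < N) \sum_(l < N) Q k l * x l * x k >= 0.
  rewrite mulr_sumr -!big_split; apply: sumr_ge0 => k _ /=.
  rewrite mulr_sumr -!big_split; apply: sumr_ge0 => l _ /=.
  have q1 : 0 <= `|Q k l| + Q k l by have := ler_norm (- Q k l); rewrite normrN; lra.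
  have q2 : 0 <= `|Q k l| - Q k l by have := ler_norm (Q k l); lra.
  have -> : `|Q k l| * x k ^+ 2 + `|Q k l| * x l ^+ 2 + 2 * (Q k l * x l * x k) =
    ((`|Q k l| + Q k l) * (x k + x l) ^+ 2 + (`|Q k l| - Q k l) * (x k - x l) ^+ 2) / 2.
    by field.
  by rewrite divr_ge0// addr_ge0// mulr_ge0// sqr_ge0.
lra.
Qed.

Lemma nu_bound_ge0 j : 0 <= nubound j.
Proof. by rewrite /nu_bound addr_ge0 ?mulr_ge0// sumr_ge0. Qed.

Section level.
Variables (N : nat) (x : nat -> nat -> R) (nu : nat -> R).
Hypothesis ox : forall i j, (i < N)%N -> (j < N)%N ->
  \sum_(k < N) x i k * x j k = (i == j)%:R.
Hypothesis ex : forall j k, (j < N)%N -> (k < N)%N ->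
  \sum_(l < N) a k l * x j l = nu j * x j k.
Hypothesis mnu : forall i j, (i <= j)%N -> (j < N)%N -> nu i <= nu j.
Hypothesis pnu : forall (D : set R) (g : R -> R) n, (n <= N)%N ->
        (forall j, (j < N)%N -> D (nu j)) ->
        (forall k, (k < n)%N -> D (a k k)) ->
        (forall y z, D y -> D z -> y <= z -> g z <= g y) ->
        supporting_lines D g ->
        \sum_(k < n) g (a k k) <= \sum_(j < n) g (nu j).

Let nx j : (j < N)%N -> \sum_(k < N) x j k ^+ 2 = 1.
Proof.
move=> jN; have := ox jN jN; rewrite eqxx mulr1n => <-.
by apply: eq_bigr => k _; rewrite expr2.
Qed.

Lemma level_coord_le1 j k : (j < N)%N -> (k < N)%N -> `|x j k| <= 1.
Proof.
move=> jN kN; rewrite -(@ler_pXn2r _ 2)// ?nnegrE// expr1n -normrX ger0_norm ?sqr_ge0//.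
rewrite -(nx jN) (bigD1 (Ordinal kN))//= lerDl.
by apply: sumr_ge0 => l _; exact: sqr_ge0.
Qed.

Lemma level_nu_ge j : (j < N)%N -> - B <= nu j.
Proof.
move=> jN; have -> : nu j = \sum_(k < N) (nu j * x j k) * x j k.
  under eq_bigr do rewrite -mulrA -expr2.
  by rewrite -mulr_sumr nx// mulr1.
under eq_bigr do rewrite -ex// sum_row_galerkin// mulrDl.
rewrite big_split /= -[leLHS]add0r lerD//.
  by apply: sumr_ge0 => k _; rewrite -mulrA -expr2 mulr_ge0 ?sqr_ge0.
have := schur_bound N (x j); rewrite nx// mulr1 => /le_trans; apply.
by apply: ler_sum => k _; rewrite mulr_suml.
Qed.

(** Schur's test bounds the eigenvalues below; the diagonal bounds them above, by
   the Peierls inequality for the decreasing affine function y |-> - y. *)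
Lemma level_nu_le j : (j < N)%N -> `|nu j| <= nubound j.
Proof.
move=> jN; have h := level_nu_ge jN.
rewrite ler_norml; apply/andP; split.
  apply: le_trans h; rewrite lerN2 /nu_bound -natr1 mulrDl mul1r.
  by rewrite addrA lerDr addr_ge0// ?mulr_ge0// sumr_ge0.
have le1 : \sum_(i < j.+1) nu i <= \sum_(k < j.+1) a k k.
  rewrite -lerN2 -!sumrN; apply: (@pnu setT (fun y => - y)) => //.
    by move=> y z _ _; rewrite lerN2.
  by move=> d _; exists (- 1) => y _; lra.
move: le1; rewrite big_ord_recr /= => le1.
have : \sum_(i < j) nu i >= - (j%:R * B).
  rewrite -mulrN mulr_natl -{1}(card_ord j) -sumr_const.
  by apply: ler_sum => i _; apply: level_nu_ge; exact: ltn_trans jN.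
have : \sum_(k < j.+1) a k k <= \sum_(k < j.+1) `|a k k|.
  by apply: ler_sum => k _; exact: ler_norm.
rewrite /nu_bound -natr1 mulrDl mul1r => le2 le3; have := B0; lra.
Qed.

(** The eigenvalue equation reads kap k * x k = nu * x k - (Q x) k, and its
   right-hand side is bounded uniformly in the size N of the matrix. *)
Lemma level_coord_le j k : (j < N)%N -> (k < N)%N ->
  `|x j k| <= (nubound j + B + 1) * weight R k.
Proof.
move=> jN kN; rewrite ler_pdivlMr; last by rewrite ltr_pwDl ?sqr_ge0.
have x1 := level_coord_le1 jN kN.
apply: (@le_trans _ _ (`|x j k| * (1 + kap k))).
  by rewrite ler_wpM2l// lerD2l.
have -> : `|x j k| * (1 + kap k) = `|x j k| + `|kap k * x j k|.
  by rewrite normrM (ger0_norm (kap0 k)); ring.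
rewrite [leLHS]addrC lerD//.
have -> : kap k * x j k = nu j * x j k - \sum_(l < N) Q k l * x j l.
  by rewrite -ex// sum_row_galerkin// addrK.
apply: le_trans (ler_normB _ _) _; rewrite lerD//.
  rewrite normrM -[leRHS]mulr1 ler_pM ?level_nu_le//.
apply: le_trans (ler_norm_sum _ _ _) _; apply: le_trans _ (QB k N).
by apply: ler_sum => l _; rewrite normrM ler_piMr// level_coord_le1.
Qed.

Lemma level_kap_sum j K : (j < N)%N -> (K <= N)%N ->
  \sum_(k < K) kap k * `|x j k| <= 4 * (nubound j + B) * (nubound j + B + 1).
Proof.
move=> jN KN; pose C := nubound j + B + 1.
have C0 : 0 <= C by apply: addr_ge0 => //; apply: addr_ge0; [exact: nu_bound_ge0|exact: B0].
have sx M : (M <= N)%N -> \sum_(l < M) `|x j l| <= 4 * C.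
  move=> MN; apply: (@le_trans _ _ (\sum_(l < M) C * weight R l)).
    apply: ler_sum => l _; apply: level_coord_le => //.
    exact: leq_trans MN.
  by rewrite -mulr_sumr mulrC ler_wpM2r// sum_weight_ord_le.
apply: (@le_trans _ _ (\sum_(k < K) (nubound j * `|x j k| +
    \sum_(l < N) `|Q k l| * `|x j l|))).
  apply: ler_sum => k _; have kN : (k < N)%N by exact: leq_trans KN.
  rewrite -[kap k]ger0_norm// -normrM.
  have -> : kap k * x j k = nu j * x j k - \sum_(l < N) Q k l * x j l.
    by rewrite -ex// sum_row_galerkin// addrK.
  apply: le_trans (ler_normB _ _) _; rewrite lerD//.
    by rewrite normrM ler_wpM2r// level_nu_le.
  apply: le_trans (ler_norm_sum _ _ _) _.
  by apply: ler_sum => l _; rewrite normrM.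
rewrite big_split /= -mulr_sumr exchange_big /=.
apply: (@le_trans _ _ (nubound j * (4 * C) + B * (4 * C))); last first.
  by rewrite -/C; lra.
rewrite lerD//; first by rewrite ler_wpM2l ?nu_bound_ge0 ?sx.
apply: (@le_trans _ _ (\sum_(l < N) B * `|x j l|)).
  by apply: ler_sum => l _; rewrite -mulr_suml ler_wpM2r// sum_col_le.
by rewrite -mulr_sumr ler_wpM2l// sx.
Qed.

End level.
End galerkin.

Section galerkin_limit.
Context {R : realType}.
Variables (kap : nat -> R) (Q : nat -> nat -> R) (B : R).
Hypothesis kap_ge : forall k, k%:R ^+ 2 <= kap k.
Hypothesis Qsym : forall k l, Q k l = Q l k.
Hypothesis QB : forall k N, \sum_(l < N) `|Q k l| <= B.
Local Notation a := (galerkin_matrix kap Q).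

(** The eigenvectors of the N x N truncations converge, coordinate by coordinate,
   to eigenvectors of the infinite matrix. All coordinates are dominated by a
   multiple of the summable sequence weight, uniformly in N, so that tails of
   sums are uniformly small: no mass escapes and orthonormality and the
   eigenvalue equation survive. *)
Theorem galerkin_limit : exists (nu : nat -> R) (x : nat -> nat -> R),
  (forall i j, (i <= j)%N -> nu i <= nu j) /\
  (forall j, exists C, forall K, \sum_(k < K) kap k * `|x j k| <= C) /\
  (forall i j, (fun K => \sum_(k < K) x i k * x j k) @ \oo --> ((i == j)%:R : R)) /\
  (forall j k, (fun K => \sum_(l < K) Q k l * x j l) @ \oo -->
     ((nu j - kap k) * x j k)) /\
  (forall K (y : nat -> R), nu 0%N * (\sum_(k < K) y k ^+ 2) <=
     \sum_(k < K) \sum_(l < K) a k l * y k * y l) /\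
  (0 < nu 0%N -> forall (g : R -> R),
     (forall y z, 0 < y -> y <= z -> g z <= g y) ->
     supporting_lines [set y | 0 < y] g ->
     (forall y, 0 < y -> {for y, continuous g}) ->
     forall n, \sum_(k < n) g (a k k) <= \sum_(j < n) g (nu j)).
Proof.
have asym k l : a k l = a l k.
  rewrite /galerkin_matrix Qsym eq_sym; congr (_ + _).
  by case: eqVneq => [->|]; rewrite ?mul0r.
have [X /choice[NU XP]] := choice (fun N => galerkin_level N asym).
have [U [UU ooU]] := @ultraFilterLemma nat \oo _.
have near_ge n0 : \forall N \near U, (n0 < N)%N.
  by apply: ooU; exact: nbhs_infty_gt.
pose nu j := lim (NU N j @[N --> U]).
pose x j k := lim (X N j k @[N --> U]).
pose C j := nu_bound kap Q B j + B + 1.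
have nub j : \forall N \near U, `|NU N j| <= nu_bound kap Q B j.
  near=> N; have [ox ex mo _ pe] := XP N.
  apply: (level_nu_le kap_ge Qsym QB ox ex pe).
  by near: N; exact: near_ge.
have xb j k : \forall N \near U, `|X N j k| <= C j * weight R k.
  near=> N; have [ox ex mo _ pe] := XP N.
  by apply: (level_coord_le kap_ge Qsym QB ox ex pe); near: N; exact: near_ge.
have cnu j : NU N j @[N --> U] --> nu j := ultra_bounded_cvg UU (nub j).
have cx j k : X N j k @[N --> U] --> x j k := ultra_bounded_cvg UU (xb j k).
have csum K (F : nat -> nat -> R) (G : nat -> R) :
    (forall k, F N k @[N --> U] --> G k) ->
    (\sum_(k < K) F N k) @[N --> U] --> \sum_(k < K) G k.
  by move=> h; apply: cvg_big => [|k _]; [exact: add_continuous|exact: h].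
have C0 j : 0 <= C j.
  have B0 : 0 <= B by have := QB 0 0; rewrite big_ord0.
  by apply: addr_ge0 => //; apply: addr_ge0 => //; exact: (nu_bound_ge0 _ QB).
have xle j k : `|x j k| <= C j * weight R k.
  exact: (cvgr_to_le (cvg_norm (cx j k)) (xb j k)).
have tail_to0 D : (fun K => D * (4 / K.+1%:R)) @ \oo --> (0 : R).
  rewrite -[X in _ --> X](mulr0 (D * 4)).
  under eq_fun do rewrite mulrA.
  by apply: cvgMl_tmp; exact: cvg_harmonic.
have nuP K (y : nat -> R) : nu 0%N * (\sum_(k < K) y k ^+ 2) <=
     \sum_(k < K) \sum_(l < K) a k l * y k * y l.
  pose z k := if (k < K)%N then y k else 0.
  have trunc N (F : nat -> R) : (K <= N)%N -> (forall k, (K <= k)%N -> F k = 0) ->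
      \sum_(k < N) F k = \sum_(k < K) F k.
    move=> KN F0; rewrite (big_ord_widen_cond N xpredT F KN) [RHS]big_mkcond /=.
    by apply: eq_bigr => k _; case: ltnP => // /F0.
  apply: (@cvgr_to_le _ U _ _ (fun N => NU N 0%N * (\sum_(k < K) y k ^+ 2))).
    by apply: cvgMr_tmp; exact: cnu.
  near=> N; have [_ _ _ fo _] := XP N.
  have KN : (K < N)%N by near: N; exact: near_ge.
  have /(_ (leq_ltn_trans (leq0n _) KN)) := fo z.
  rewrite (trunc _ (fun k => z k ^+ 2) (ltnW KN)); last first.
    by move=> k; rewrite leqNgt /z => /negbTE ->; rewrite expr0n.
  rewrite (trunc _ (fun k => \sum_(l < N) a k l * z k * z l) (ltnW KN)); last first.
    move=> k; rewrite leqNgt /z => /negbTE ->.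
    by rewrite big1// => l _; rewrite mulr0 mul0r.
  rewrite (eq_bigr (fun k : 'I_K => y k ^+ 2)) => [|k _]; last by rewrite /z ltn_ord.
  move=> h; apply: le_trans h _; apply: ler_sum => k _.
  have -> : \sum_(l < N) a k l * z k * z l = \sum_(l < K) a k l * z k * z l.
    apply: (trunc N (fun l => a k l * z k * z l) (ltnW KN)).
    by move=> l; rewrite leqNgt {2}/z => /negbTE ->; rewrite mulr0.
  apply: ler_sum => l _.
  by rewrite /z !ltn_ord.
exists nu, x; split; [|split; [|split; [|split; [|split]]]] => //.
- move=> i j ij; apply: (ler_cvg_to (cnu i) (cnu j)).
  near=> N; have [_ _ mo _ _] := XP N; apply: mo => //.
  by near: N; exact: near_ge.
- move=> j; exists (4 * (nu_bound kap Q B j + B) * (nu_bound kap Q B j + B + 1)) => K.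
  apply: (@cvgr_to_le _ U _ _ (fun N => \sum_(k < K) kap k * `|X N j k|)).
    apply: (csum K (fun N k => kap k * `|X N j k|) (fun k => kap k * `|x j k|)) => k.
    by apply: cvgMl_tmp; apply: cvg_norm; exact: cx.
  near=> N; have [ox ex mo _ pe] := XP N.
  apply: (level_kap_sum kap_ge Qsym QB ox ex pe); first by near: N; exact: near_ge.
  by apply: ltnW; near: N; exact: near_ge.
- move=> i j; apply/cvgrPdist_le => e e0.
  have /cvgrPdist_le/(_ e e0) := tail_to0 (C i * C j); apply: filterS => K.
  rewrite sub0r normrN ger0_norm ?mulr_ge0 ?divr_ge0// => Ke.
  apply: le_trans _ Ke.
  apply: (@cvgr_to_le _ U _ _ (fun N => `|(i == j)%:R - \sum_(k < K) X N i k * X N j k|)).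
    apply: cvg_norm; apply: cvgB; first exact: cvg_cst.
    apply: (csum K (fun N k => X N i k * X N j k) (fun k => x i k * x j k)) => k.
    by apply: cvgM; exact: cx.
  near=> N; have [ox ex mo _ pe] := XP N.
  have iN : (i < N)%N by near: N; exact: near_ge.
  have jN : (j < N)%N by near: N; exact: near_ge.
  have KN : (K < N)%N by near: N; exact: near_ge.
  rewrite -ox// -!(big_mkord xpredT (fun k => X N i k * X N j k)).
  rewrite (big_cat_nat (leq0n K) (ltnW KN))//= addrAC subrr add0r.
  apply: le_trans (ler_norm_sum _ _ _) _.
  apply: (@le_trans _ _ (\sum_(K <= k < N) (C i * C j) * weight R k)); last first.
    by rewrite -mulr_sumr ler_wpM2l ?mulr_ge0// sum_weight_le.
  rewrite big_nat_cond [leRHS]big_nat_cond; apply: ler_sum => k /andP[/andP[_ kN] _].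
  have h i' : (i' < N)%N -> `|X N i' k| <= C i' * weight R k.
    by move=> i'N; apply: (level_coord_le kap_ge Qsym QB ox ex pe).
  rewrite normrM; apply: le_trans (ler_pM _ _ (h i iN) (h j jN)) _ => //.
  have := weight_ge0 R k; have := weight_le1 R k; have := C0 i; have := C0 j.
  set ci := C i; set cj := C j; set w := weight R k => cj0 ci0 w1 w0.
  have : 0 <= ci * cj * w * (1 - w) by rewrite !mulr_ge0// subr_ge0.
  lra.
- move=> j k; apply/cvgrPdist_le => e e0.
  have B0 : 0 <= B by have := QB 0 0; rewrite big_ord0.
  have /cvgrPdist_le/(_ e e0) := tail_to0 (B * C j); apply: filterS => K.
  rewrite sub0r normrN ger0_norm ?mulr_ge0 ?divr_ge0// => Ke.
  apply: le_trans _ Ke.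
  apply: (@cvgr_to_le _ U _ _ (fun N =>
    `|(NU N j - kap k) * X N j k - \sum_(l < K) Q k l * X N j l|)).
    apply: cvg_norm; apply: cvgB.
      by apply: cvgM => //; apply: cvgB => //; exact: cvg_cst.
    apply: (csum K (fun N l => Q k l * X N j l) (fun l => Q k l * x j l)) => l.
    by apply: cvgMl_tmp; exact: cx.
  near=> N; have [ox ex mo _ pe] := XP N.
  have jN : (j < N)%N by near: N; exact: near_ge.
  have kN : (k < N)%N by near: N; exact: near_ge.
  have KN : (K < N)%N by near: N; exact: near_ge.
  rewrite mulrBl -ex// sum_row_galerkin// [X in X - _]addrAC subrr add0r.
  rewrite -!(big_mkord xpredT (fun l => Q k l * X N j l)).
  rewrite (big_cat_nat (leq0n K) (ltnW KN))//= addrAC subrr add0r.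
  apply: le_trans (ler_norm_sum _ _ _) _.
  apply: (@le_trans _ _ (\sum_(K <= l < N) (B * C j) * weight R l)); last first.
    by rewrite -mulr_sumr ler_wpM2l ?mulr_ge0// sum_weight_le.
  rewrite big_nat_cond [leRHS]big_nat_cond; apply: ler_sum => l /andP[/andP[_ lN] _].
  rewrite normrM -mulrA ler_pM//.
    apply: le_trans _ (QB k l.+1); rewrite big_ord_recr /= lerDr.
    by apply: sumr_ge0.
  exact: (level_coord_le kap_ge Qsym QB ox ex pe).
- move=> nu0 g gmono gline gcont n.
  have nupos j : 0 < nu j.
    apply: lt_le_trans nu0 _; apply: (ler_cvg_to (cnu 0%N) (cnu j)).
    near=> N; have [_ _ mo _ _] := XP N; apply: mo => //.
    by near: N; exact: near_ge.
  apply: (@cvgr_to_ge _ U _ _ (fun N => \sum_(j < n) g (NU N j))).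
    apply: (csum n (fun N j => g (NU N j)) (fun j => g (nu j))) => j.
    by apply: continuous_cvg; [exact: gcont|exact: cnu].
  near=> N; have [ox ex mo fo pe] := XP N.
  have nN : (n < N)%N by near: N; exact: near_ge.
  have N0 : (0 < N)%N by exact: leq_ltn_trans nN.
  (* nu 0 bounds the form of every truncation below, hence also its eigenvalues,
     which are therefore positive *)
  have NU0 : nu 0%N <= NU N 0%N.
    have := nuP N (X N 0%N).
    have -> : \sum_(k < N) X N 0%N k ^+ 2 = 1.
      have := ox 0%N 0%N N0 N0; rewrite mulr1n => <-.
      by apply: eq_bigr => k _; rewrite expr2.
    rewrite mulr1 => /le_trans; apply.
    rewrite (eq_bigr (fun k : 'I_N => NU N 0%N * (X N 0%N k * X N 0%N k))).
      by rewrite -mulr_sumr ox// mulr1.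
    move=> k _; rewrite mulrA -ex// mulr_suml.
    by apply: eq_bigr => l _; ring.
  apply: (pe [set y | 0 < y] g n (ltnW nN)) => //=.
  + move=> j jN; apply: lt_le_trans nu0 _; apply: le_trans NU0 _.
    exact: mo.
  + by move=> k _; apply: lt_le_trans nu0 _; exact: form_diagonal_ge.
  + by move=> y z y0 _; exact: gmono.
Unshelve. all: by end_near. Qed.

End galerkin_limit.

(** * Integration over (0, pi) *)

Section integration.
Context {R : realType}.
Implicit Types (f g u v c : R -> R).
Local Notation mu := (@lebesgue_measure R).
Local Notation D := (I0pi R).
Local Notation I := (@int_I0pi R).

Lemma contD f g : continuous f -> continuous g -> continuous (fun x => f x + g x).
Proof. by move=> cf cg x; apply: cvgD; [exact: cf|exact: cg]. Qed.

Lemma contM f g : continuous f -> continuous g -> continuous (fun x => f x * g x).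
Proof. by move=> cf cg x; apply: cvgM; [exact: cf|exact: cg]. Qed.

Lemma contC (k : R) : continuous (fun _ : R => k).
Proof. by move=> x; exact: cvg_cst. Qed.

Lemma contZ (k : R) f : continuous f -> continuous (fun x => k * f x).
Proof. exact/contM/contC. Qed.

Lemma contB f g : continuous f -> continuous g -> continuous (fun x => f x - g x).
Proof. by move=> cf cg x; apply: cvgB; [exact: cf|exact: cg]. Qed.

Lemma cont_norm f : continuous f -> continuous (fun x => `|f x|).
Proof. by move=> cf x; apply: cvg_norm; exact: cf. Qed.

Lemma cont_max0 f : continuous f -> continuous (fun x => Num.max 0 (f x)).
Proof.
move=> cf; have -> : (fun x => Num.max 0 (f x)) = (fun x => 2^-1 * (f x + `|f x|)).
  by apply/funext => x; case: (leP 0 (f x)) => f0;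
    rewrite ?(ger0_norm f0) ?(ltr0_norm f0); lra.
exact/contZ/contD/cont_norm.
Qed.

Lemma derive_continuous f df : (forall x, is_derive x (1 : R) f (df x)) -> continuous f.
Proof.
move=> Df x; apply/differentiable_continuous/derivable1_diffP.
by case: (Df x).
Qed.

Definition intble f := mu.-integrable D (EFin \o f).

Lemma I0pi_measurable : measurable (D : set (measurableTypeR R)). Proof. exact: measurable_itv. Qed.
Local Hint Resolve I0pi_measurable : core.

Lemma lebesgue_I0pi : mu D = (pi : R)%:E.
Proof. by rewrite /I0pi lebesgue_measure_itv /= lte_fin pi_gt0 oppr0 adde0. Qed.

Lemma I0piP x : D x <-> 0 < x < pi.
Proof. by rewrite /I0pi /= in_itv. Qed.

Lemma int_eq f g : (forall x, 0 < x < pi -> f x = g x) -> I f = I g.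
Proof.
by move=> fg; apply: eq_Rintegral => x; rewrite inE => /I0piP /fg.
Qed.

Lemma intD f g : intble f -> intble g -> I (fun x => f x + g x) = I f + I g.
Proof. by move=> fi gi; apply: RintegralD. Qed.

Lemma intB f g : intble f -> intble g -> I (fun x => f x - g x) = I f - I g.
Proof. by move=> fi gi; apply: RintegralB. Qed.

Lemma intZ k f : intble f -> I (fun x => k * f x) = k * I f.
Proof. by move=> fi; apply: RintegralZl. Qed.

Lemma int0 : I (fun=> 0) = 0.
Proof. by rewrite /int_I0pi Rintegral_cst// mul0r. Qed.

Lemma le_int f g : intble f -> intble g ->
  (forall x, 0 < x < pi -> f x <= g x) -> I f <= I g.
Proof. by move=> fi gi fg; apply: le_Rintegral => // x /I0piP; exact: fg. Qed.

Lemma int_ge0 f : (forall x, 0 < x < pi -> 0 <= f x) -> 0 <= I f.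
Proof. by move=> f0; apply: Rintegral_ge0 => x /I0piP; exact: f0. Qed.

Lemma intbleD f g : intble f -> intble g -> intble (fun x => f x + g x).
Proof.
move=> fi gi; rewrite /intble.
have -> : EFin \o (fun x => f x + g x) = ((EFin \o f) \+ (EFin \o g))%E by [].
exact: integrableD.
Qed.

Lemma intbleZ k f : intble f -> intble (fun x => k * f x).
Proof.
move=> fi; rewrite /intble.
have -> : EFin \o (fun x => k * f x) = (fun x => k%:E * (EFin \o f) x)%E.
  by apply/funext => x /=; rewrite EFinM.
exact: integrableZl.
Qed.

Lemma intbleB f g : intble f -> intble g -> intble (fun x => f x - g x).
Proof.
move=> fi gi; have := intbleD fi (intbleZ (-1) gi).
by under [X in intble X -> _]eq_fun do rewrite mulN1r.
Qed.

Lemma intble_norm f : intble f -> intble (fun x => `|f x|).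
Proof. by move=> fi; exact: (integrable_norm fi). Qed.

Lemma le_intble f g : measurable_fun D f -> intble g ->
  (forall x, 0 < x < pi -> `|f x| <= `|g x|) -> intble f.
Proof.
move=> fm gi fg; apply: (le_integrable I0pi_measurable _ _ gi).
  exact/measurable_EFinP.
by move=> x /I0piP x0; rewrite /= lee_fin fg.
Qed.

Lemma intble_measurable f : intble f -> measurable_fun D f.
Proof. by move=> fi; apply/measurable_EFinP; exact: measurable_int fi. Qed.

Lemma le_int_norm f : intble f -> `|I f| <= I (fun x => `|f x|).
Proof. by move=> fi; exact: le_normr_Rintegral. Qed.

Lemma intble_sum (K : nat) (F : nat -> R -> R) :
  (forall k, (k < K)%N -> intble (F k)) -> intble (fun x => \sum_(k < K) F k x).
Proof.
elim: K => [|K IH] h.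
  under eq_fun do rewrite big_ord0.
  by rewrite /intble; apply: integrable0.
under eq_fun do rewrite big_ord_recr /=.
by apply: intbleD; [apply: IH => k kK; apply: h; exact: ltnW|exact: h].
Qed.

Lemma int_sum (K : nat) (F : nat -> R -> R) :
  (forall k, (k < K)%N -> intble (F k)) ->
  I (fun x => \sum_(k < K) F k x) = \sum_(k < K) I (F k).
Proof.
elim: K => [|K IH] h.
  under eq_fun do rewrite big_ord0.
  by rewrite big_ord0 int0.
under eq_fun do rewrite big_ord_recr /=.
rewrite big_ord_recr intD ?IH//; last exact: h.
- by move=> k kK; apply: h; exact: ltnW.
- by apply: intble_sum => k kK; apply: h; exact: ltnW.
Qed.

Lemma continuous_measurable f : continuous f -> measurable_fun D f.
Proof.
move=> cf; apply: (@measurable_funS _ _ _ _ setT) => //.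
exact: continuous_measurable_fun.
Qed.

Lemma continuous_bounded f : continuous f ->
  exists2 M, 0 <= M & forall x, 0 <= x <= pi -> `|f x| <= M.
Proof.
move=> cf; have cn : {within `[0, pi], continuous (fun x => `|f x|)}.
  apply: continuous_subspaceT => x.
  by apply: continuous_comp; [exact: cf|exact: norm_continuous].
have [c _ cM] := EVT_max (pi_ge0 R) cn.
by exists `|f c| => // x x0; apply: cM; rewrite in_itv.
Qed.

Lemma bounded_intble f (M : R) : measurable_fun D f ->
  (forall x, 0 < x < pi -> `|f x| <= M) -> intble f.
Proof.
move=> fm fM; have muD : (mu D < +oo)%E by rewrite lebesgue_I0pi ltry.
apply: (measurable_bounded_integrable I0pi_measurable) => //.
exists M; split; first exact: num_real.
move=> y My x /I0piP /fM h; exact: le_trans h (ltW My).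
Qed.

Lemma continuous_intble f : continuous f -> intble f.
Proof.
move=> cf; have [M _ fM] := continuous_bounded cf.
apply: (@bounded_intble _ M); first exact: continuous_measurable.
by move=> x /andP[x0 xpi]; apply: fM; rewrite !ltW.
Qed.

Lemma bounded_mul_intble c f (M : R) : measurable_fun D c ->
  (forall x, 0 < x < pi -> `|c x| <= M) -> intble f -> intble (fun x => c x * f x).
Proof.
move=> cm cM fi; apply: (le_intble _ (intbleZ M fi)).
  by apply: measurable_funM => //; exact: intble_measurable.
by move=> x x0; rewrite !normrM ler_wpM2r// (le_trans (cM x x0))// ler_norm.
Qed.

Lemma continuous_mul_intble c f : continuous c -> intble f ->
  intble (fun x => c x * f x).
Proof.
move=> cc; have [M _ cM] := continuous_bounded cc.
apply: (@bounded_mul_intble _ _ M); first exact: continuous_measurable.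
by move=> x /andP[x0 xpi]; apply: cM; rewrite !ltW.
Qed.

Lemma L2_measurable u : L2 u -> measurable_fun D u.
Proof. by case. Qed.

Lemma L2_sqr u : L2 u -> intble (fun x => u x ^+ 2).
Proof. by case. Qed.

Lemma L2_mul u v : L2 u -> L2 v -> intble (fun x => u x * v x).
Proof.
move=> Lu Lv; apply: (le_intble _ (intbleD (L2_sqr Lu) (L2_sqr Lv))).
  by apply: measurable_funM; exact: L2_measurable.
move=> x _; rewrite normrM [leRHS]ger0_norm ?addr_ge0 ?sqr_ge0//.
rewrite -[u x ^+ 2]ger0_norm ?sqr_ge0// -[v x ^+ 2]ger0_norm ?sqr_ge0//.
rewrite !normrX; have := sqr_ge0 (`|u x| - `|v x|).
have := normr_ge0 (u x); have := normr_ge0 (v x); nra.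
Qed.

Lemma L2D u v : L2 u -> L2 v -> L2 (fun x => u x + v x).
Proof.
move=> Lu Lv; split.
  by apply: measurable_funD; exact: L2_measurable.
have := intbleD (intbleD (L2_sqr Lu) (L2_sqr Lv)) (intbleZ 2 (L2_mul Lu Lv)).
congr (mu.-integrable D _); apply/funext => x /=; congr EFin; ring.
Qed.

Lemma L2_bounded_mul c u (M : R) : measurable_fun D c ->
  (forall x, 0 < x < pi -> `|c x| <= M) -> L2 u -> L2 (fun x => c x * u x).
Proof.
move=> cm cM Lu; split.
  by apply: measurable_funM => //; exact: L2_measurable.
have -> : EFin \o (fun x => (c x * u x) ^+ 2) = EFin \o (fun x => c x ^+ 2 * u x ^+ 2).
  by apply/funext => x /=; rewrite exprMn.
apply: (@bounded_mul_intble (fun x => c x ^+ 2) _ (M ^+ 2) _ _ (L2_sqr Lu)).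
  exact: measurable_funX.
move=> x x0; rewrite normrX ler_pXn2r ?nnegrE// ?cM//.
exact: le_trans (cM x x0).
Qed.

Lemma L2_continuous_mul c u : continuous c -> L2 u -> L2 (fun x => c x * u x).
Proof.
move=> cc; have [M _ cM] := continuous_bounded cc.
apply: (@L2_bounded_mul _ _ M); first exact: continuous_measurable.
by move=> x /andP[x0 xpi]; apply: cM; rewrite !ltW.
Qed.

Lemma L2_continuous u : continuous u -> L2 u.
Proof.
move=> cu; split; first exact: continuous_measurable.
apply: continuous_intble => x; under eq_fun do rewrite expr2.
by apply: continuousM; exact: cu.
Qed.

Lemma L2Z k u : L2 u -> L2 (fun x => k * u x).
Proof. by move=> Lu; apply: L2_continuous_mul => // x; exact: cst_continuous. Qed.

Lemma L2B u v : L2 u -> L2 v -> L2 (fun x => u x - v x).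
Proof.
move=> Lu Lv; have := L2D Lu (L2Z (-1) Lv).
by under [X in L2 X -> _]eq_fun do rewrite mulN1r.
Qed.

Lemma L2_intble u : L2 u -> intble u.
Proof.
move=> Lu; have c1 : continuous (fun _ : R => 1 : R) by move=> x; exact: cst_continuous.
by have := L2_mul (L2_continuous c1) Lu; under eq_fun do rewrite mul1r.
Qed.

Lemma int_sqr_ge0 u : 0 <= I (fun x => u x ^+ 2).
Proof. by apply: int_ge0 => x _; exact: sqr_ge0. Qed.

Lemma int_sqr_comb (a b : R) u v : L2 u -> L2 v ->
  I (fun x => (a * u x + b * v x) ^+ 2) =
  a ^+ 2 * I (fun x => u x ^+ 2) + 2 * a * b * I (fun x => u x * v x)
  + b ^+ 2 * I (fun x => v x ^+ 2).
Proof.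
move=> Lu Lv.
have h1 := intbleZ (a ^+ 2) (L2_sqr Lu).
have h2 := intbleZ (2 * a * b) (L2_mul Lu Lv).
have h3 := intbleZ (b ^+ 2) (L2_sqr Lv).
rewrite -(intZ _ (L2_sqr Lu)) -(intZ _ (L2_mul Lu Lv)) -(intZ _ (L2_sqr Lv)).
rewrite -(intD h1 h2) -(intD (intbleD h1 h2) h3).
by apply: int_eq => x _; ring.
Qed.

Lemma cauchy_schwarz u v : L2 u -> L2 v ->
  I (fun x => u x * v x) ^+ 2 <= I (fun x => u x ^+ 2) * I (fun x => v x ^+ 2).
Proof.
move=> Lu Lv; have u0 := int_sqr_ge0 u; have v0 := int_sqr_ge0 v.
have h a b := int_sqr_comb a b Lu Lv.
have h0 a b : 0 <= a ^+ 2 * I (fun x => u x ^+ 2) + 2 * a * b * I (fun x => u x * v x)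
  + b ^+ 2 * I (fun x => v x ^+ 2) by rewrite -h int_sqr_ge0.
move: (I (fun x => u x ^+ 2)) (I (fun x => v x ^+ 2)) (I (fun x => u x * v x)) u0 v0 h0.
move=> {h} p r s p0 r0 h.
have [r0'|r0'] := eqVneq r 0.
  have [->|s0] := eqVneq s 0; first by rewrite r0' mulr0 expr0n.
  have := h 1 (- (p + 1) / (2 * s)); rewrite r0' mulr0 addr0.
  have -> : 1 ^+ 2 * p + 2 * 1 * (- (p + 1) / (2 * s)) * s = - 1 by field.
  by rewrite ler0N1.
have rp : 0 < r by rewrite lt0r r0'.
have := h r (- s).
have -> : r ^+ 2 * p + 2 * r * - s * s + (- s) ^+ 2 * r = r * (p * r - s ^+ 2) by ring.
by rewrite pmulr_rge0// subr_ge0.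
Qed.

Lemma dominated_int (F : nat -> R -> R) f g :
  (forall n, measurable_fun D (F n)) -> measurable_fun D f -> intble g ->
  (forall x, 0 < x < pi -> (fun n => F n x) @ \oo --> f x) ->
  (forall n x, 0 < x < pi -> `|F n x| <= g x) ->
  (fun n => I (F n)) @ \oo --> I f.
Proof.
move=> Fm fm gi Ff Fg.
have hFm n : measurable_fun D (EFin \o F n) by exact/measurable_EFinP.
have hfm : measurable_fun D (EFin \o f) by exact/measurable_EFinP.
have hcv : {ae mu, forall x, D x -> (EFin \o F n) x @[n --> \oo] --> (EFin \o f) x}.
  by apply: aeW => x /I0piP x0; apply: cvg_EFin; [exact: nearW|exact: Ff].
have hdom : {ae mu, forall x n, D x -> (`|(EFin \o F n) x| <= (EFin \o g) x)%E}.
  by apply: aeW => x n /I0piP x0; rewrite /= lee_fin Fg.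
have [fi _ cF] := dominated_convergence I0pi_measurable hFm hfm hcv gi hdom.
rewrite /int_I0pi /Rintegral; apply: fine_cvg; rewrite fineK//.
exact: integrable_fin_num.
Qed.

Lemma int_I0pi_closed f : continuous f ->
  I f = \int[mu]_(x in `[0, pi]) f x.
Proof.
move=> cf; rewrite /int_I0pi Rintegral_itv_obnd_cbnd; last exact: continuous_intble.
rewrite Rintegral_itv_bndo_bndc//.
have h : mu.-integrable `[0, pi]%classic (EFin \o f).
  apply: continuous_compact_integrable; first exact: segment_compact.
  exact: continuous_subspaceT.
apply: integrableS h => //.
by move=> x /=; rewrite !in_itv /= => /andP[-> /ltW].
Qed.

Lemma FTC f F : (forall x, is_derive x (1 : R) F (f x)) -> continuous f ->
  I f = F pi - F 0.
Proof.
move=> dF cf; rewrite int_I0pi_closed//.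
have dF' x : derivable F x 1 by case: (dF x).
have cF := derive_continuous dF.
rewrite /Rintegral (@continuous_FTC2 _ f F _ _ (pi_gt0 R) (continuous_subspaceT cf))//.
- split => //.
  + by apply: cvg_at_right_filter; exact: cF.
  + by apply: cvg_at_left_filter; exact: cF.
- by move=> x _; rewrite derive1E; case: (dF x).
Qed.

Lemma int_by_parts u du v dv :
  (forall x, is_derive x (1 : R) u (du x)) -> continuous du ->
  (forall x, is_derive x (1 : R) v (dv x)) -> continuous dv ->
  I (fun x => u x * dv x) = u pi * v pi - u 0 * v 0 - I (fun x => du x * v x).
Proof.
move=> Du cdu Dv cdv.
have cu := derive_continuous Du.
have cv := derive_continuous Dv.
have c1 := contM cu cdv; have c2 := contM cdu cv.
apply/eqP; rewrite -subr_eq opprK eq_sym; apply/eqP.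
rewrite -intD ?continuous_intble//.
apply/esym; apply: (@FTC _ (u * v)); last first.
  exact: contD.
move=> x; apply: is_derive_eq; rewrite /GRing.scale /=; ring.
Qed.

End integration.

(** * Calculus on the line *)

Section calculus.
Context {R : realType}.
Implicit Types f g : R -> R.

Lemma lipschitz_of_derive f df (K : R) :
  (forall x, is_derive x (1 : R) f (df x)) -> (forall x, `|df x| <= K) ->
  forall x y, `|f x - f y| <= K * `|x - y|.
Proof.
move=> Df dfK; have cf := derive_continuous Df.
suff h x y : y <= x -> `|f x - f y| <= K * `|x - y|.
  move=> x y; case/orP: (le_total y x) => [/h//|/h h'].
  by rewrite distrC (distrC x).
move=> yx; have [c _ ->] := MVT_segment yx (fun x _ => Df x) (continuous_subspaceT cf).
by rewrite normrM ler_wpM2r.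
Qed.

(** By the mean value theorem, with a constant that is twice the sharp one. *)
Lemma taylor_of_derive f df (K : R) :
  (forall x, is_derive x (1 : R) f (df x)) ->
  (forall x y, `|df x - df y| <= K * `|x - y|) ->
  forall x h, `|f (x + h) - f x - h * df x| <= K * h ^+ 2.
Proof.
move=> Df dfK x h; have cf := derive_continuous Df.
have K0 : 0 <= K.
  by have := dfK 1 0; rewrite subr0 normr1 mulr1; exact: le_trans.
have [c cP ->] : exists2 c, `|c - x| <= `|h| & f (x + h) - f x = df c * h.
  have [h0|h0] := lerP 0 h.
    have le : x <= x + h by rewrite lerDl.
    have [c] := MVT_segment le (fun x _ => Df x) (continuous_subspaceT cf).
    rewrite in_itv /= => /andP[xc ch] ->; exists c; last by rewrite addrAC subrr add0r.
    by rewrite !ger0_norm ?subr_ge0//; lra.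
  have le : x + h <= x by rewrite gerDl ltW.
  have [c] := MVT_segment le (fun x _ => Df x) (continuous_subspaceT cf).
  rewrite in_itv /= => /andP[xc ch] e; exists c; last first.
    by rewrite -[LHS]opprB e; ring.
  by rewrite (ltr0_norm h0) ler0_norm; lra.
rewrite [h * _]mulrC -mulrBl normrM.
apply: le_trans (ler_wpM2r (normr_ge0 h) (dfK c x)) _.
by rewrite -mulrA ler_wpM2l// -[h ^+ 2]ger0_norm ?sqr_ge0// normrX expr2 ler_wpM2r.
Qed.

(** Quadratic bounds of this kind can be summed, which makes them a convenient way
   to differentiate series term by term and functions with corners in the second
   derivative. *)
Lemma derive_of_quadratic_bound f (x d K : R) :
  (forall h, `|f (x + h) - f x - h * d| <= K * h ^+ 2) -> is_derive x (1 : R) f d.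
Proof.
move=> fK; have K0 : 0 <= K.
  by have := fK 1; rewrite expr1n mulr1; exact: le_trans.
have lim : h^-1 *: ((f \o shift x) (h *: 1) - f x) @[h --> 0^'] --> d.
  apply/cvgrPdist_le => e e0; near=> h.
  have h0 : h != 0 by near: h; exact: nbhs_dnbhs_neq.
  have he : `|h| <= e / (K + 1).
    near: h; apply: dnbhs0_le; rewrite divr_gt0//; lra.
  rewrite /= /GRing.scale /= mulr1 [h + x]addrC.
  have -> : d - h^-1 * (f (x + h) - f x) = - (h^-1 * (f (x + h) - f x - h * d)).
    by field.
  rewrite normrN normrM normfV ler_pdivrMl ?normr_gt0//.
  apply: le_trans (fK h) _.
  rewrite -[h ^+ 2]ger0_norm ?sqr_ge0// normrX.
  have n0 := normr_ge0 h; rewrite expr2 mulrA [leRHS]mulrC ler_wpM2r//.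
  apply: le_trans (ler_wpM2l K0 he) _.
  rewrite mulrA ler_pdivrMr; nra.
apply: DeriveDef; first by apply/cvg_ex; exists d.
exact: cvg_lim lim.
Unshelve. all: by end_near. Qed.

Lemma int_eq0_ae f : intble f -> (forall x, 0 < x < pi -> 0 <= f x) ->
  int_I0pi f = 0 -> eq_ae f (fun=> 0).
Proof.
move=> fi f0 If; have mf : measurable_fun (I0pi R) (EFin \o f).
  exact: measurable_int fi.
have : (\int[@lebesgue_measure R]_(x in I0pi R) `|(EFin \o f) x|)%E = 0%E.
  transitivity (\int[@lebesgue_measure R]_(x in I0pi R) (EFin \o f) x)%E.
    by apply: eq_integral => x; rewrite inE => /I0piP x0; rewrite /= ger0_norm// f0.
  rewrite -[LHS]fineK; last exact: (integrable_fin_num I0pi_measurable fi).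
  exact: (congr1 EFin If).
move/(ae_eq_integral_abs _ I0pi_measurable mf); apply: filterS => x h Dx.
by have := h Dx => -[].
Qed.

End calculus.

(** * The trigonometric system on (0, pi) *)

Section trigonometric.
Context {R : realType}.
Implicit Types h g : R -> R.
Local Notation I := (@int_I0pi R).

Definition cosn (k : nat) (x : R) : R := cos (k%:R * x).
Definition sinn (k : nat) (x : R) : R := sin (k%:R * x).
(** The distance of k and l: the frequency of the difference term in the
   product-to-sum formulas. *)
Definition gap (k l : nat) : nat := ((k - l) + (l - k))%N.

Lemma is_derive_dilation (k : R) f df (x : R) : is_derive (k * x) (1 : R) f df ->
  is_derive x (1 : R) (fun y : R => f (k * y)) (k * df).
Proof.
move=> Df; rewrite mulrC; apply: (@is_derive1_comp R f (fun y => k * y)) => //.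
have -> : (fun y : R => k * y) = (k \*: (@id R)) by [].
by apply: is_derive_eq; rewrite /GRing.scale /= mulr1.
Qed.

Lemma is_derive_cosn k x : is_derive x (1 : R) (cosn k) (- (k%:R * sinn k x)).
Proof. by rewrite -mulrN; exact: is_derive_dilation. Qed.

Lemma is_derive_sinn k x : is_derive x (1 : R) (sinn k) (k%:R * cosn k x).
Proof. exact: is_derive_dilation. Qed.

Lemma cosn_continuous k : continuous (cosn k).
Proof. exact: derive_continuous (is_derive_cosn k). Qed.

Lemma sinn_continuous k : continuous (sinn k).
Proof. exact: derive_continuous (is_derive_sinn k). Qed.

Lemma cosn0 x : cosn 0 x = 1. Proof. by rewrite /cosn mul0r cos0. Qed.
Lemma sinn0 x : sinn 0 x = 0. Proof. by rewrite /sinn mul0r sin0. Qed.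
Lemma sinn_at0 k : sinn k 0 = 0. Proof. by rewrite /sinn mulr0 sin0. Qed.

Lemma sinn_atpi k : sinn k pi = 0.
Proof.
elim: k => [|k IH]; first exact: sinn0.
by rewrite /sinn -natr1 mulrDl mul1r sinDpi -/(sinn k pi) IH oppr0.
Qed.

Lemma cosn_gap k l x : cosn (gap k l) x = cos (k%:R * x - l%:R * x).
Proof.
rewrite /cosn /gap; have [kl|/ltnW lk] := leqP k l.
  by rewrite (eqP kl) add0n natrB// mulrBl -cosN opprB.
by rewrite (eqP lk) addn0 natrB// mulrBl.
Qed.

Lemma cosnM k l x : cosn k x * cosn l x = (cosn (k + l) x + cosn (gap k l) x) / 2.
Proof. rewrite cosn_gap /cosn natrD [(_ + _) * x]mulrDl cosB cosD; by field. Qed.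

Lemma sinnM k l x : sinn k x * sinn l x = (cosn (gap k l) x - cosn (k + l) x) / 2.
Proof. rewrite cosn_gap /cosn /sinn natrD [(_ + _) * x]mulrDl cosB cosD; by field. Qed.

Lemma int_cosn k : I (cosn k) = (k == 0%N)%:R * pi.
Proof.
case: eqVneq => [->|k0].
  rewrite mul1r (@int_eq _ _ (fun=> 1)) => [|x _]; last exact: cosn0.
  have Did x : is_derive x (1 : R) (@id R) ((fun=> 1) x) by exact: is_derive_id.
  by rewrite (FTC Did) ?subr0//; exact: contC.
have k0' : k%:R != 0 :> R by rewrite pnatr_eq0.
rewrite mul0r -[LHS](mulKf k0') -intZ; last exact/continuous_intble/cosn_continuous.
rewrite (FTC (is_derive_sinn k)); last exact/contZ/cosn_continuous.
by rewrite sinn_atpi sinn_at0 subrr mulr0.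
Qed.

Lemma gap_eq0 k l : (gap k l == 0)%N = (k == l).
Proof. by rewrite /gap addn_eq0 !subn_eq0 eqn_leq. Qed.

Lemma cosn_intble k : intble (cosn k).
Proof. exact/continuous_intble/cosn_continuous. Qed.

Lemma int_cosnM k l :
  I (fun x => cosn k x * cosn l x) = pi / 2 * ((k + l == 0)%N%:R + (k == l)%:R).
Proof.
rewrite (@int_eq _ _ (fun x => 2^-1 * (cosn (k + l) x + cosn (gap k l) x))).
  rewrite intZ ?intD ?int_cosn ?gap_eq0; [by field|exact: cosn_intble..|].
  by apply: intbleD; exact: cosn_intble.
by move=> x _; rewrite cosnM mulrC.
Qed.

Lemma int_sinnM k l :
  I (fun x => sinn k x * sinn l x) = pi / 2 * ((k == l)%:R - (k + l == 0)%N%:R).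
Proof.
rewrite (@int_eq _ _ (fun x => 2^-1 * (cosn (gap k l) x - cosn (k + l) x))).
  rewrite intZ ?intB ?int_cosn ?gap_eq0; [by field|exact: cosn_intble..|].
  by apply: intbleB; exact: cosn_intble.
by move=> x _; rewrite sinnM mulrC.
Qed.

Lemma int_gt0 g (x0 : R) : continuous g -> (forall x, 0 < x < pi -> 0 <= g x) ->
  0 < x0 < pi -> 0 < g x0 -> 0 < I g.
Proof.
move=> cg g0 /andP[x00 x0pi] gx0; rewrite lt0r int_ge0// andbT; apply/eqP => Ig.
have gi := continuous_intble cg.
have [A [mA A0 sA]] := int_eq0_ae gi g0 Ig.
have : \forall x \near x0, 0 < g x by apply: (cvgr_gt _ (cg x0)).
have : \forall x \near x0, 0 < x by exact: lt_nbhsr.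
have : \forall x \near x0, x < pi by exact: lt_nbhsl.
move=> h1 h2 h3.
have [e /= e0 he] : \forall x \near x0, [/\ x < pi, 0 < x & 0 < g x].
  by near=> x; split; near: x.
have sJ : `[x0, x0 + e / 2]%classic `<=` A.
  move=> x /=; rewrite in_itv /= => /andP[x0x xe]; apply: sA => /= h.
  have [|xpi x_gt0 gx] := he x.
    by rewrite /ball /= ltr_norml; apply/andP; split; lra.
  by move: gx; rewrite h ?ltxx//; apply/I0piP; rewrite x_gt0.
have : (@lebesgue_measure R `[x0, (x0 + e / 2)%R]%classic <= @lebesgue_measure R A)%E.
  by apply: le_measure => //; rewrite inE.
rewrite A0 lebesgue_measure_itv /= lte_fin ltrDl divr_gt0//.
by rewrite -EFinD addrAC subrr add0r lee_fin leNgt divr_gt0.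
Unshelve. all: by end_near. Qed.

End trigonometric.

(** * Completeness of the trigonometric system *)

Section completeness.
Context {R : realType}.
Implicit Types h g : R -> R.
Local Notation I := (@int_I0pi R).

(** The functions g such that g * h is orthogonal to all cosines form a space that
   is stable under multiplication by cos x, hence by polynomials in cos x. *)
Definition cosn_orthogonal h g :=
  continuous g /\ forall k, I (fun x => h x * g x * cosn k x) = 0.

Lemma cosn_orthogonalD h g1 g2 : continuous h -> cosn_orthogonal h g1 ->
  cosn_orthogonal h g2 -> cosn_orthogonal h (fun x => g1 x + g2 x).
Proof.
move=> ch [c1 o1] [c2 o2]; split=> [|k]; first exact: contD.
have i g : continuous g -> intble (fun x => h x * g x * cosn k x).
  by move=> cg; apply/continuous_intble/contM/cosn_continuous/contM.
rewrite -[RHS]addr0 -[X in X + _](o1 k) -[X in _ + X](o2 k) -intD ?i//.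
by apply: int_eq => x _; ring.
Qed.

Lemma cosn_orthogonalZ h g (a : R) : continuous h -> cosn_orthogonal h g ->
  cosn_orthogonal h (fun x => a * g x).
Proof.
move=> ch [cg og]; split=> [|k]; first exact: contZ.
rewrite -[RHS](mulr0 a) -(og k) -intZ; first by apply: int_eq => x _; ring.
exact/continuous_intble/contM/cosn_continuous/contM.
Qed.

Lemma cosn_orthogonal_cos h g : continuous h -> cosn_orthogonal h g ->
  cosn_orthogonal h (fun x => cosn 1 x * g x).
Proof.
move=> ch [cg og]; split=> [|k]; first exact/contM/cg/cosn_continuous.
have i j : intble (fun x => h x * g x * cosn j x).
  exact/continuous_intble/contM/cosn_continuous/contM.
have := og (1 + k)%N; have := og (gap 1 k) => e1 e2.
have : 2^-1 * (I (fun x => h x * g x * cosn (1 + k) x) +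
    I (fun x => h x * g x * cosn (gap 1 k) x)) = 0 by rewrite e1 e2 addr0 mulr0.
rewrite -intD// -intZ; last exact: intbleD.
move=> <-; apply: int_eq => x _.
transitivity (h x * g x * (cosn 1 x * cosn k x)); first by ring.
by rewrite cosnM; field.
Qed.

Lemma bernoulli_ge (b : R) n : 0 <= b -> n%:R * b <= (1 + b) ^+ n.
Proof.
move=> b0; suff : 1 + n%:R * b <= (1 + b) ^+ n by apply: le_trans; rewrite lerDr.
elim: n => [|n IH]; first by rewrite mul0r addr0 expr0.
rewrite exprS; apply: le_trans _ (ler_wpM2l _ IH); last by rewrite addr_ge0.
rewrite -natr1; have : 0 <= n%:R * b ^+ 2 by rewrite mulr_ge0// sqr_ge0.
lra.
Qed.

(** A polynomial p in cos x exceeds 1 near x0 and lies in [0, 1] away from x0. If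
   h x0 > 0, then the functions h * p ^+ n are bounded below by a constant and
   grow without bound near x0, so that their integrals, which are all 0, would
   tend to +oo. *)
Lemma cosn_complete_pos h (x0 : R) : continuous h ->
  (forall k, I (fun x => h x * cosn k x) = 0) -> 0 < x0 < pi -> ~ 0 < h x0.
Proof.
move=> ch oh /andP[x00 x0pi] hx0.
have h1 : \forall x \near x0, h x0 / 2 < h x.
  by apply: (cvgr_gt _ (ch x0)); lra.
have h2 : \forall x \near x0, 0 < x by exact: lt_nbhsr.
have h3 : \forall x \near x0, x < pi by exact: lt_nbhsl.
have [e /= e0 he] : \forall x \near x0, [/\ x < pi, 0 < x & h x0 / 2 < h x].
  by near=> x; split; near: x.
have {}he x : `|x - x0| < e -> [/\ x < pi, 0 < x & h x0 / 2 < h x].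
  by move=> xe; apply: he; rewrite /ball /= distrC.
pose d := e / 2; have d0 : 0 < d by rewrite divr_gt0.
have [_ a0 _] : [/\ x0 - d < pi, 0 < x0 - d & h x0 / 2 < h (x0 - d)].
  by apply: he; rewrite addrAC subrr add0r normrN gtr0_norm// /d; lra.
have [ap _ _] : [/\ x0 + d < pi, 0 < x0 + d & h x0 / 2 < h (x0 + d)].
  by apply: he; rewrite addrAC subrr add0r gtr0_norm// /d; lra.
have cosd (x y : R) : 0 <= x -> x < y -> y <= pi -> cos y < cos x.
  by move=> x_ge0 xy ypi; rewrite ltr_cos// in_itv /=; apply/andP; split; lra.
pose m := Num.min (cos (x0 - d) - cos x0) (cos x0 - cos (x0 + d)).
have m0 : 0 < m.
  by rewrite lt_min !subr_gt0; apply/andP; split; apply: cosd; lra.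
have far x : 0 < x < pi -> d <= `|x - x0| -> m <= `|cos x - cos x0|.
  move=> /andP[x_gt0 xpi]; rewrite ler_normr => /orP[] dx.
    have : m <= cos x0 - cos (x0 + d) by rewrite ge_min lexx orbT.
    move=> /le_trans; apply; rewrite distrC; apply: le_trans _ (ler_norm _).
    rewrite lerD2l lerN2; have [->//|] := eqVneq x (x0 + d).
    by move=> ne; apply/ltW/cosd; lra.
  have : m <= cos (x0 - d) - cos x0 by rewrite ge_min lexx.
  move=> /le_trans; apply; apply: le_trans _ (ler_norm _).
  rewrite lerD2r; have [->//|] := eqVneq x (x0 - d).
  by move=> ne; apply/ltW/cosd; lra.
have m2 : m <= 2.
  have : m <= cos (x0 - d) - cos x0 by rewrite ge_min lexx.
  by have := cos_le1 (x0 - d); have := cos_geN1 x0; lra.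
pose b := m ^+ 2 / 4.
have b0 : 0 < b by rewrite divr_gt0 ?exprn_gt0.
pose p x := 1 + b - (cosn 1 x - cos x0) ^+ 2 / 4.
have cosn1 x : cosn 1 x = cos x by rewrite /cosn mul1r.
have p0 x : 0 <= p x.
  have : `|cos x - cos x0| ^+ 2 <= 2 ^+ 2.
    rewrite ler_pXn2r ?nnegrE// ler_norml.
    by have := cos_le1 x; have := cos_geN1 x; have := cos_le1 x0;
       have := cos_geN1 x0; lra.
  by rewrite real_normK ?num_real// /p cosn1; lra.
have pfar x : 0 < x < pi -> d <= `|x - x0| -> p x <= 1.
  move=> xI /(far x xI) mx.
  have : m ^+ 2 <= `|cos x - cos x0| ^+ 2 by rewrite ler_pXn2r ?nnegrE// ltW.
  by rewrite real_normK ?num_real// /p cosn1 /b; lra.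
have lipcos x y : `|cos x - cos y| <= 1 * `|x - y| :> R.
  apply: (@lipschitz_of_derive R cos (fun z => - sin z)) => z.
  by rewrite normrN sin_max.
pose eta := Num.min d (m / 2).
have eta0 : 0 < eta by rewrite lt_min d0 divr_gt0.
have pnear x : `|x - x0| < eta -> 1 + b / 2 <= p x.
  rewrite lt_min => /andP[_ xm].
  have : `|cos x - cos x0| ^+ 2 <= (m / 2) ^+ 2.
    rewrite ler_pXn2r ?nnegrE//; last by rewrite divr_ge0// ltW.
    by apply: le_trans (lipcos _ _) _; rewrite mul1r ltW.
  by have := b0; rewrite real_normK ?num_real// /p cosn1 /b; lra.
(* a tent inside the region where p ^+ n grows *)
pose T x := Num.max 0 (1 - `|x - x0| / eta).
have cT : continuous T.
  have cn : continuous (fun x => 1 - `|x - x0| / eta).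
    apply: contB; first exact: contC.
    apply: contM; last exact: contC.
    by apply: cont_norm; apply: contB; [move=> x; exact: cvg_id|exact: contC].
  exact: cont_max0.
have T0 x : 0 <= T x by rewrite le_max lexx.
have T1 x : T x <= 1.
  by rewrite ge_max ler01 gerBl divr_ge0// ltW.
have Tfar x : eta <= `|x - x0| -> T x = 0.
  by move=> xe; apply/max_idPl; rewrite subr_le0 ler_pdivlMr// mul1r.
have IT : 0 < I T.
  apply: (@int_gt0 _ _ x0) => //; first by rewrite x00.
  by rewrite /T subrr normr0 mul0r subr0 lt_max ltr01 orbT.
have [M M0 hM] := continuous_bounded ch.
have op n : cosn_orthogonal h (fun x => p x ^+ n).
  elim: n => [|n IH].
    split=> [|k]; first by under eq_fun do rewrite expr0; exact: contC.
    by rewrite -[RHS](oh k); apply: int_eq => x _; rewrite expr0 mulr1.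
  have o1 := cosn_orthogonal_cos ch IH; have o2 := cosn_orthogonal_cos ch o1.
  have := cosn_orthogonalD ch (cosn_orthogonalZ (1 + b - cos x0 ^+ 2 / 4) ch IH)
    (cosn_orthogonalD ch (cosn_orthogonalZ (cos x0 / 2) ch o1)
      (cosn_orthogonalZ (- 4^-1) ch o2)).
  congr cosn_orthogonal; apply/funext => x; rewrite [p x ^+ n.+1]exprS.
  by move: (p x ^+ n) => z; rewrite /p; field.
have low n x : 0 < x < pi ->
    - M + h x0 / 2 * (n%:R * (b / 2)) * T x <= h x * p x ^+ n.
  move=> xI; have hMx : `|h x| <= M by apply: hM; move/andP: xI => [? ?]; rewrite !ltW.
  have pn0 : 0 <= p x ^+ n by exact: exprn_ge0.
  have [xe|ex] := ltP `|x - x0| eta.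
    have [|_ _ hx] := he x.
      by move: xe; rewrite lt_min /d => /andP[xd _]; lra.
    apply: (@le_trans _ _ (h x0 / 2 * (n%:R * (b / 2)) * T x)); first lra.
    apply: (@le_trans _ _ (h x0 / 2 * (n%:R * (b / 2)))).
      by rewrite ler_piMr// !mulr_ge0// ?divr_ge0// ltW.
    apply: ler_pM; [by lra|by rewrite mulr_ge0// divr_ge0// ltW|exact: ltW|].
    apply: le_trans (bernoulli_ge n (ltW (divr_gt0 b0 _))) _ => //.
    by rewrite lerXn2r ?nnegrE// ?pnear// addr_ge0// divr_ge0// ltW.
  rewrite Tfar// mulr0 addr0.
  have [xd|dx] := ltP `|x - x0| d.
    have [|_ _ hx] := he x; first by move: xd; rewrite /d; lra.
    apply: (@le_trans _ _ 0); first by rewrite oppr_le0.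
    by rewrite mulr_ge0//; lra.
  have p1 : p x ^+ n <= 1 by rewrite exprn_ile1// pfar.
  have : `|h x * p x ^+ n| <= M.
    by rewrite normrM (ger0_norm pn0) -[leRHS]mulr1 ler_pM.
  by rewrite ler_norml => /andP[].
have iT a : intble (fun x => a * T x) by exact/continuous_intble/contZ.
have iM : intble (fun _ : R => - M) by exact/continuous_intble/contC.
have bound n : h x0 / 2 * (n%:R * (b / 2)) * I T <= M * pi.
  have [cpn /(_ 0%N)] := op n.
  rewrite (@int_eq _ _ (fun x => h x * p x ^+ n)) => [I0|x _]; last first.
    by rewrite cosn0 mulr1.
  have := le_int (intbleD iM (iT _)) (continuous_intble (contM ch cpn)) (low n).
  rewrite intD// I0 intZ; last exact: continuous_intble.
  have -> : I (fun=> - M) = - M * pi.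
    have := intZ (- M) (cosn_intble 0); rewrite int_cosn mul1r => <-.
    by apply: int_eq => x _; rewrite cosn0 mulr1.
  by rewrite mulNr addrC subr_le0.
pose c := h x0 / 2 * (b / 2) * I T.
have c0 : 0 < c by rewrite !mulr_gt0// ?divr_gt0.
have := archi_boundP (divr_ge0 (mulr_ge0 M0 (pi_ge0 R)) (ltW c0)).
move: (Num.bound _) => N; rewrite ltr_pdivrMr// ltNge => /negP; apply.
apply: le_trans _ (bound N); rewrite /c le_eqVlt; apply/orP; left; apply/eqP.
by ring.
Unshelve. all: by end_near. Qed.

Lemma cosn_complete h : continuous h ->
  (forall k, I (fun x => h x * cosn k x) = 0) ->
  forall x, 0 < x < pi -> h x = 0.
Proof.
move=> ch oh x xI.
have [h0|h0|->//] := ltgtP (h x) 0; last by have := cosn_complete_pos ch oh xI h0.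
have /= := @cosn_complete_pos (fun y => - 1 * h y) x (contZ ch) _ xI.
rewrite mulN1r oppr_gt0 h0 => H; exfalso; apply: H => // k.
rewrite -[RHS](mulr0 (-1)) -(oh k) -intZ.
  by apply: int_eq => y _; rewrite mulrA.
exact/continuous_intble/contM/cosn_continuous.
Qed.

(** Multiplication by sin x turns orthogonality to the sines into orthogonality to
   the cosines. *)
Lemma sinn_complete h : continuous h ->
  (forall k, I (fun x => h x * sinn k.+1 x) = 0) ->
  forall x, 0 < x < pi -> h x = 0.
Proof.
move=> ch oh x xI.
have : h x * sinn 1 x = 0.
  apply: (@cosn_complete (fun y => h y * sinn 1 y) _ _ x xI); first exact/contM/sinn_continuous.
  move=> k; have i j : intble (fun y => h y * sinn j y).
    exact/continuous_intble/contM/sinn_continuous.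
  have [->|k0] := eqVneq k 0%N.
    rewrite -[RHS](oh 0%N).
    by apply: int_eq => y _; rewrite cosn0 mulr1.
  have e1 := oh k.
  have e2 : I (fun y => h y * sinn k.-1 y) = 0.
    have [->|k1] := eqVneq k.-1 0%N.
      by rewrite -[RHS]int0; apply: int_eq => y _; rewrite sinn0 mulr0.
    by rewrite -[k.-1]prednK ?lt0n// oh.
  have : 2^-1 * (I (fun y => h y * sinn k.+1 y) - I (fun y => h y * sinn k.-1 y)) = 0.
    by rewrite e1 e2 subrr mulr0.
  rewrite -intB// -intZ; last exact: intbleB.
  move=> <-; apply: int_eq => y _; rewrite /sinn /cosn -{1}[k]prednK ?lt0n//.
  rewrite -[k.+1]addn1 natrD mulrDl sinD mul1r.
  have -> : k.-1%:R * y = k%:R * y - y.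
    by rewrite -[k in RHS]prednK ?lt0n// -natr1 mulrDl mul1r addrK.
  rewrite sinB.
  have -> : k.-1.+1%:R * y = k%:R * y by rewrite prednK ?lt0n.
  by field.
move/eqP; rewrite mulf_eq0 => /orP[/eqP//|]; rewrite /sinn mul1r.
by rewrite gt_eqF// sin_gt0_pi.
Qed.

End completeness.

(** * Cutoffs and boundary values *)

Section cutoff.
Context {R : realType}.
Local Notation I := (@int_I0pi R).

Definition parab (x : R) : R := x * (pi - x).
Definition excess (e x : R) : R := Num.max 0 (parab x - e).
Definition defect (e x : R) : R := e ^+ 2 / (excess e x ^+ 2 + e ^+ 2).

(** With r = excess e x, the cutoff is r ^+ 2 / (r ^+ 2 + e ^+ 2): it
   is C^1, vanishes where parab is at most e and tends to 1 on (0, pi) as e tends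
   to 0. It is written as 1 - defect because defect also controls the derivative,
   in parab_dcutoff_le. *)
Definition cutoff (e x : R) : R := 1 - defect e x.
Definition dcutoff (e x : R) : R :=
  2 * e ^+ 2 * excess e x * (pi - 2 * x) / (excess e x ^+ 2 + e ^+ 2) ^+ 2.

Lemma is_derive_sqr_max0 (t : R) :
  is_derive t (1 : R) (fun s => Num.max 0 s ^+ 2) (2 * Num.max 0 t).
Proof.
apply: (@derive_of_quadratic_bound _ _ _ _ 1) => h; rewrite mul1r.
by case: (leP 0 t) => t0; case: (leP 0 (t + h)) => h0;
  rewrite ler_norml; apply/andP; split; nra.
Qed.

Lemma parab_continuous : continuous parab.
Proof. by apply: contM; [move=> x; exact: cvg_id|apply: contB; [exact: contC|move=> x; exact: cvg_id]]. Qed.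

Lemma is_derive_parab (x : R) : is_derive x (1 : R) parab (pi - 2 * x).
Proof.
apply: (@derive_of_quadratic_bound _ _ _ _ 1) => h; rewrite mul1r /parab.
have -> : (x + h) * (pi - (x + h)) - x * (pi - x) - h * (pi - 2 * x) = - h ^+ 2 by ring.
by rewrite normrN ger0_norm// sqr_ge0.
Qed.

Lemma is_derive_excess (e x : R) :
  is_derive x (1 : R) (fun y => excess e y ^+ 2) (2 * excess e x * (pi - 2 * x)).
Proof.
apply: (@is_derive1_comp R (fun s => Num.max 0 s ^+ 2) (fun y => parab y - e)).
  exact: is_derive_sqr_max0.
have := is_derive_parab x => Db.
apply: (@derive_of_quadratic_bound _ _ _ _ 1) => h; rewrite mul1r /parab.
have -> : (x + h) * (pi - (x + h)) - e - (x * (pi - x) - e) - h * (pi - 2 * x) = - h ^+ 2 by ring.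
by rewrite normrN ger0_norm// sqr_ge0.
Qed.

Lemma excess_continuous e : continuous (excess e).
Proof. exact/cont_max0/contB/contC/parab_continuous. Qed.

Lemma denominator_gt0 (e x : R) : 0 < e -> 0 < excess e x ^+ 2 + e ^+ 2.
Proof. by move=> e0; rewrite ltr_wpDl ?sqr_ge0// exprn_gt0. Qed.

Lemma is_derive_cutoff (e x : R) : 0 < e ->
  is_derive x (1 : R) (cutoff e) (dcutoff e x).
Proof.
move=> e0; have D0 := denominator_gt0 x e0.
have De := is_derive_excess e x.
pose f := fun y : R => excess e y ^+ 2 + e ^+ 2.
have Df : is_derive x (1 : R) f (2 * excess e x * (pi - 2 * x)).
  rewrite -[X in is_derive _ _ _ X]addr0.
  have -> : f = (fun y => excess e y ^+ 2) + (fun=> e ^+ 2) by [].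
  exact: is_deriveD.
have fx0 : f x != 0 by rewrite gt_eqF.
have DV := is_deriveV fx0 Df.
have -> : cutoff e = (fun=> 1) - (e ^+ 2 \*: (fun y => (f y)^-1)).
  by apply/funext => y.
apply: is_derive_eq; rewrite /dcutoff /GRing.scale /= /f.
by field; rewrite gt_eqF.
Qed.

Lemma contV (f : R -> R) : (forall x, f x != 0) -> continuous f ->
  continuous (fun x => (f x)^-1).
Proof. by move=> f0 cf x; apply: cvgV; [exact: f0|exact: cf]. Qed.

Lemma contX (f : R -> R) n : continuous f -> continuous (fun x => f x ^+ n).
Proof.
move=> cf; elim: n => [|n IH]; first by under eq_fun do rewrite expr0; exact: contC.
by under eq_fun do rewrite exprS; exact: contM.
Qed.

Lemma dcutoff_continuous e : 0 < e -> continuous (dcutoff e).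
Proof.
move=> e0; apply: contM.
  apply: contM; first exact/contM/excess_continuous/contC.
  by apply: contB; [exact: contC|apply: contZ => x; exact: cvg_id].
apply: contV => [x|]; first by rewrite expf_neq0// gt_eqF// denominator_gt0.
by apply/contX/contD; [exact/contX/excess_continuous|exact: contC].
Qed.

Lemma defect_bounds (e x : R) : 0 < e -> 0 <= defect e x <= 1.
Proof.
move=> e0; have D0 := denominator_gt0 x e0.
by rewrite divr_ge0 ?sqr_ge0 ?(ltW D0)//= ler_pdivrMr// mul1r lerDr sqr_ge0.
Qed.

Lemma cutoff_eq0 (e x : R) : 0 < e -> parab x <= e -> cutoff e x = 0.
Proof.
move=> e0 xe; rewrite /cutoff /defect /excess.
have -> : Num.max 0 (parab x - e) = 0 by apply/max_idPl; rewrite subr_le0.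
by rewrite expr0n /= add0r divff ?subrr// expf_neq0// gt_eqF.
Qed.

Lemma parab_dcutoff_le (e x : R) : 0 < e -> 0 < x < pi ->
  `|parab x * dcutoff e x| <= 4 * pi * defect e x.
Proof.
move=> e0 /andP[x0 xpi]; have D0 := denominator_gt0 x e0.
have b0 : 0 <= parab x by rewrite mulr_ge0 ?subr_ge0// ltW.
have m0 : 0 <= excess e x by rewrite le_max lexx.
have bm : parab x * excess e x <= 2 * (excess e x ^+ 2 + e ^+ 2).
  have [xe|ex] := leP (parab x) e.
    have -> : excess e x = 0 by apply/max_idPl; rewrite subr_le0.
    by rewrite mulr0 mulr_ge0// expr0n add0r sqr_ge0.
  have -> : parab x = excess e x + e.
    have -> : excess e x = parab x - e by apply/max_idPr; rewrite subr_ge0 ltW.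
    by rewrite subrK.
  by move: (excess e x) m0 => m m0; nra.
have dw : `|pi - 2 * x| <= pi by rewrite ler_norml; apply/andP; split; lra.
have -> : parab x * dcutoff e x = (parab x * excess e x) *
    (2 * e ^+ 2 / (excess e x ^+ 2 + e ^+ 2) ^+ 2) * (pi - 2 * x).
  by rewrite /dcutoff; ring.
have c0 : 0 <= 2 * e ^+ 2 / (excess e x ^+ 2 + e ^+ 2) ^+ 2.
  by rewrite divr_ge0 ?sqr_ge0// mulr_ge0// sqr_ge0.
have p0 : 0 <= parab x * excess e x *
    (2 * e ^+ 2 / (excess e x ^+ 2 + e ^+ 2) ^+ 2) by apply: mulr_ge0 => //; exact: mulr_ge0.
rewrite normrM (ger0_norm p0).
have -> : 4 * pi * defect e x = 2 * (excess e x ^+ 2 + e ^+ 2) *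
    (2 * e ^+ 2 / (excess e x ^+ 2 + e ^+ 2) ^+ 2) * pi.
  by rewrite /defect; field; rewrite gt_eqF.
by rewrite ler_pM// ler_wpM2r.
Qed.

Lemma defect_cvg0 (x : R) : 0 < x < pi ->
  (fun n => defect n.+1%:R^-1 x) @ \oo --> (0 : R).
Proof.
move=> /andP[x0 xpi]; have b0 : 0 < parab x by rewrite mulr_gt0 ?subr_gt0.
apply: (@squeeze_cvgr _ _ _ _ (fun=> 0) (fun n => 4 / parab x ^+ 2 * n.+1%:R^-1));
  last first.
- rewrite -[X in _ --> X](mulr0 (4 / parab x ^+ 2)).
  by apply: cvgMl_tmp; exact: cvg_harmonic.
- exact: cvg_cst.
have h1 : \forall n \near \oo, n.+1%:R^-1 < parab x / 2.
  by apply: (cvgr_lt (0 : R)); [exact: cvg_harmonic|rewrite divr_gt0].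
near=> n; have e0 : 0 < n.+1%:R^-1 :> R by rewrite invr_gt0.
have /andP[-> _] := defect_bounds x e0.
have e1 : n.+1%:R^-1 <= 1 :> R by rewrite invf_le1// ler1n.
have eb : n.+1%:R^-1 < parab x / 2 by near: n.
rewrite /defect; move: (n.+1%:R^-1 : R) e0 e1 eb => e e0 e1 eb.
have -> : excess e x = parab x - e by apply/max_idPr; rewrite subr_ge0; lra.
have D0 : 0 < (parab x - e) ^+ 2 + e ^+ 2 by rewrite ltr_wpDl ?sqr_ge0// exprn_gt0.
rewrite ler_pdivrMr//.
have h : parab x ^+ 2 / 4 <= (parab x - e) ^+ 2 + e ^+ 2.
  have : (parab x / 2) ^+ 2 <= (parab x - e) ^+ 2 by rewrite ler_pXn2r ?nnegrE ?subr_ge0 ?divr_ge0 ?(ltW b0)//; lra.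
  by have := sqr_ge0 e; lra.
apply: (@le_trans _ _ e); first by rewrite expr2 ler_piMr// ltW.
apply: (@le_trans _ _ (4 / parab x ^+ 2 * e * (parab x ^+ 2 / 4))).
  by rewrite le_eqVlt; apply/orP; left; apply/eqP; field; rewrite gt_eqF.
by rewrite ler_wpM2l// mulr_ge0 ?(ltW e0)// divr_ge0// sqr_ge0.
Unshelve. all: by end_near. Qed.

Lemma le_parab (g dg : R -> R) : (forall x, is_derive x (1 : R) g (dg x)) ->
  continuous dg -> g 0 = 0 -> g pi = 0 ->
  exists2 C, 0 <= C & forall x, 0 < x < pi -> `|g x| <= C * parab x.
Proof.
move=> Dg cdg g0 gpi; have [M M0 dM] := continuous_bounded cdg.
have cg := derive_continuous Dg.
have pi0 := pi_gt0 R.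
exists (2 * M / pi); first by rewrite divr_ge0 ?mulr_ge0// ltW.
move=> x /andP[x0 xpi].
have gl : `|g x| <= M * x.
  have [c] := MVT_segment (ltW x0) (fun x _ => Dg x) (continuous_subspaceT cg).
  rewrite in_itv /= g0 !subr0 => /andP[c0 cx] ->; rewrite normrM (gtr0_norm x0).
  by rewrite ler_wpM2r ?(ltW x0)// dM// c0 (le_trans cx)// ltW.
have gr : `|g x| <= M * (pi - x).
  have [c] := MVT_segment (ltW xpi) (fun x _ => Dg x) (continuous_subspaceT cg).
  rewrite in_itv /= gpi sub0r => /andP[xc cpi] e.
  have -> : g x = - (dg c * (pi - x)) by rewrite -e opprK.
  have p0 : 0 <= pi - x by rewrite subr_ge0 ltW.
  rewrite normrN normrM (ger0_norm p0).
  by rewrite ler_wpM2r// dM// cpi andbT (le_trans (ltW x0)).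
have [xh|hx] := leP x (pi / 2).
  apply: le_trans gl _; rewrite /parab.
  have -> : 2 * M / pi * (x * (pi - x)) = M * x * (2 * (pi - x) / pi).
    by move: (pi : R) pi0 => p p0; field; rewrite gt_eqF.
  by rewrite ler_peMr ?mulr_ge0 ?(ltW x0)// ler_pdivlMr//; lra.
apply: le_trans gr _; rewrite /parab.
have -> : 2 * M / pi * (x * (pi - x)) = M * (pi - x) * (2 * x / pi).
  by move: (pi : R) pi0 => p p0; field; rewrite gt_eqF.
by rewrite ler_peMr ?mulr_ge0 ?subr_ge0 ?(ltW xpi)// ler_pdivlMr//; lra.
Qed.

End cutoff.

(** * Weak derivatives *)

Lemma seq_lim_unique (R : realType) (f g : nat -> R) (a b : R) :
  f @ \oo --> a -> g @ \oo --> b -> f =1 g -> a = b.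
Proof.
move=> fa gb /funext fg; rewrite -(cvg_lim (@Rhausdorff R) fa).
by rewrite -(cvg_lim (@Rhausdorff R) gb) fg.
Qed.

Lemma seq_cvgD (R : realType) (f g : nat -> R) (a b : R) :
  f @ \oo --> a -> g @ \oo --> b -> (fun n => f n + g n) @ \oo --> a + b.
Proof. by move=> fa gb; exact: cvgD. Qed.

Lemma seq_cvgN (R : realType) (f : nat -> R) (a : R) :
  f @ \oo --> a -> (fun n => - f n) @ \oo --> - a.
Proof. by move=> fa; exact: cvgN. Qed.

Lemma seq_cvgM (R : realType) (f g : nat -> R) (a b : R) :
  f @ \oo --> a -> g @ \oo --> b -> (fun n => f n * g n) @ \oo --> a * b.
Proof. by move=> fa gb; exact: cvgM. Qed.

Lemma seq_cvgZ (R : realType) (c : R) (f : nat -> R) (a : R) :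
  f @ \oo --> a -> (fun n => c * f n) @ \oo --> c * a.
Proof. by move=> fa; exact: cvgMl_tmp. Qed.

Section sobolev.
Context {R : realType}.
Implicit Types u v du dv g dg phi : R -> R.
Local Notation I := (@int_I0pi R).

Lemma test_function_is_derive phi : test_function phi ->
  forall x, is_derive x (1 : R) phi (derive1 phi x).
Proof.
by move=> [Dphi _ _ _] x; rewrite derive1E; apply: DeriveDef => //; exact: Dphi.
Qed.

Lemma test_function_derive_continuous phi : test_function phi -> continuous (derive1 phi).
Proof. by case. Qed.

Lemma test_function_out phi x : test_function phi -> ~~ (0 < x < pi) -> phi x = 0.
Proof.
move=> [_ _ _ sphi]; apply: contraNeq => phix; apply/I0piP; apply: sphi.
by apply: subset_closure.
Qed.

Lemma derive1_is_derive (f : R -> R) df : (forall x, is_derive x (1 : R) f (df x)) ->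
  derive1 f = df.
Proof. by move=> Df; apply/funext => x; rewrite derive1E; case: (Df x). Qed.

Lemma cutoff_mul_is_derive (e : R) g dg : 0 < e ->
  (forall x, is_derive x (1 : R) g (dg x)) ->
  forall x, is_derive x (1 : R) (fun x => cutoff e x * g x)
    (dcutoff e x * g x + cutoff e x * dg x).
Proof.
move=> e0 Dg x; have Dc := is_derive_cutoff x e0.
have -> : (fun x => cutoff e x * g x) = cutoff e * g by [].
by apply: is_derive_eq; rewrite /GRing.scale /=; ring.
Qed.

Lemma cutoff_continuous (e : R) : 0 < e -> continuous (cutoff e).
Proof. by move=> e0; exact: derive_continuous (fun x => is_derive_cutoff x e0). Qed.

Lemma test_function_cutoff (e : R) g dg : 0 < e ->
  (forall x, is_derive x (1 : R) g (dg x)) -> continuous dg ->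
  test_function (fun x => cutoff e x * g x).
Proof.
move=> e0 Dg cdg; have Dcg := cutoff_mul_is_derive e0 Dg.
have sub : closure [set x | cutoff e x * g x != 0] `<=` [set x | e <= parab x].
  have cl : closed [set x | e <= parab x].
    have -> : [set x | e <= parab x] = parab @^-1` [set y | e <= y] by [].
    by apply: preimage_closed; [move=> x _; exact: parab_continuous|exact: closed_ge].
  rewrite [X in _ `<=` X](closure_id _).1//; apply: closureS => x /=.
  apply: contraNT; rewrite -ltNge => xe.
  by rewrite cutoff_eq0 ?mul0r// ltW.
have subI : [set x | e <= parab x] `<=` I0pi R.
  move=> x /= ex; apply/I0piP; have b0 : 0 < parab x by exact: lt_le_trans ex.
  have pi0 := pi_gt0 R; move: b0; rewrite /parab.
  have [x0|x0] := leP x 0.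
    by rewrite ltNge mulr_le0_ge0// subr_ge0 (le_trans x0)// ltW.
  by rewrite pmulr_rgt0// subr_gt0.
split.
- by move=> x; case: (Dcg x).
- rewrite (derive1_is_derive Dcg).
  apply: contD; apply: contM => //; first exact: dcutoff_continuous.
    exact: derive_continuous Dg.
  exact: cutoff_continuous.
- apply: (subclosed_compact _ (@segment_compact R 0 pi)); first exact: closed_closure.
  move=> x /sub /subI /I0piP /andP[x0 xpi].
  by rewrite /= in_itv /= !ltW.
- exact: subset_trans subI.
Qed.

Lemma H1_pair_classical u du : (forall x, is_derive x (1 : R) u (du x)) ->
  continuous du -> H1_pair u du.
Proof.
move=> Du cdu; have cu := derive_continuous Du; split; try exact: L2_continuous.
move=> phi tphi.
rewrite (int_by_parts Du cdu (test_function_is_derive tphi)); last first.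
  exact: test_function_derive_continuous.
by rewrite !(test_function_out tphi) ?ltxx ?andbF// !mulr0 subrr sub0r.
Qed.

Lemma test_function_L2 phi : test_function phi -> L2 phi /\ L2 (derive1 phi).
Proof.
move=> t; split; apply: L2_continuous; last exact: test_function_derive_continuous.
exact: derive_continuous (test_function_is_derive t).
Qed.

Lemma H1_pair_test phi : test_function phi -> H1_pair phi (derive1 phi).
Proof.
move=> t; apply: H1_pair_classical; first exact: test_function_is_derive.
exact: test_function_derive_continuous.
Qed.

Local Notation eps n := (n.+1%:R^-1 : R).

Lemma eps_gt0 n : 0 < eps n. Proof. by rewrite invr_gt0. Qed.

Lemma cutoff_bounds (e x : R) : 0 < e -> 0 <= cutoff e x <= 1.
Proof.
move=> e0; have /andP[h0 h1] := defect_bounds x e0.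
by rewrite /cutoff subr_ge0 h1 gerBl.
Qed.

Lemma cutoff_cvg1 (x : R) : 0 < x < pi -> (fun n => cutoff (eps n) x) @ \oo --> (1 : R).
Proof.
move=> xI; rewrite -[X in _ --> X]subr0.
by apply: cvgB; [exact: cvg_cst|exact: defect_cvg0].
Qed.

Lemma int_cutoff_cvg f : intble f ->
  (fun n => I (fun x => cutoff (eps n) x * f x)) @ \oo --> I f.
Proof.
move=> fi; apply: (@dominated_int _ _ _ (fun x => `|f x|)).
- move=> n; apply: measurable_funM; last exact: intble_measurable.
  by apply: continuous_measurable; apply: cutoff_continuous; exact: eps_gt0.
- exact: intble_measurable.
- exact: intble_norm.
- move=> x xI; rewrite -[X in _ --> X]mul1r.
  by apply: cvgM; [exact: cutoff_cvg1|exact: cvg_cst].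
- move=> n x _; have /andP[h0 h1] := cutoff_bounds x (eps_gt0 n).
  by rewrite normrM (ger0_norm h0) ler_piMl.
Qed.

(** The derivative of the cutoff is large near the ends, but only as large as the
   inverse of parab, which compensates the zeros of g. *)
Lemma dcutoff_mul_le g (C : R) : 0 <= C ->
  (forall x, 0 < x < pi -> `|g x| <= C * parab x) ->
  forall n x, 0 < x < pi ->
  `|dcutoff (eps n) x * g x| <= C * (4 * pi) * defect (eps n) x.
Proof.
move=> C0 gC n x xI; have b0 : 0 <= parab x.
  by move/andP: xI => [? ?]; rewrite mulr_ge0 ?subr_ge0 ?ltW.
have := parab_dcutoff_le (eps_gt0 n) xI.
rewrite normrM (ger0_norm b0) => h; rewrite normrM.
apply: (@le_trans _ _ (`|dcutoff (eps n) x| * (C * parab x))).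
  by rewrite ler_wpM2l// gC.
rewrite mulrCA -[leRHS]mulrA ler_wpM2l//; apply: le_trans h.
by rewrite mulrC.
Qed.

Lemma int_dcutoff_cvg0 f g dg : intble f ->
  (forall x, is_derive x (1 : R) g (dg x)) -> continuous dg -> g 0 = 0 -> g pi = 0 ->
  (fun n => I (fun x => dcutoff (eps n) x * g x * f x)) @ \oo --> (0 : R).
Proof.
move=> fi Dg cdg g0 gpi; have [C C0 gC] := le_parab Dg cdg g0 gpi.
have bnd := dcutoff_mul_le C0 gC.
have pi4 : 0 <= C * (4 * pi) by rewrite !mulr_ge0// pi_ge0.
rewrite -[X in _ --> X]int0.
apply: (@dominated_int _ _ _ (fun x => C * (4 * pi) * `|f x|)).
- move=> n; apply: measurable_funM; last exact: intble_measurable.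
  apply: continuous_measurable; apply: contM; last exact: derive_continuous Dg.
  by apply: dcutoff_continuous; exact: eps_gt0.
- by apply: continuous_measurable; exact: contC.
- exact/intbleZ/intble_norm.
- move=> x xI; apply/cvgr0Pnorm_le => e e0.
  have hz : (fun n => C * (4 * pi) * `|f x| * defect (eps n) x) @ \oo --> (0 : R).
    rewrite -[X in _ --> X](mulr0 (C * (4 * pi) * `|f x|)).
    by apply: cvgMl_tmp; exact: defect_cvg0.
  have /cvgr0Pnorm_le/(_ e e0) := hz; apply: filterS => n; apply: le_trans.
  rewrite normrM; apply: le_trans (ler_wpM2r (normr_ge0 _) (bnd n x xI)) _.
  by rewrite mulrAC ler_norm.
- move=> n x xI; have /andP[h0 h1] := defect_bounds x (eps_gt0 n).
  rewrite normrM ler_wpM2r//; apply: le_trans (bnd n x xI) _.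
  by rewrite ler_piMr.
Qed.

(** Test functions cutoff * g approximate g; the terms that carry the derivative of
   the cutoff disappear in the limit because g vanishes at the ends. *)
Lemma weak_by_parts_vanishing v dv g dg : H1_pair v dv ->
  (forall x, is_derive x (1 : R) g (dg x)) -> continuous dg -> g 0 = 0 -> g pi = 0 ->
  I (fun x => v x * dg x) = - I (fun x => dv x * g x).
Proof.
move=> [Lv Ldv wv] Dg cdg g0 gpi.
have cg := derive_continuous Dg.
have i1 : intble (fun x => v x * dg x) by exact/L2_mul/L2_continuous.
have i2 : intble (fun x => dv x * g x) by exact/L2_mul/L2_continuous.
have i3 : intble v by exact: L2_intble.
have E n : I (fun x => dcutoff (eps n) x * g x * v x) +
    I (fun x => cutoff (eps n) x * (v x * dg x)) =
    - I (fun x => cutoff (eps n) x * (dv x * g x)).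
  have := wv _ (test_function_cutoff (eps_gt0 n) Dg cdg).
  rewrite (derive1_is_derive (cutoff_mul_is_derive (eps_gt0 n) Dg)) => e.
  transitivity (I (fun x => v x * (dcutoff (eps n) x * g x + cutoff (eps n) x * dg x))).
    rewrite -intD.
    - by apply: int_eq => x _; ring.
    - apply: continuous_mul_intble => //; apply: contM => //.
      by apply: dcutoff_continuous; exact: eps_gt0.
    - apply: continuous_mul_intble => //.
      by apply: cutoff_continuous; exact: eps_gt0.
  by rewrite e; congr (- _); apply: int_eq => x _; ring.
have l1 := seq_cvgD (int_dcutoff_cvg0 i3 Dg cdg g0 gpi) (int_cutoff_cvg i1).
have l2 := seq_cvgN (int_cutoff_cvg i2).
rewrite add0r in l1.
exact: (seq_lim_unique l1 l2 E).
Qed.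

(** The products cutoff * u approximate u in H^1, by dominated convergence. *)
Lemma H10_classical u du : (forall x, is_derive x (1 : R) u (du x)) ->
  continuous du -> u 0 = 0 -> u pi = 0 -> H10 u.
Proof.
move=> Du cdu u0 upi; have cu := derive_continuous Du.
exists du; split; first exact: H1_pair_classical.
exists (fun n x => cutoff (eps n) x * u x); split.
  by move=> n; apply: test_function_cutoff => //; exact: eps_gt0.
have cutc n : continuous (cutoff (eps n)) by apply: cutoff_continuous; exact: eps_gt0.
have dcutc n : continuous (dcutoff (eps n)) by apply: dcutoff_continuous; exact: eps_gt0.
have [C C0 uC] := le_parab Du cdu u0 upi.
have i2 : intble (fun x => u x ^+ 2) by exact/continuous_intble/contX.
have i3 : intble (fun x => du x ^+ 2) by exact/continuous_intble/contX.
have defc n : continuous (fun x => 1 - cutoff (eps n) x).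
  by apply: contB => //; exact: contC.
have dcv (x : R) : 0 < x < pi -> (fun n => 1 - cutoff (eps n) x) @ \oo --> (0 : R).
  move=> xI; rewrite -(subrr 1).
  by apply: cvgB; [exact: cvg_cst|exact: cutoff_cvg1].
have cb n (x : R) : 0 <= 1 - cutoff (eps n) x <= 1.
  by have := cutoff_bounds x (eps_gt0 n); lra.
have bnd := dcutoff_mul_le C0 uC.
have pi4 : 0 <= C * (4 * pi) by rewrite !mulr_ge0// pi_ge0.
rewrite -[X in _ --> X]addr0; apply: cvgD.
  rewrite -[X in _ --> X]int0.
  apply: (@dominated_int _ (fun n x => (u x - cutoff (eps n) x * u x) ^+ 2) (fun=> 0)
    (fun x => u x ^+ 2)) => //.
  - move=> n; apply: continuous_measurable; apply: contX; apply: contB => //.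
    exact: contM.
  - move=> x xI /=.
    have -> : (fun n => (u x - cutoff (eps n) x * u x) ^+ 2) =
      (fun n => (1 - cutoff (eps n) x) * (1 - cutoff (eps n) x) * u x ^+ 2).
      by apply/funext => n; ring.
    have := seq_cvgM (seq_cvgM (dcv x xI) (dcv x xI)) (cvg_cst (u x ^+ 2)).
    by rewrite !mul0r; apply.
  - move=> n x xI; rewrite -{1}[u x]mul1r -mulrBl exprMn normrM.
    rewrite [`|u x ^+ 2|]ger0_norm ?sqr_ge0// ler_piMl ?sqr_ge0//.
    have /andP[h0 h1] := cb n x.
    by rewrite ger0_norm ?sqr_ge0// expr_le1.
rewrite -[X in _ --> X]int0.
have E n : derive1 (fun x => cutoff (eps n) x * u x) =
    (fun x => dcutoff (eps n) x * u x + cutoff (eps n) x * du x).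
  exact: derive1_is_derive (cutoff_mul_is_derive (eps_gt0 n) Du).
under eq_fun do rewrite E.
apply: (@dominated_int _ (fun n x => (du x -
    (dcutoff (eps n) x * u x + cutoff (eps n) x * du x)) ^+ 2) (fun=> 0)
    (fun x => 2 * du x ^+ 2 + 2 * (C * (4 * pi)) ^+ 2)).
- move=> n; apply: continuous_measurable; apply: contX; apply: contB => //.
  by apply: contD; exact: contM.
- by apply: continuous_measurable; exact: contC.
- by apply: intbleD; [exact: intbleZ|exact/continuous_intble/contC].
- move=> x xI.
  have hz : (fun n => (1 - cutoff (eps n) x) * du x - dcutoff (eps n) x * u x)
      @ \oo --> (0 : R).
    rewrite -[X in _ --> X]subr0; apply: cvgB.
      rewrite -[X in _ --> X](mul0r (du x)).
      by apply: cvgM; [exact: dcv|exact: cvg_cst].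
    apply/cvgr0Pnorm_le => e e0.
    have hz : (fun n => C * (4 * pi) * defect (eps n) x) @ \oo --> (0 : R).
      rewrite -[X in _ --> X](mulr0 (C * (4 * pi))).
      by apply: cvgMl_tmp; exact: defect_cvg0.
    have /cvgr0Pnorm_le/(_ e e0) := hz; apply: filterS => n; apply: le_trans.
    by apply: le_trans (bnd n x xI) _; exact: ler_norm.
  have := seq_cvgM hz hz; rewrite mulr0 => hz2 /=.
  have -> // : (fun n => (du x - (dcutoff (eps n) x * u x + cutoff (eps n) x * du x)) ^+ 2)
    = (fun n => ((1 - cutoff (eps n) x) * du x - dcutoff (eps n) x * u x) *
      ((1 - cutoff (eps n) x) * du x - dcutoff (eps n) x * u x)).
  by apply/funext => n; ring.
- move=> n x xI.
  have -> : du x - (dcutoff (eps n) x * u x + cutoff (eps n) x * du x) =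
    (1 - cutoff (eps n) x) * du x - dcutoff (eps n) x * u x by ring.
  have h1 : ((1 - cutoff (eps n) x) * du x) ^+ 2 <= du x ^+ 2.
    rewrite exprMn ler_piMl ?sqr_ge0//.
    by have /andP[? ?] := cb n x; rewrite expr_le1.
  have h2 : (dcutoff (eps n) x * u x) ^+ 2 <= (C * (4 * pi)) ^+ 2.
    rewrite -[leLHS]ger0_norm ?sqr_ge0// normrX ler_pXn2r ?nnegrE//.
    apply: le_trans (bnd n x xI) _.
    by have /andP[? ?] := defect_bounds x (eps_gt0 n); rewrite ler_piMr.
  rewrite ger0_norm ?sqr_ge0//.
  move: (_ * du x) (_ * u x) ((C * _) ^+ 2) h1 h2 => a b c h1 h2.
  by have := sqr_ge0 (a + b); lra.
Qed.

Lemma sqr_dominated_cvg0 (a b : nat -> R) (C : R) :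
  (forall n, a n ^+ 2 <= C * b n) -> b @ \oo --> (0 : R) -> a @ \oo --> (0 : R).
Proof.
move=> ab b0; apply/cvgr0Pnorm_le => e e0.
have Cb : (fun n => C * b n) @ \oo --> (0 : R).
  by rewrite -[X in _ --> X](mulr0 C); exact: cvgMl_tmp.
have /cvgr0Pnorm_le/(_ _ (exprn_gt0 2 e0)) := Cb; apply: filterS => n h.
rewrite -(@ler_pXn2r _ 2) ?nnegrE ?(ltW e0)// -normrX ger0_norm ?sqr_ge0//.
by apply: le_trans (ab n) _; apply: le_trans h; exact: ler_norm.
Qed.

(** Here g need not vanish at the ends: approximation of v by test functions gives
   the formula for the derivative dw that comes with membership in H^1_0, and dv
   and dw have the same integrals against cutoff * g, hence against g. *)
Lemma weak_by_parts_H10 v dv g dg : H10 v -> H1_pair v dv ->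
  (forall x, is_derive x (1 : R) g (dg x)) -> continuous dg ->
  I (fun x => v x * dg x) = - I (fun x => dv x * g x).
Proof.
move=> [dw [[Lv Ldw ww] [phi [tphi cphi]]]] [_ Ldv wv] Dg cdg.
have cg := derive_continuous Dg.
have Lg := L2_continuous cg; have Ldg := L2_continuous cdg.
have -> : I (fun x => dv x * g x) = I (fun x => dw x * g x).
  have idv := L2_mul Ldv Lg; have idw := L2_mul Ldw Lg.
  apply: (seq_lim_unique (int_cutoff_cvg idv) (int_cutoff_cvg idw)) => n.
  have tn := test_function_cutoff (eps_gt0 n) Dg cdg.
  have := wv _ tn; rewrite (ww _ tn) => /oppr_inj e.
  transitivity (I (fun x => dv x * (cutoff (eps n) x * g x))).
    by apply: int_eq => x _; ring.
  by rewrite -e; apply: int_eq => x _; ring.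
have E n : I (fun x => phi n x * dg x) = - I (fun x => derive1 (phi n) x * g x).
  rewrite (int_by_parts (test_function_is_derive (tphi n)) _ Dg cdg); last first.
    exact: test_function_derive_continuous.
  by rewrite !(test_function_out (tphi n)) ?ltxx ?andbF// !mul0r subrr sub0r.
have Lphi n := (test_function_L2 (tphi n)).1.
have Ldphi n := (test_function_L2 (tphi n)).2.
have c1 : (fun n => I (fun x => (v x - phi n x) * dg x)) @ \oo --> (0 : R).
  apply: (@sqr_dominated_cvg0 _ _ (I (fun x => dg x ^+ 2)) _ cphi) => n.
  apply: le_trans (cauchy_schwarz (L2B Lv (Lphi n)) Ldg) _.
  by rewrite mulrC ler_wpM2l ?int_sqr_ge0// lerDl int_sqr_ge0.
have c2 : (fun n => I (fun x => (dw x - derive1 (phi n) x) * g x)) @ \oo --> (0 : R).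
  apply: (@sqr_dominated_cvg0 _ _ (I (fun x => g x ^+ 2)) _ cphi) => n.
  apply: le_trans (cauchy_schwarz (L2B Ldw (Ldphi n)) Lg) _.
  by rewrite mulrC ler_wpM2l ?int_sqr_ge0// lerDr int_sqr_ge0.
have c := seq_cvgD c1 c2; rewrite addr0 in c.
apply/eqP; rewrite -subr_eq0 opprK; apply/eqP.
apply: (seq_lim_unique (cvg_cst _) c) => n /=.
have -> : I (fun x => (v x - phi n x) * dg x) =
    I (fun x => v x * dg x) - I (fun x => phi n x * dg x).
  by rewrite -intB; [apply: int_eq => x _; ring|exact: L2_mul..].
have -> : I (fun x => (dw x - derive1 (phi n) x) * g x) =
    I (fun x => dw x * g x) - I (fun x => derive1 (phi n) x * g x).
  by rewrite -intB; [apply: int_eq => x _; ring|exact: L2_mul..].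
by rewrite E; ring.
Qed.

End sobolev.

(** * Absolutely convergent series of functions *)

Section function_series.
Context {R : realType}.
Local Notation I := (@int_I0pi R).

Definition fsum (f : nat -> R -> R) (t : R) : R :=
  lim ((fun K => \sum_(k < K) f k t) @ \oo).

Definition summable_by (a : nat -> R) (C : R) : Prop :=
  forall K, \sum_(k < K) `|a k| <= C.

Lemma summable_cvg (a : nat -> R) C : summable_by a C ->
  cvgn (fun K => \sum_(k < K) `|a k|).
Proof.
move=> aC; apply: nondecreasing_is_cvgn.
  apply/nondecreasing_seqP => K; rewrite big_ord_recr /= lerDl.
  exact: normr_ge0.
by exists C => _ [K _ <-].
Qed.

Lemma sum_ord_split (f : nat -> R) K M : (K <= M)%N ->
  \sum_(k < M) f k = \sum_(k < K) f k + \sum_(K <= k < M) f k.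
Proof.
move=> KM; rewrite -!(big_mkord xpredT f).
by rewrite (big_cat_nat (leq0n K) KM).
Qed.

Section dominated.
Variables (a : nat -> R) (C : R) (f : nat -> R -> R).
Hypothesis aC : summable_by a C.
Hypothesis fa : forall k t, `|f k t| <= `|a k|.

Lemma fsum_cvg t : (fun K => \sum_(k < K) f k t) @ \oo --> fsum f t.
Proof.
have : cvgn (series (fun k => `|f k t|)).
  apply: nondecreasing_is_cvgn.
    apply/nondecreasing_seqP => K; rewrite /series /= big_nat_recr//= lerDl.
    exact: normr_ge0.
  exists C => _ [K _ <-]; rewrite /series /= big_mkord; apply: le_trans (aC K).
  by apply: ler_sum => k _; exact: fa.
move/normed_cvg; rewrite /fsum.
have -> : series (f^~ t) = (fun K => \sum_(k < K) f k t).
  by apply/funext => K; rewrite /series /= big_mkord.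
by [].
Qed.

(** The tail of the dominating series serves all points at once. *)
Lemma fsum_tail : exists2 tail : nat -> R, tail @ \oo --> (0 : R) &
  forall K t, `|fsum f t - \sum_(k < K) f k t| <= tail K.
Proof.
pose S := lim ((fun K => \sum_(k < K) `|a k|) @ \oo).
have cS : (fun K => \sum_(k < K) `|a k|) @ \oo --> S := summable_cvg aC.
exists (fun K => S - \sum_(k < K) `|a k|).
  have := seq_cvgD (cvg_cst S) (seq_cvgN cS); rewrite subrr; exact.
move=> K t; have l1 : (fun M => \sum_(k < M) f k t - \sum_(k < K) f k t) @ \oo -->
    fsum f t - \sum_(k < K) f k t.
  by apply: cvgB; [exact: fsum_cvg|exact: cvg_cst].
have l2 : (fun M => \sum_(k < M) `|a k| - \sum_(k < K) `|a k|) @ \oo -->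
    S - \sum_(k < K) `|a k|.
  by apply: cvgB => //; exact: cvg_cst.
apply: (ler_cvg_to (cvg_norm l1) l2); near=> M.
have KM : (K <= M)%N by near: M; exact: nbhs_infty_ge.
rewrite (sum_ord_split (f^~ t) KM) (sum_ord_split (fun k => `|a k|) KM).
rewrite ![_ + (\sum_(_ <= _ < _) _)]addrC !addrK.
apply: le_trans (ler_norm_sum _ _ _) _.
by apply: ler_sum => k _; exact: fa.
Unshelve. all: by end_near. Qed.

Lemma fsum_continuous : (forall k, continuous (f k)) -> continuous (fsum f).
Proof.
move=> cf t; have [tail t0 ft] := fsum_tail.
apply/cvgrPdist_le => e e0.
have e3 : 0 < e / 3 by rewrite divr_gt0.
have /cvgr0Pnorm_le/(_ _ e3)[K _ /(_ K (leqnn K)) tK] := t0.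
have cK : continuous (fun s => \sum_(k < K) f k s).
  by apply: continuous_big => [|k _]; [exact: add_continuous|exact: cf].
have /cvgrPdist_le/(_ _ e3) := cK t; apply: filterS => s hs.
have h1 := le_trans (ft K t) (le_trans (ler_norm _) tK).
have h2 := le_trans (ft K s) (le_trans (ler_norm _) tK).
have -> : fsum f t - fsum f s = (fsum f t - \sum_(k < K) f k t) +
  (\sum_(k < K) f k t - \sum_(k < K) f k s) - (fsum f s - \sum_(k < K) f k s) by ring.
apply: le_trans (ler_normB _ _) _.
apply: le_trans (lerD (ler_normD _ _) (lexx _)) _.
lra.
Qed.

Lemma int_fsum v : (forall k, continuous (f k)) -> intble v ->
  (fun K => \sum_(k < K) I (fun x => f k x * v x)) @ \oo -->
  I (fun x => fsum f x * v x).
Proof.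
move=> cf vi; have [tail t0 ft] := fsum_tail.
have cF := fsum_continuous cf.
have i1 : intble (fun x => fsum f x * v x) by exact: continuous_mul_intble.
have i2 k : intble (fun x => f k x * v x) by exact: continuous_mul_intble.
have iv := intble_norm vi.
apply/cvgrPdist_le => e e0.
have c0 : (fun K => tail K * I (fun x => `|v x|)) @ \oo --> (0 : R).
  by have := seq_cvgM t0 (cvg_cst (I (fun x => `|v x|))); rewrite mul0r; apply.
have /cvgr0Pnorm_le/(_ _ e0) := c0; apply: filterS => K hK.
apply: le_trans _ hK; apply: le_trans _ (ler_norm _).
rewrite -(@int_sum _ K (fun k x => f k x * v x)); last by move=> k _; exact: i2.
have i3 : intble (fun x => \sum_(k < K) f k x * v x).
  by apply: (@intble_sum _ K (fun k x => f k x * v x)) => k _; exact: i2.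
rewrite -intB//; apply: le_trans (le_int_norm (intbleB i1 i3)) _.
rewrite -intZ//; apply: le_int; [exact/intble_norm/intbleB|exact: intbleZ|].
by move=> x _; rewrite -mulr_suml -mulrBl normrM ler_wpM2r.
Qed.

End dominated.

Lemma fsum_derive (f df : nat -> R -> R) (a da b : nat -> R) (A dA B : R) :
  summable_by a A -> (forall k t, `|f k t| <= `|a k|) ->
  summable_by da dA -> (forall k t, `|df k t| <= `|da k|) ->
  summable_by b B ->
  (forall k t h, `|f k (t + h) - f k t - h * df k t| <= `|b k| * h ^+ 2) ->
  forall t, is_derive t (1 : R) (fsum f) (fsum df t).
Proof.
move=> aA fa daA dfa bB fb t; apply: (@derive_of_quadratic_bound _ _ _ _ B) => h.
have c1 := fsum_cvg aA fa (t := t + h); have c2 := fsum_cvg aA fa (t := t).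
have c3 := fsum_cvg daA dfa (t := t).
have c : (fun K => \sum_(k < K) f k (t + h) - \sum_(k < K) f k t
    - h * \sum_(k < K) df k t) @ \oo --> fsum f (t + h) - fsum f t - h * fsum df t.
  by apply: cvgB; [exact: cvgB|exact: cvgMl_tmp].
apply: (cvgr_to_le (cvg_norm c)); apply: nearW => K.
rewrite mulr_sumr -!sumrB; apply: le_trans (ler_norm_sum _ _ _) _.
apply: (@le_trans _ _ (\sum_(k < K) `|b k| * h ^+ 2)).
  by apply: ler_sum => k _; exact: fb.
by rewrite -mulr_suml ler_wpM2r ?sqr_ge0.
Qed.

End function_series.

(** * Eigenfunctions from coefficient sequences *)

(** What the two boundary value problems have in common: an orthonormal system of
   eigenfunctions e of the operator - d^2/dx^2 with form domain V, where kap lists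
   the eigenvalues and de the derivatives. The condition in mode_mem transfers to u
   whatever boundary values all the e k share. *)
Record mode_system (R : realType) (V : set (R -> R)) (beta : R) (kap : nat -> R)
    (e de : nat -> R -> R) : Prop := ModeSystem {
  mode_beta_ge0 : 0 <= beta;
  mode_kap_ge : forall k, k%:R ^+ 2 <= kap k;
  mode_derive : forall k x, is_derive x (1 : R) (e k) (de k x);
  mode_derive2 : forall k x, is_derive x (1 : R) (de k) (- (kap k * e k x));
  mode_bound : forall k x, `|e k x| <= beta;
  mode_dbound : forall k x, `|de k x| <= beta * (1 + kap k);
  mode_ortho : forall k l, int_I0pi (fun x => e k x * e l x) = (k == l)%:R;
  mode_complete : forall h : R -> R, continuous h ->
    (forall k, int_I0pi (fun x => h x * e k x) = 0) ->
    forall x : R, 0 < x < pi -> h x = 0;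
  mode_by_parts : forall (v dv : R -> R) k, V v -> H1_pair v dv ->
    int_I0pi (fun x => dv x * de k x) = kap k * int_I0pi (fun x => v x * e k x);
  mode_mem : forall u du : R -> R, (forall x, is_derive x (1 : R) u (du x)) -> continuous du ->
    (forall t : R, (forall k, e k t = 0) -> u t = 0) -> V u }.

Section modes.
Context {R : realType} {V : set (R -> R)} {beta : R} {kap : nat -> R}.
Context {e de : nat -> R -> R}.
Hypothesis ms : mode_system V beta kap e de.
Local Notation I := (@int_I0pi R).

Lemma mode_kap_ge0 k : 0 <= kap k.
Proof. exact: le_trans (sqr_ge0 _) (mode_kap_ge ms k). Qed.

Lemma mode_continuous k : continuous (e k).
Proof. exact: derive_continuous (mode_derive ms k). Qed.

Lemma mode_dcontinuous k : continuous (de k).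
Proof. exact: derive_continuous (mode_derive2 ms k). Qed.

Lemma mode_taylor k t h :
  `|e k (t + h) - e k t - h * de k t| <= kap k * beta * h ^+ 2.
Proof.
apply: (taylor_of_derive (mode_derive ms k)).
apply: (lipschitz_of_derive (mode_derive2 ms k)) => x.
rewrite normrN normrM (ger0_norm (mode_kap_ge0 k)).
by rewrite ler_wpM2l ?mode_kap_ge0// (mode_bound ms).
Qed.

Definition mode_sum (x : nat -> R) : R -> R := fsum (fun k t => x k * e k t).
Definition mode_dsum (x : nat -> R) : R -> R := fsum (fun k t => x k * de k t).

Section coefficients.
Variables (x : nat -> R) (C : R).
Hypothesis xC : summable_by (fun k => (1 + kap k) * x k) C.

Let kap1 k : 1 <= 1 + kap k. Proof. by rewrite lerDl mode_kap_ge0. Qed.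
Let kap1_ge0 k : 0 <= 1 + kap k. Proof. exact: le_trans (kap1 k). Qed.

Let scaled (a : nat -> R) : summable_by a C -> summable_by (fun k => beta * a k) (beta * C).
Proof.
move=> aC K; under eq_bigr do rewrite normrM (ger0_norm (mode_beta_ge0 ms)).
by rewrite -mulr_sumr ler_wpM2l ?(mode_beta_ge0 ms).
Qed.

Lemma coefficients_summable : summable_by x C.
Proof.
move=> K; apply: le_trans (xC K); apply: ler_sum => k _.
by rewrite normrM (ger0_norm (kap1_ge0 k)) ler_peMl.
Qed.

Let xe k t : `|x k * e k t| <= `|beta * x k|.
Proof.
rewrite mulrC !normrM (ger0_norm (mode_beta_ge0 ms)).
by rewrite ler_wpM2r// (mode_bound ms).
Qed.

Let xde k t : `|x k * de k t| <= `|beta * ((1 + kap k) * x k)|.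
Proof.
have b0 : 0 <= beta * (1 + kap k) by rewrite mulr_ge0 ?(mode_beta_ge0 ms).
have -> : `|beta * ((1 + kap k) * x k)| = `|x k| * (beta * (1 + kap k)).
  by rewrite mulrA normrM mulrC (ger0_norm b0).
by rewrite normrM ler_wpM2l// (mode_dbound ms).
Qed.

Lemma mode_sum_derive t : is_derive t (1 : R) (mode_sum x) (mode_dsum x t).
Proof.
apply: (fsum_derive (scaled coefficients_summable) xe (scaled xC) xde (scaled xC)).
move=> k s h.
have -> : x k * e k (s + h) - x k * e k s - h * (x k * de k s) =
  x k * (e k (s + h) - e k s - h * de k s) by ring.
have b0 : 0 <= beta * (1 + kap k) by rewrite mulr_ge0 ?(mode_beta_ge0 ms).
have -> : `|beta * ((1 + kap k) * x k)| = `|x k| * (beta * (1 + kap k)).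
  by rewrite mulrA normrM mulrC (ger0_norm b0).
rewrite normrM -mulrA ler_wpM2l//.
apply: le_trans (mode_taylor k s h) _; rewrite ler_wpM2r ?sqr_ge0//.
by rewrite mulrC ler_wpM2l ?(mode_beta_ge0 ms)// lerDr.
Qed.

Lemma mode_sum_continuous : continuous (mode_sum x).
Proof. exact: derive_continuous mode_sum_derive. Qed.

Lemma mode_dsum_continuous : continuous (mode_dsum x).
Proof.
apply: (fsum_continuous (scaled xC) xde) => k.
exact/contZ/mode_dcontinuous.
Qed.

Lemma mode_sum_mem : V (mode_sum x).
Proof.
apply: (mode_mem ms mode_sum_derive mode_dsum_continuous) => t et.
have c0 : (fun _ : nat => 0 : R) @ \oo --> (0 : R) by exact: cvg_cst.
have c1 : (fun K => \sum_(k < K) x k * e k t) @ \oo --> mode_sum x t.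
  exact: (fsum_cvg (scaled coefficients_summable) xe).
apply: (seq_lim_unique c1 c0) => K; by rewrite big1// => k _; rewrite et mulr0.
Qed.

Lemma mode_sum_H1_pair : H1_pair (mode_sum x) (mode_dsum x).
Proof. exact: H1_pair_classical mode_sum_derive mode_dsum_continuous. Qed.

Lemma int_mode_sum v : intble v ->
  (fun K => \sum_(k < K) x k * I (fun t => e k t * v t)) @ \oo -->
  I (fun t => mode_sum x t * v t).
Proof.
move=> vi; have ce k : continuous (fun t => x k * e k t).
  exact/contZ/mode_continuous.
have -> : (fun K => \sum_(k < K) x k * I (fun t => e k t * v t)) =
    (fun K => \sum_(k < K) I (fun t => x k * e k t * v t)).
  apply/funext => K; apply: eq_bigr => k _.
  rewrite -intZ; first by apply: int_eq => t _; rewrite mulrA.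
  by apply: continuous_mul_intble => //; exact: mode_continuous.
exact: (int_fsum (scaled coefficients_summable) xe ce vi).
Qed.

Lemma int_mode_dsum v : intble v ->
  (fun K => \sum_(k < K) x k * I (fun t => de k t * v t)) @ \oo -->
  I (fun t => mode_dsum x t * v t).
Proof.
move=> vi; have ce k : continuous (fun t => x k * de k t).
  exact/contZ/mode_dcontinuous.
have -> : (fun K => \sum_(k < K) x k * I (fun t => de k t * v t)) =
    (fun K => \sum_(k < K) I (fun t => x k * de k t * v t)).
  apply/funext => K; apply: eq_bigr => k _.
  rewrite -intZ; first by apply: int_eq => t _; rewrite mulrA.
  by apply: continuous_mul_intble => //; exact: mode_dcontinuous.
exact: (int_fsum (scaled xC) xde ce vi).
Qed.

Lemma mode_sum_coefficient l : I (fun t => mode_sum x t * e l t) = x l.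
Proof.
have h := int_mode_sum (continuous_intble (@mode_continuous l)).
rewrite -(cvg_lim (@Rhausdorff R) h).
apply: (cvg_lim (@Rhausdorff R)); apply: cvg_near_cst.
near=> K; have lK : (l < K)%N by near: K; exact: nbhs_infty_gt.
rewrite (bigD1 (Ordinal lK))//= (mode_ortho ms) eqxx mulr1 big1 ?addr0// => k.
by rewrite -val_eqE /= (mode_ortho ms) => /negbTE ->; rewrite mulr0.
Unshelve. all: by end_near. Qed.

End coefficients.

Section eigenfunction.
Variables (q : R -> R) (Q : nat -> nat -> R) (nu : R) (x : nat -> R) (C : R).
Hypothesis cq : continuous q.
Hypothesis QE : forall k l, Q k l = I (fun t => q t * e k t * e l t).
Hypothesis xC : summable_by (fun k => (1 + kap k) * x k) C.
Hypothesis eqx : forall k, (fun K => \sum_(l < K) Q k l * x l) @ \oo -->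
  (nu - kap k) * x k.

Let y k := (nu - kap k) * x k.

Let bnd k (a : R) : `|y k * a| <= `|(`|nu| + 1) * ((1 + kap k) * x k)| * `|a|.
Proof.
rewrite /y !normrM ler_wpM2r// mulrA ler_wpM2r//.
have k0 := mode_kap_ge0 k; have n0 := normr_ge0 nu.
rewrite (ger0_norm (addr_ge0 n0 _))// (@ger0_norm _ (1 + kap k)) ?addr_ge0//.
apply: le_trans (ler_normB _ _) _; rewrite (ger0_norm k0).
by have := mulr_ge0 n0 k0; lra.
Qed.

Let a k := beta * ((`|nu| + 1) * ((1 + kap k) * x k)).

Let aC : summable_by a (beta * (`|nu| + 1) * C).
Proof.
move=> K; rewrite /a; under eq_bigr do rewrite mulrA normrM.
by rewrite -mulr_sumr ger0_norm ?ler_wpM2l ?mulr_ge0 ?addr_ge0 ?(mode_beta_ge0 ms).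
Qed.

Let ya k s : `|y k * e k s| <= `|a k|.
Proof.
rewrite /a [leRHS]normrM (ger0_norm (mode_beta_ge0 ms)) [leRHS]mulrC.
by apply: le_trans (bnd _ _) _; rewrite ler_wpM2l// (mode_bound ms).
Qed.

(** By the eigenvalue equation both sides have the coefficients
   (nu - kap k) * x k; they are continuous, so completeness identifies them. *)
Lemma potential_times_mode_sum t : 0 < t < pi ->
  q t * mode_sum x t = fsum (fun k t => y k * e k t) t.
Proof.
have ce k : continuous (fun t => y k * e k t) by exact/contZ/mode_continuous.
have cF := fsum_continuous aC ya ce.
have cu := mode_sum_continuous xC.
have ch : continuous (fun t => q t * mode_sum x t - fsum (fun k t => y k * e k t) t).
  by apply: contB => //; exact: contM.
move=> tI; apply/eqP; rewrite -subr_eq0; apply/eqP.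
apply: (mode_complete ms ch _ tI) => k.
have ie := continuous_intble (@mode_continuous k).
have -> : I (fun s => (q s * mode_sum x s - fsum (fun k t => y k * e k t) s) * e k s) =
    I (fun s => mode_sum x s * (q s * e k s)) -
    I (fun s => fsum (fun k t => y k * e k t) s * e k s).
  rewrite -intB.
  - by apply: int_eq => s _; ring.
  - apply: continuous_mul_intble => //.
    by apply: continuous_mul_intble => //.
  - exact: continuous_mul_intble.
have iq : intble (fun s => q s * e k s) by exact: continuous_mul_intble.
have c1 := int_mode_sum xC iq.
have -> : I (fun s => mode_sum x s * (q s * e k s)) = y k.
  apply: (seq_lim_unique c1 (eqx (k := k))) => K; apply: eq_bigr => l _.
  rewrite mulrC; congr (_ * _); rewrite QE.
  by apply: int_eq => s _; ring.
have c2 := int_fsum aC ya ce ie.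
suff -> : I (fun s => fsum (fun k t => y k * e k t) s * e k s) = y k by rewrite subrr.
rewrite -(cvg_lim (@Rhausdorff R) c2).
apply: (cvg_lim (@Rhausdorff R)); apply: cvg_near_cst.
have iyl l : I (fun s => y l * e l s * e k s) = y l * (l == k)%:R.
  rewrite -(mode_ortho ms) -intZ; first by apply: int_eq => s _; ring.
  by apply: continuous_mul_intble => //; exact: mode_continuous.
near=> K; have lK : (k < K)%N by near: K; exact: nbhs_infty_gt.
rewrite (bigD1 (Ordinal lK))//= iyl eqxx mulr1 big1 ?addr0// => l.
by rewrite -val_eqE /= iyl => /negbTE ->; rewrite mulr0.
Unshelve. all: by end_near. Qed.

(** The integral of du * dv produces the coefficients kap k * x k, the one of q * u * v
   the coefficients (nu - kap k) * x k. *)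
Lemma mode_sum_eigenspace : eigenspace_on V q nu (mode_sum x).
Proof.
split; first exact: (mode_sum_mem xC).
exists (mode_dsum x); split; first exact: (mode_sum_H1_pair xC).
move=> v dv Vv vdv; have [Lv Ldv _] := vdv.
have vi := L2_intble Lv; have dvi := L2_intble Ldv.
have cu := mode_sum_continuous xC; have cdu := mode_dsum_continuous xC.
have ce k : continuous (fun t => y k * e k t) by exact/contZ/mode_continuous.
have cF := fsum_continuous aC ya ce.
have c1 := int_mode_dsum xC dvi; have c2 := int_fsum aC ya ce vi.
have c3 := int_mode_sum xC vi.
have iev k : I (fun t => e k t * v t) = I (fun t => v t * e k t).
  by apply: int_eq => t _; rewrite mulrC.
have l2 := seq_cvgD c1 c2; have l1 := @seq_cvgZ R nu _ _ c3.
transitivity (I (fun t => mode_dsum x t * dv t) +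
    I (fun t => fsum (fun k s => y k * e k s) t * v t)).
  rewrite -intD; [|exact: continuous_mul_intble..].
  by apply: int_eq => t tI; rewrite potential_times_mode_sum.
apply: (seq_lim_unique l2 l1) => K; rewrite mulr_sumr -big_split; apply: eq_bigr => k _ /=.
have -> : I (fun t => de k t * dv t) = kap k * I (fun t => e k t * v t).
  rewrite iev -(mode_by_parts ms k Vv vdv).
  by apply: int_eq => t _; rewrite mulrC.
have -> : I (fun t => y k * e k t * v t) = y k * I (fun t => e k t * v t).
  rewrite -intZ; first by apply: int_eq => t _; rewrite mulrA.
  by apply: continuous_mul_intble => //; exact: mode_continuous.
by rewrite /y; ring.
Qed.

End eigenfunction.

(** Parseval's identity. *)
Lemma int_mode_sumM (x y : nat -> R) (Cx Cy l : R) :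
  summable_by (fun k => (1 + kap k) * x k) Cx ->
  summable_by (fun k => (1 + kap k) * y k) Cy ->
  (fun K => \sum_(k < K) x k * y k) @ \oo --> l ->
  I (fun t => mode_sum x t * mode_sum y t) = l.
Proof.
move=> xC yC xyl; have cy := mode_sum_continuous yC.
apply: (seq_lim_unique (int_mode_sum xC (continuous_intble cy)) xyl) => K.
apply: eq_bigr => k _; congr (_ * _); rewrite -[RHS](mode_sum_coefficient yC).
by apply: int_eq => t _; rewrite mulrC.
Qed.

End modes.

(** * The Neumann and Dirichlet modes *)

Section neumann_dirichlet.
Context {R : realType}.
Local Notation I := (@int_I0pi R).
Local Notation amp := (Num.sqrt (2 / pi) : R).

Lemma amp_sqr : amp ^+ 2 = 2 / pi.
Proof. by rewrite sqr_sqrtr// divr_ge0// pi_ge0. Qed.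

Definition neumann_amp (k : nat) : R := if k == 0%N then Num.sqrt (1 / pi) else amp.
Definition neumann_mode (k : nat) (x : R) : R := neumann_amp k * cosn k x.
Definition neumann_dmode (k : nat) (x : R) : R := neumann_amp k * - (k%:R * sinn k x).
Definition neumann_kap (k : nat) : R := k%:R ^+ 2.
(** The Dirichlet modes are numbered from 0: the mode k has frequency k.+1. *)
Definition dirichlet_mode (k : nat) (x : R) : R := amp * sinn k.+1 x.
Definition dirichlet_dmode (k : nat) (x : R) : R := amp * (k.+1%:R * cosn k.+1 x).
Definition dirichlet_kap (k : nat) : R := k.+1%:R ^+ 2.

Lemma neumann_amp_ge0 k : 0 <= neumann_amp k.
Proof. by rewrite /neumann_amp; case: ifP => _; exact: sqrtr_ge0. Qed.

Lemma neumann_amp_le k : neumann_amp k <= amp.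
Proof.
rewrite /neumann_amp; case: ifP => // _; rewrite ler_sqrt ?divr_ge0 ?pi_ge0//.
by rewrite ler_wpM2r ?invr_ge0 ?pi_ge0// ler1n.
Qed.

Lemma is_derive_scale (c : R) f df (x : R) : is_derive x (1 : R) f df ->
  is_derive x (1 : R) (fun y => c * f y) (c * df).
Proof.
move=> Df; have -> : (fun y => c * f y) = (c \*: f) by [].
exact: is_deriveZ.
Qed.

Lemma cosn_le1 k (x : R) : `|cosn k x| <= 1. Proof. exact: cos_max. Qed.
Lemma sinn_le1 k (x : R) : `|sinn k x| <= 1. Proof. exact: sin_max. Qed.

Lemma nat_le_1Dsqr k : k%:R <= 1 + k%:R ^+ 2 :> R.
Proof. by have := sqr_ge0 (k%:R - 1 : R); have : 0 <= k%:R :> R by []; nra. Qed.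

Lemma is_derive_neumann_mode k (x : R) :
  is_derive x (1 : R) (neumann_mode k) (neumann_dmode k x).
Proof. by apply: is_derive_scale; exact: is_derive_cosn. Qed.

Lemma is_derive_neumann_dmode k (x : R) :
  is_derive x (1 : R) (neumann_dmode k) (- (neumann_kap k * neumann_mode k x)).
Proof.
have -> : - (neumann_kap k * neumann_mode k x) =
    neumann_amp k * (- k%:R * (k%:R * cosn k x)).
  by rewrite /neumann_kap /neumann_mode; ring.
apply: is_derive_scale.
have -> : (fun y : R => - (k%:R * sinn k y)) = (fun y => - k%:R * sinn k y).
  by apply/funext => y; rewrite mulNr.
by apply: is_derive_scale; exact: is_derive_sinn.
Qed.

Lemma is_derive_dirichlet_mode k (x : R) :
  is_derive x (1 : R) (dirichlet_mode k) (dirichlet_dmode k x).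
Proof. by apply: is_derive_scale; exact: is_derive_sinn. Qed.

Lemma is_derive_dirichlet_dmode k (x : R) :
  is_derive x (1 : R) (dirichlet_dmode k) (- (dirichlet_kap k * dirichlet_mode k x)).
Proof.
have -> : - (dirichlet_kap k * dirichlet_mode k x) =
    amp * (k.+1%:R * - (k.+1%:R * sinn k.+1 x)).
  by rewrite /dirichlet_kap /dirichlet_mode; ring.
by apply: is_derive_scale; apply: is_derive_scale; exact: is_derive_cosn.
Qed.

Lemma neumann_modes : mode_system (@H1 R) amp neumann_kap neumann_mode neumann_dmode.
Proof.
split.
- exact: sqrtr_ge0.
- by [].
- exact: is_derive_neumann_mode.
- exact: is_derive_neumann_dmode.
- move=> k x; rewrite /neumann_mode normrM (ger0_norm (neumann_amp_ge0 k)).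
  by rewrite -[leRHS]mulr1 ler_pM ?neumann_amp_ge0 ?neumann_amp_le ?cosn_le1.
- move=> k x; rewrite /neumann_dmode normrM (ger0_norm (neumann_amp_ge0 k)).
  rewrite normrN normrM ger0_norm//.
  rewrite ler_pM ?neumann_amp_ge0 ?neumann_amp_le ?mulr_ge0//.
  by apply: le_trans (nat_le_1Dsqr k); rewrite ler_piMr// sinn_le1.
- move=> k l; rewrite (@int_eq _ _ (fun x => neumann_amp k * neumann_amp l *
    (cosn k x * cosn l x))); last by move=> x _; rewrite /neumann_mode; ring.
  rewrite intZ; last by apply: continuous_intble; apply: contM; exact: cosn_continuous.
  rewrite int_cosnM; have pi0 := pi_gt0 R.
  have pin0 : (pi : R) != 0 by rewrite gt_eqF.
  case: (eqVneq k l) => [<-|kl]; last first.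
    suff -> : (k + l == 0)%N = false by rewrite addr0 !mulr0.
    by apply: contraNF kl; rewrite addn_eq0 => /andP[/eqP -> /eqP ->].
  rewrite addn_eq0 andbb -expr2 /neumann_amp; case: (k == 0%N) => /=.
    rewrite sqr_sqrtr ?divr_ge0 ?pi_ge0//.
    by move: (pi : R) pin0 => p p0; field.
  by rewrite amp_sqr; move: (pi : R) pin0 => p p0; field.
- move=> h ch oh; apply: cosn_complete => // k.
  have ak : neumann_amp k != 0.
    by rewrite /neumann_amp; case: ifP => _; rewrite sqrtr_eq0 -ltNge divr_gt0 ?pi_gt0.
  apply: (mulfI ak); rewrite mulr0 -(oh k) -intZ.
    by apply: int_eq => x _; rewrite /neumann_mode; ring.
  by apply: continuous_intble; apply: contM => //; exact: cosn_continuous.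
- move=> v dv k _ vdv; have [Lv _ _] := vdv.
  have ce : continuous (neumann_mode k) := derive_continuous (is_derive_neumann_mode k).
  have := weak_by_parts_vanishing vdv (is_derive_neumann_dmode k).
  rewrite /neumann_dmode sinn_at0 sinn_atpi mulr0 oppr0 mulr0.
  have cke : continuous (fun x => - (neumann_kap k * neumann_mode k x)).
    have := @contZ R (- neumann_kap k) _ ce.
    by under eq_fun do rewrite mulNr.
  move=> /(_ cke erefl erefl) e; apply: oppr_inj; rewrite -e -mulNr -intZ.
    by apply: int_eq => x _; ring.
  by apply: L2_mul => //; exact: L2_continuous.
- by move=> u du Du cdu _; exists du; exact: H1_pair_classical.
Qed.

Lemma dirichlet_modes :
  mode_system (@H10 R) amp dirichlet_kap dirichlet_mode dirichlet_dmode.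
Proof.
have amp0 : 0 <= amp by exact: sqrtr_ge0.
split => //.
- by move=> k; rewrite ler_pXn2r ?nnegrE// ler_nat.
- exact: is_derive_dirichlet_mode.
- exact: is_derive_dirichlet_dmode.
- by move=> k x; rewrite normrM (ger0_norm amp0) ler_piMr ?sinn_le1.
- move=> k x; rewrite normrM (ger0_norm amp0) ler_wpM2l// normrM ger0_norm//.
  by apply: le_trans (nat_le_1Dsqr k.+1); rewrite ler_piMr ?cosn_le1.
- move=> k l; rewrite (@int_eq _ _ (fun x => amp ^+ 2 * (sinn k.+1 x * sinn l.+1 x)));
    last by move=> x _; rewrite /dirichlet_mode; ring.
  rewrite intZ; last by apply: continuous_intble; apply: contM; exact: sinn_continuous.
  rewrite int_sinnM amp_sqr eqSS addn_eq0 /= subr0; have pi0 := pi_gt0 R.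
  have pin0 : (pi : R) != 0 by rewrite gt_eqF.
  by move: (pi : R) pin0 => p p0; field.
- move=> h ch oh; apply: sinn_complete => // k.
  have ak : amp != 0 by rewrite sqrtr_eq0 -ltNge divr_gt0 ?pi_gt0.
  apply: (mulfI ak); rewrite mulr0 -(oh k) -intZ.
    by apply: int_eq => x _; rewrite /dirichlet_mode; ring.
  by apply: continuous_intble; apply: contM => //; exact: sinn_continuous.
- move=> v dv k Vv vdv; have [Lv _ _] := vdv.
  have ce : continuous (dirichlet_mode k) :=
    derive_continuous (is_derive_dirichlet_mode k).
  have cke : continuous (fun x => - (dirichlet_kap k * dirichlet_mode k x)).
    have := @contZ R (- dirichlet_kap k) _ ce.
    by under eq_fun do rewrite mulNr.
  have e := weak_by_parts_H10 Vv vdv (is_derive_dirichlet_dmode k) cke.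
  apply: oppr_inj; rewrite -e -mulNr -intZ; first by apply: int_eq => x _; ring.
  by apply: L2_mul => //; exact: L2_continuous.
- move=> u du Du cdu bc; apply: (H10_classical Du cdu); apply: bc => k.
    by rewrite /dirichlet_mode sinn_at0 mulr0.
  by rewrite /dirichlet_mode sinn_atpi mulr0.
Qed.

Lemma sum_widen_le (f : nat -> R) (N M : nat) : (N <= M)%N -> (forall k, 0 <= f k) ->
  \sum_(k < N) f k <= \sum_(k < M) f k.
Proof.
by move=> NM f0; rewrite (sum_ord_split f NM) lerDl; apply: sumr_ge0 => k _.
Qed.

Lemma sum_shift_le (c : nat -> R) (S : R) (m N : nat) : summable_by c S ->
  \sum_(l < N) `|c (m + l)%N| <= S.
Proof.
move=> cS; apply: le_trans _ (cS (m + N)%N).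
rewrite (sum_ord_split (fun k => `|c k|) (leq_addr N m)).
have -> : \sum_(m <= k < m + N) `|c k| = \sum_(l < N) `|c (m + l)%N|.
  rewrite -{1}[m]add0n big_addn addKn big_mkord.
  by apply: eq_bigr => l _; rewrite addnC.
by rewrite lerDr; apply: sumr_ge0.
Qed.

(** Every gap is attained by at most two values of l. *)
Lemma sum_gap_le (c : nat -> R) (S : R) (k N : nat) : summable_by c S ->
  \sum_(l < N) `|c (gap k l)| <= 2 * S.
Proof.
move=> cS.
have le1 : \sum_(l < k) `|c (gap k l)| <= S.
  apply: le_trans _ (sum_shift_le 1 k cS); rewrite (reindex_inj rev_ord_inj) /=.
  rewrite le_eqVlt; apply/orP; left; apply/eqP; apply: eq_bigr => l _.
  rewrite /gap; have lk := ltn_ord l; congr (`|c _|).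
  by rewrite subKn// (eqP (_ : k - l.+1 - k == 0)%N) ?addn0 ?add1n// subn_eq0 leq_subr.
have le2 : \sum_(k <= l < k + N) `|c (gap k l)| <= S.
  rewrite -{1}[k]add0n big_addn addKn big_mkord.
  apply: le_trans _ (cS N); apply: ler_sum => l _.
  rewrite /gap addnK (eqP (_ : k - (l + k) == 0)%N) ?add0n//.
  by rewrite subn_eq0 leq_addl.
apply: (@le_trans _ _ (\sum_(l < k + N) `|c (gap k l)|)).
  by apply: (@sum_widen_le (fun l => `|c (gap k l)|)) => //; exact: leq_addl.
rewrite (sum_ord_split (fun l => `|c (gap k l)|) (leq_addr N k)).
by rewrite mulr_natl mulr2n lerD.
Qed.

Lemma gapSS k l : gap k.+1 l.+1 = gap k l. Proof. by rewrite /gap !subSS. Qed.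

Section potential.
Variables (q : R -> R) (S : R).
Hypothesis cq : continuous q.
Let c j := I (fun x => q x * cosn j x).
Hypothesis cS : summable_by c S.

Definition neumann_matrix k l := I (fun x => q x * neumann_mode k x * neumann_mode l x).
Definition dirichlet_matrix k l := I (fun x => q x * dirichlet_mode k x * dirichlet_mode l x).

Let ic j : intble (fun x => q x * cosn j x).
Proof. by apply/continuous_intble/contM => //; exact: cosn_continuous. Qed.

Lemma neumann_matrix_coef k l : neumann_matrix k l =
  neumann_amp k * neumann_amp l / 2 * (c (k + l) + c (gap k l)).
Proof.
rewrite -intD// -intZ; last exact: intbleD.
apply: int_eq => x _; have := cosnM k l x; rewrite /neumann_mode => e.
transitivity (neumann_amp k * neumann_amp l * q x * (cosn k x * cosn l x)); first by ring.
by rewrite e; field.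
Qed.

Lemma dirichlet_matrix_coef k l : dirichlet_matrix k l =
  amp ^+ 2 / 2 * (c (gap k l) - c (k.+1 + l.+1)%N).
Proof.
rewrite -intB// -intZ; last exact: intbleB.
apply: int_eq => x _; have := sinnM k.+1 l.+1 x; rewrite /dirichlet_mode gapSS => e.
transitivity (amp ^+ 2 * q x * (sinn k.+1 x * sinn l.+1 x)); first by ring.
by rewrite e; field.
Qed.

Let amp2 : amp ^+ 2 / 2 = pi^-1.
Proof.
have pin0 : (pi : R) != 0 by rewrite gt_eqF// pi_gt0.
by rewrite amp_sqr; move: (pi : R) pin0 => p p0; field.
Qed.

Lemma neumann_matrix_row k N : \sum_(l < N) `|neumann_matrix k l| <= pi^-1 * (3 * S).
Proof.
have piV0 : 0 <= pi^-1 :> R by rewrite invr_ge0 pi_ge0.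
apply: (@le_trans _ _ (\sum_(l < N) pi^-1 * (`|c (k + l)%N| + `|c (gap k l)|))).
  apply: ler_sum => l _; rewrite neumann_matrix_coef normrM.
  apply: ler_pM => //; last exact: ler_normD.
  rewrite ger0_norm ?divr_ge0 ?mulr_ge0 ?neumann_amp_ge0// -amp2.
  by rewrite ler_wpM2r// expr2 ler_pM ?neumann_amp_ge0 ?neumann_amp_le.
rewrite -mulr_sumr ler_wpM2l// big_split /=.
by have := sum_shift_le k N cS; have := sum_gap_le k N cS; lra.
Qed.

Lemma dirichlet_matrix_row k N : \sum_(l < N) `|dirichlet_matrix k l| <= pi^-1 * (3 * S).
Proof.
have piV0 : 0 <= pi^-1 :> R by rewrite invr_ge0 pi_ge0.
apply: (@le_trans _ _ (\sum_(l < N) pi^-1 * (`|c (gap k l)| + `|c (k.+2 + l)%N|))).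
  apply: ler_sum => l _; rewrite dirichlet_matrix_coef normrM amp2 (ger0_norm piV0).
  have -> : (k.+1 + l.+1 = k.+2 + l)%N by rewrite addnS.
  by rewrite ler_wpM2l//; exact: ler_normB.
rewrite -mulr_sumr ler_wpM2l// big_split /=.
by have := sum_shift_le k.+2 N cS; have := sum_gap_le k N cS; lra.
Qed.

(** The oscillating parts of the two diagonals cancel, because sin^2 + cos^2 = 1. *)
Lemma diagonal_sum k :
  dirichlet_matrix k k + neumann_matrix k.+1 k.+1 = 2 * (pi^-1 * I q).
Proof.
have iq := continuous_intble cq.
rewrite -amp2 mulrA -intZ//.
have cd := derive_continuous (is_derive_dirichlet_mode k).
have cn := derive_continuous (is_derive_neumann_mode k.+1).
rewrite -intD; [|exact: continuous_intble (contM (contM cq cd) cd)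
  |exact: continuous_intble (contM (contM cq cn) cn)].
apply: int_eq => x _; rewrite /dirichlet_mode /neumann_mode /neumann_amp /=.
have := cos2Dsin2 (k.+1%:R * x : R); rewrite -/(cosn k.+1 x) -/(sinn k.+1 x) => e.
transitivity (amp ^+ 2 * q x * (cosn k.+1 x ^+ 2 + sinn k.+1 x ^+ 2)); first by ring.
by rewrite e; field.
Qed.

Lemma neumann_matrix00 : neumann_matrix 0 0 = pi^-1 * I q.
Proof.
have iq := continuous_intble cq.
rewrite -intZ//; apply: int_eq => x _; rewrite /neumann_mode /neumann_amp /= cosn0 !mulr1.
by rewrite -mulrA -expr2 sqr_sqrtr ?div1r ?invr_ge0 ?pi_ge0// mulrC.
Qed.

End potential.

End neumann_dirichlet.

(** * Comparison with the list of eigenvalues *)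

Section counting.
Context {R : realType}.
Local Notation I := (@int_I0pi R).

Lemma int_eq_ae (f g : R -> R) : measurable_fun (I0pi R) f ->
  measurable_fun (I0pi R) g -> eq_ae f g -> I f = I g.
Proof.
move=> mf mg fg; rewrite /int_I0pi /Rintegral; congr fine.
apply: ae_eq_integral; [exact: I0pi_measurable|exact/measurable_EFinP..|].
by apply: filterS fg => x /= h Dx; rewrite h.
Qed.

Lemma L2_sum (d : nat) (c : 'I_d -> R) (w : 'I_d -> R -> R) :
  (forall i, L2 (w i)) -> L2 (fun x => \sum_(i < d) c i * w i x).
Proof.
elim: d c w => [|d IH] c w Lw.
  under eq_fun do rewrite big_ord0.
  by apply: L2_continuous; exact: contC.
under eq_fun do rewrite big_ord_recr /=.
apply: L2D; last by apply: L2Z; exact: Lw.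
exact: (IH (fun i => c (widen_ord (leqnSn d) i)) (fun i => w (widen_ord (leqnSn d) i))).
Qed.

Lemma int_ord_sum (d : nat) (F : 'I_d -> R -> R) : (forall i, intble (F i)) ->
  intble (fun x => \sum_(i < d) F i x) /\
  I (fun x => \sum_(i < d) F i x) = \sum_(i < d) I (F i).
Proof.
elim: d F => [|d IH] F iF.
  under eq_fun do rewrite big_ord0.
  by rewrite big_ord0 int0; split=> //; exact/continuous_intble/contC.
have [i1 e1] := IH (fun i => F (widen_ord (leqnSn d) i)) (fun i => iF _).
under eq_fun do rewrite big_ord_recr /=.
by split; [exact: intbleD|rewrite intD// e1 big_ord_recr].
Qed.

(** If p > d, some nontrivial combination of the w i vanishes almost everywhere,
   while its squared norm is the sum of the squares of its coefficients. *)
Lemma orthonormal_le_dim (E : set (R -> R)) (d p : nat) (w : 'I_p -> R -> R) :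
  has_dim_ae E d -> (forall i, E (w i)) -> (forall f, E f -> L2 f) ->
  (forall i j, I (fun x => w i x * w j x) = (i == j)%:R) -> (p <= d)%N.
Proof.
move=> [f [Ef _ span]] Ew EL ow; rewrite leqNgt; apply/negP => dp.
have [C CE] := choice (fun i => span (w i) (Ew i)).
pose M : 'M[R]_(p, d) := \matrix_(i, k) C i k.
have /rowV0Pn[a aM a0] : kermx M != 0.
  rewrite kermx_eq0 -row_leq_rank -ltnNge.
  by apply: leq_ltn_trans dp; exact: rank_leq_col.
have Lw i := EL _ (Ew i).
pose s x := \sum_(i < p) a 0 i * w i x.
have Ls : L2 s by exact: (@L2_sum p (fun i => a 0 i) w).
have aC k : \sum_(i < p) a 0 i * C i k = 0.
  have /sub_kermxP/matrixP/(_ 0 k) := aM; rewrite !mxE => e; rewrite -[RHS]e.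
  by apply: eq_bigr => i _; rewrite mxE.
have s0 : eq_ae s (fun=> 0).
  have h := @filter_forall R 'I_p (fun i => [set x | I0pi R x ->
    w i x = \sum_(k < d) C i k * f k x]) _ (ae_filter_ringOfSetsType (@lebesgue_measure R)) (fun i => CE i).
  apply: (@filterS _ _ (ae_filter_ringOfSetsType (@lebesgue_measure R)) _ _ _ h).
  move=> x hx Dx; rewrite /s.
  under eq_bigr => i _ do rewrite hx// mulr_sumr.
  rewrite exchange_big big1// => k _ /=.
  under eq_bigr do rewrite mulrA.
  by rewrite -mulr_suml aC mul0r.
have Is : I (fun x => s x ^+ 2) = 0.
  rewrite -int0; apply: int_eq_ae.
  - exact: (intble_measurable (L2_sqr Ls)).
  - by apply: continuous_measurable; exact: contC.
  - by apply: filterS s0 => x h Dx; rewrite h// expr0n.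
have : \sum_(i < p) a 0 i ^+ 2 = 0.
  have Iws i : I (fun x => w i x * s x) = a 0 i.
    have iF j : intble (fun x => a 0 j * (w i x * w j x)) by exact/intbleZ/L2_mul.
    transitivity (\sum_(j < p) I (fun x => a 0 j * (w i x * w j x))).
      rewrite -(int_ord_sum iF).2; apply: int_eq => x _.
      by rewrite /s mulr_sumr; apply: eq_bigr => j _; ring.
    rewrite (bigD1 i)//= intZ ?ow ?eqxx ?mulr1; last exact: L2_mul.
    rewrite big1 ?addr0// => j ji; rewrite intZ ?ow; last exact: L2_mul.
    by rewrite eq_sym (negbTE ji) mulr0.
  have iF i : intble (fun x => a 0 i * (w i x * s x)) by exact/intbleZ/L2_mul.
  transitivity (\sum_(i < p) I (fun x => a 0 i * (w i x * s x))).
    by apply: eq_bigr => i _; rewrite intZ ?Iws ?expr2//; exact: L2_mul.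
  rewrite -(int_ord_sum iF).2 -[RHS]Is; apply: int_eq => x _.
  by rewrite expr2 {2}/s mulr_suml; apply: eq_bigr => i _; rewrite mulrA.
move/eqP; rewrite psumr_eq0 => [/allP h|k _]; last exact: sqr_ge0.
move/negP: a0; apply; apply/eqP/rowP => k; rewrite mxE; apply/eqP.
by have := h k (mem_index_enum k); rewrite sqrf_eq0.
Qed.

(** If nu j < lam (m + j), then the j.+1 numbers nu 0, ..., nu j would be found, with
   multiplicity, among the j numbers lam m, ..., lam (m + j - 1). *)
Lemma seq_le_of_counts (j : nat) (nu lam : nat -> R) (m : nat) :
  (forall i k, (i <= k)%N -> nu i <= nu k) ->
  (forall i k, (m <= i <= k)%N -> lam i <= lam k) ->
  (forall t, t < lam (m + j)%N ->
    (count (fun i => nu i == t) (iota 0 j.+1) <=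
     count (fun k => lam k == t) (iota m j))%N) ->
  lam (m + j)%N <= nu j.
Proof.
move=> mnu mlam hc; rewrite leNgt; apply/negP => lt_nu.
pose s1 := [seq nu i | i <- iota 0 j.+1]; pose s2 := [seq lam k | k <- iota m j].
have /count_subseqP[s ss ps] : forall t, (count_mem t s1 <= count_mem t s2)%N.
  move=> t; have [tl|lt] := ltP t (lam (m + j)%N).
    by rewrite !count_map; exact: hc.
  rewrite (_ : count_mem t s1 = 0)//; apply/count_memPn/mapP => -[i].
  rewrite mem_iota add0n ltnS => /andP[_ ij] e.
  by move: lt; rewrite leNgt e (le_lt_trans (mnu _ _ ij)).
have := size_subseq ss; rewrite -(perm_size ps) !size_map !size_iota.
by rewrite ltnn.
Qed.

(** An orthonormal sequence of eigenfunctions need not exhaust the spectrum: its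
   eigenvalues bound those of the complete list from above. *)
Lemma eigenvalue_list_le (V : set (R -> R)) (q : R -> R) (m : nat) (lam nu : nat -> R)
    (w : nat -> R -> R) :
  eigenvalue_list V q m lam -> (forall i k, (i <= k)%N -> nu i <= nu k) ->
  (forall j, eigenspace_on V q (nu j) (w j)) ->
  (forall i j, I (fun x => w i x * w j x) = (i == j)%:R) ->
  forall j, lam (m + j)%N <= nu j.
Proof.
move=> [mlam dlam] mnu ew ow j; apply: seq_le_of_counts => // t tl.
have [d [cd dimd]] := dlam t.
pose s := [seq i <- iota 0 j.+1 | nu i == t].
have su : uniq s by rewrite filter_uniq// iota_uniq.
have EL f : eigenspace_on V q t f -> L2 f by move=> [_ [df [[]]]].
have sd : (size s <= d)%N.
  apply: (@orthonormal_le_dim _ d (size s) (fun i => w (nth 0%N s i)) dimd) => //.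
    move=> i; have : nth 0%N s i \in s by exact: mem_nth.
    by rewrite mem_filter => /andP[/eqP <- _]; exact: ew.
  by move=> i k; rewrite ow nth_uniq.
rewrite -[leqLHS]size_filter; apply: leq_trans sd _; rewrite -size_filter.
move: cd; rewrite card_eq_sym => /card_set_bijP[f fb].
have -> : d = size [seq f i | i <- iota 0 d] by rewrite size_map size_iota.
apply: uniq_leq_size.
  rewrite map_inj_in_uniq ?iota_uniq// => i k; rewrite !mem_iota !add0n /= => id kd.
  by apply: (set_bij_inj fb); rewrite inE.
move=> k /mapP[i]; rewrite mem_iota add0n /= => id ->.
have [mf ef] : (m <= f i)%N /\ lam (f i) = t.
  by have := set_bij_sub fb; apply; exists i.
rewrite mem_filter mem_iota mf ef eqxx /= ltnNge; apply/negP => jf.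
by move: tl; rewrite -ef ltNge mlam// leq_addr.
Qed.

End counting.

(** * Positivity of the Dirichlet spectrum *)

Section bessel.
Context {R : realType}.
Variable e : nat -> R -> R.
Hypothesis ce : forall k, continuous (e k).
Hypothesis oe : forall k l, int_I0pi (fun x => e k x * e l x) = (k == l)%:R.
Local Notation I := (@int_I0pi R).

Definition partial_sum (c : nat -> R) (K : nat) (x : R) : R := \sum_(k < K) c k * e k x.

Lemma partial_sum_continuous c K : continuous (partial_sum c K).
Proof.
apply: continuous_big => [|k _]; first exact: add_continuous.
exact/contZ/ce.
Qed.

Lemma int_partial_sum c K v : L2 v ->
  I (fun x => partial_sum c K x * v x) = \sum_(k < K) c k * I (fun x => v x * e k x).
Proof.
move=> Lv; have ie k : intble (fun x => v x * e k x) by exact/L2_mul/L2_continuous.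
transitivity (I (fun x => \sum_(k < K) c k * (v x * e k x))).
  apply: int_eq => x _; rewrite mulr_suml; apply: eq_bigr => k _; ring.
rewrite (@int_sum _ K (fun k x => c k * (v x * e k x))); last first.
  by move=> k _; exact: intbleZ.
by apply: eq_bigr => k _; rewrite intZ.
Qed.

Lemma int_partial_sum_mode c K l : (l < K)%N ->
  I (fun x => partial_sum c K x * e l x) = c l.
Proof.
move=> lK; rewrite int_partial_sum; last exact: L2_continuous.
rewrite (bigD1 (Ordinal lK))//= oe eqxx mulr1 big1 ?addr0// => k.
by rewrite -val_eqE /= oe eq_sym => /negbTE ->; rewrite mulr0.
Qed.

Lemma int_partial_sum_sqr c K :
  I (fun x => partial_sum c K x ^+ 2) = \sum_(k < K) c k ^+ 2.
Proof.
have -> : I (fun x => partial_sum c K x ^+ 2) =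
    I (fun x => partial_sum c K x * partial_sum c K x).
  by apply: int_eq => x _; rewrite expr2.
rewrite int_partial_sum; last exact/L2_continuous/partial_sum_continuous.
by apply: eq_bigr => k _; rewrite int_partial_sum_mode// expr2.
Qed.

Lemma int_sub_partial_sum_sqr v c K : L2 v ->
  I (fun x => (v x - partial_sum c K x) ^+ 2) =
  I (fun x => v x ^+ 2) - \sum_(k < K) I (fun x => v x * e k x) ^+ 2
  + \sum_(k < K) (c k - I (fun x => v x * e k x)) ^+ 2.
Proof.
move=> Lv; have Lp := L2_continuous (@partial_sum_continuous c K).
have := int_sqr_comb 1 (- 1) Lv Lp.
rewrite int_partial_sum_sqr => E.
transitivity (I (fun x => (1 * v x + -1 * partial_sum c K x) ^+ 2)).
  by apply: int_eq => x _; ring.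
rewrite E (@int_eq _ (fun x => v x * partial_sum c K x) (fun x => partial_sum c K x * v x));
  last by move=> x _; rewrite mulrC.
rewrite int_partial_sum//.
have -> : \sum_(k < K) (c k - I (fun x => v x * e k x)) ^+ 2 =
    \sum_(k < K) c k ^+ 2 - 2 * (\sum_(k < K) c k * I (fun x => v x * e k x))
    + \sum_(k < K) I (fun x => v x * e k x) ^+ 2.
  by rewrite mulr_sumr -sumrB -big_split; apply: eq_bigr => k _ /=; ring.
by ring.
Qed.

Lemma bessel v K : L2 v -> \sum_(k < K) I (fun x => v x * e k x) ^+ 2 <= I (fun x => v x ^+ 2).
Proof.
move=> Lv; have := int_sub_partial_sum_sqr (fun k => I (fun x => v x * e k x)) K Lv.
rewrite [X in _ = _ + X]big1 ?addr0 => [E|k _]; last by rewrite subrr expr0n.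
by rewrite -subr_ge0 -E; exact: int_sqr_ge0.
Qed.

Lemma best_approximation v c K : L2 v ->
  I (fun x => v x ^+ 2) - \sum_(k < K) I (fun x => v x * e k x) ^+ 2 <=
  I (fun x => (v x - partial_sum c K x) ^+ 2).
Proof.
move=> Lv; rewrite int_sub_partial_sum_sqr// lerDl.
by apply: sumr_ge0 => k _; exact: sqr_ge0.
Qed.

End bessel.

Section rayleigh.
Context {R : realType}.
Local Notation I := (@int_I0pi R).
Local Notation e := (@neumann_mode R).
Local Notation coef u k := (int_I0pi (fun x => u x * neumann_mode k x)).

Let ce k : continuous (e k).
Proof. exact: derive_continuous (is_derive_neumann_mode k). Qed.

Let oe := mode_ortho (@neumann_modes R).

(** The cosine coefficients of u are, up to the factor k, the sine coefficients of du,
   to which Bessel's inequality applies. *)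
Lemma coef_derivative_bessel u du K : H1_pair u du ->
  \sum_(k < K) k%:R ^+ 2 * coef u k ^+ 2 <= I (fun x => du x ^+ 2).
Proof.
move=> udu; have [Lu Ldu _] := udu.
have cd k : continuous (@dirichlet_mode R k).
  exact: derive_continuous (is_derive_dirichlet_mode k).
have cdd k : continuous (@dirichlet_dmode R k).
  exact: derive_continuous (is_derive_dirichlet_dmode k).
have E k : I (fun x => du x * dirichlet_mode k x) = - (k.+1%:R * coef u k.+1).
  have := weak_by_parts_vanishing udu (is_derive_dirichlet_mode k) (@cdd k).
  rewrite {1 2}/dirichlet_mode sinn_at0 sinn_atpi mulr0 => /(_ erefl erefl) h.
  apply: oppr_inj; rewrite opprK -h -intZ; last exact/L2_mul/L2_continuous.
  by apply: int_eq => x _; rewrite /dirichlet_dmode /neumann_mode /neumann_amp /=; ring.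
case: K => [|K]; first by rewrite big_ord0 int_sqr_ge0.
rewrite big_ord_recl expr0n mul0r add0r /=.
apply: le_trans (bessel (@cd) (mode_ortho (@dirichlet_modes R)) K Ldu).
by apply: ler_sum => k _; rewrite E sqrrN exprMn /bump /= add1n.
Qed.

(** The coefficients of a test function are absolutely summable, because
   2 |a| <= (1 + k^2) a^2 + 1 / (1 + k^2). By completeness the series sums to the
   function, and it converges uniformly. *)
Lemma test_function_expansion phi : test_function phi ->
  (fun K => I (fun x => phi x ^+ 2) - \sum_(k < K) coef phi k ^+ 2) @ \oo --> (0 : R).
Proof.
move=> tphi; have [Lphi Ldphi] := test_function_L2 tphi.
have cphi := derive_continuous (test_function_is_derive tphi).
pose M := I (fun x => phi x ^+ 2) + I (fun x => derive1 phi x ^+ 2) + 4.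
have amp0 : 0 <= Num.sqrt (2 / pi) :> R by exact: sqrtr_ge0.
have summ : summable_by (fun k => Num.sqrt (2 / pi) * coef phi k) (Num.sqrt (2 / pi) * M).
  move=> K; under eq_bigr do rewrite normrM (ger0_norm amp0).
  rewrite -mulr_sumr ler_wpM2l//.
  apply: (@le_trans _ _ (\sum_(k < K) (coef phi k ^+ 2 + k%:R ^+ 2 * coef phi k ^+ 2 +
      weight R k))).
    apply: ler_sum => k _; move: (coef phi k) => a.
    have w0 : 0 < 1 + k%:R ^+ 2 :> R by rewrite ltr_pwDl ?sqr_ge0.
    have wE : (1 + k%:R ^+ 2) * weight R k = 1 by rewrite divff// gt_eqF.
    have -> : a ^+ 2 + k%:R ^+ 2 * a ^+ 2 = (1 + k%:R ^+ 2) * `|a| ^+ 2.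
      by rewrite real_normK ?num_real//; ring.
    move: (1 + k%:R ^+ 2) (weight R k) w0 wE (weight_ge0 R k) => t w t0 tw w0.
    have n0 := normr_ge0 a; have : 0 <= t * (`|a| - w) ^+ 2 by rewrite mulr_ge0 ?sqr_ge0// ltW.
    have -> : t * (`|a| - w) ^+ 2 = t * `|a| ^+ 2 - 2 * (t * w) * `|a| + (t * w) * w by ring.
    by rewrite tw; lra.
  rewrite !big_split /= lerD ?sum_weight_ord_le// lerD ?coef_derivative_bessel//.
    exact: (bessel ce oe K Lphi).
  exact: H1_pair_test.
have fa k x : `|coef phi k * e k x| <= `|Num.sqrt (2 / pi) * coef phi k|.
  rewrite normrM [leRHS]normrM (ger0_norm amp0) [leRHS]mulrC ler_wpM2l//.
  exact: (mode_bound (@neumann_modes R)).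
have cf k : continuous (fun x => coef phi k * e k x) by exact/contZ/ce.
have cF := fsum_continuous summ fa cf.
have phiE x : 0 < x < pi -> phi x = fsum (fun k x => coef phi k * e k x) x.
  move=> xI; apply/eqP; rewrite -subr_eq0; apply/eqP.
  apply: (mode_complete (@neumann_modes R) (contB cphi cF) _ xI) => k.
  rewrite (@int_eq _ _ (fun x => phi x * e k x -
    fsum (fun k x => coef phi k * e k x) x * e k x)); last by move=> y _; rewrite mulrBl.
  rewrite intB; [|exact/continuous_intble/contM/ce..].
  apply/eqP; rewrite subr_eq0 eq_sym; apply/eqP.
  have c := int_fsum summ fa cf (continuous_intble (@ce k)).
  rewrite -(cvg_lim (@Rhausdorff R) c); apply: (cvg_lim (@Rhausdorff R)).
  apply: cvg_near_cst; near=> K.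
  have kK : (k < K)%N by near: K; exact: nbhs_infty_gt.
  rewrite -(@int_sum _ K (fun l x => coef phi l * e l x * e k x)); last first.
    by move=> l _; apply/continuous_intble/contM/ce.
  rewrite -[RHS](int_partial_sum_mode ce oe (fun l => coef phi l) kK).
  by apply: int_eq => y _; rewrite -mulr_suml.
have [tail t0 ft] := fsum_tail summ fa.
have ub : (fun K => tail K ^+ 2 * pi) @ \oo --> (0 : R).
  have := seq_cvgM (seq_cvgM t0 t0) (cvg_cst (pi : R)).
  by rewrite mul0r mul0r; under [X in _ -> X @ _ --> _]eq_fun do rewrite expr2; apply.
apply: (@squeeze_cvgr _ _ _ _ (fun=> 0) (fun K => tail K ^+ 2 * pi)) => //; last exact: cvg_cst.
apply: nearW => K; rewrite subr_ge0 bessel//=.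
apply: le_trans (best_approximation ce oe (fun k => coef phi k) K Lphi) _.
have -> : tail K ^+ 2 * pi = I (fun x => tail K ^+ 2 * cosn 0 x).
  by rewrite intZ ?int_cosn ?mul1r//; exact: cosn_intble.
have cp := @partial_sum_continuous _ _ ce (fun k => coef phi k) K.
apply: le_int.
- exact/continuous_intble/contX/contB.
- exact/intbleZ/cosn_intble.
- move=> x xI; rewrite cosn0 mulr1 phiE//.
  have h := ft K x.
  rewrite -[leLHS]ger0_norm ?sqr_ge0// normrX ler_pXn2r ?nnegrE//.
  exact: le_trans h.
Unshelve. all: by end_near. Qed.

(** The partial sums are best approximations, so that Parseval's identity passes from
   test functions to their limits in the mean. *)
Lemma H10_expansion u : H10 u ->
  (fun K => I (fun x => u x ^+ 2) - \sum_(k < K) coef u k ^+ 2) @ \oo --> (0 : R).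
Proof.
move=> [du [[Lu Ldu _] [phi [tphi cphi]]]].
apply/cvgr0Pnorm_le => eps eps0.
have eps4 : 0 < eps / 4 by rewrite divr_gt0.
have /cvgr0Pnorm_le/(_ _ eps4)[n _ /(_ n (leqnn n)) hn] := cphi.
have [Lphi Ldphi] := test_function_L2 (tphi n).
have hu : I (fun x => (u x - phi n x) ^+ 2) <= eps / 4.
  apply: le_trans (le_trans (ler_norm _) hn).
  by rewrite lerDl int_sqr_ge0.
have /cvgr0Pnorm_le/(_ _ eps4) := test_function_expansion (tphi n).
apply: filterS => K hK; rewrite ger0_norm ?subr_ge0 ?(bessel ce oe)//.
apply: le_trans (best_approximation ce oe (fun k => coef (phi n) k) K Lu) _.
have Lp := L2_continuous (@partial_sum_continuous _ _ ce (fun k => coef (phi n) k) K).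
have hphi : I (fun x => (phi n x - partial_sum e (fun k => coef (phi n) k) K x) ^+ 2) <= eps / 4.
  rewrite (int_sub_partial_sum_sqr ce oe)// [X in _ + X]big1 ?addr0; last first.
    by move=> k _; rewrite subrr expr0n.
  exact: le_trans (ler_norm _) hK.
have L1 := L2B Lu Lphi; have L2' := L2B Lphi Lp.
apply: (@le_trans _ _ (I (fun x => 2 * (u x - phi n x) ^+ 2 +
    2 * (phi n x - partial_sum e (fun k => coef (phi n) k) K x) ^+ 2))).
  apply: le_int.
  - exact: L2_sqr (L2B Lu Lp).
  - by apply: intbleD; exact/intbleZ/L2_sqr.
  - move=> x _; move: (partial_sum _ _ _ _) => p.
    by have := sqr_ge0 (u x - phi n x - (phi n x - p)); lra.
rewrite intD; [|exact/intbleZ/L2_sqr..].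
rewrite !intZ; [|exact: L2_sqr..].
lra.
Qed.

(** A function of H^1_0 is a competitor in the Neumann problem: the form of the
   Neumann matrix at its partial cosine sums is at most its energy, up to an error in
   the potential term that tends to 0. *)
Lemma rayleigh_H10 (q : R -> R) (nu : R) u du : continuous q ->
  (forall K (y : nat -> R), nu * (\sum_(k < K) y k ^+ 2) <= \sum_(k < K) \sum_(l < K)
     galerkin_matrix (@neumann_kap R) (neumann_matrix q) k l * y k * y l) ->
  H10 u -> H1_pair u du ->
  nu * I (fun x => u x ^+ 2) <= I (fun x => du x ^+ 2) + I (fun x => q x * u x ^+ 2).
Proof.
move=> cq form Hu udu; have [Lu Ldu _] := udu.
pose S K x := partial_sum e (fun k => coef u k) K x.
have cS K : continuous (S K) by exact: partial_sum_continuous.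
have LS K := L2_continuous (@cS K).
have iqS K : intble (fun x => q x * S K x ^+ 2) by exact/continuous_intble/contM/contX.
have iqu : intble (fun x => q x * u x ^+ 2) by exact/continuous_mul_intble/L2_sqr.
have bound K : nu * (\sum_(k < K) coef u k ^+ 2) <=
    I (fun x => du x ^+ 2) + I (fun x => q x * S K x ^+ 2).
  apply: le_trans (form K (fun k => coef u k)) _.
  have -> : I (fun x => q x * S K x ^+ 2) = \sum_(k < K) \sum_(l < K)
      neumann_matrix q k l * coef u k * coef u l.
    transitivity (I (fun x => S K x * (q x * S K x))).
      by apply: int_eq => x _; ring.
    rewrite int_partial_sum//; last exact/L2_continuous/contM.
    apply: eq_bigr => k _.
    transitivity (coef u k * I (fun x => S K x * (q x * e k x))).
      by congr (_ * _); apply: int_eq => x _; ring.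
    rewrite int_partial_sum//; last exact/L2_continuous/contM/ce.
    rewrite mulr_sumr; apply: eq_bigr => l _.
    by rewrite -/(neumann_matrix q k l); ring.
  apply: le_trans (lerD (coef_derivative_bessel K udu) (lexx _)).
  rewrite -big_split; apply: ler_sum => k _ /=.
  rewrite /galerkin_matrix; under eq_bigr do rewrite !mulrDl.
  rewrite big_split /= lerD2r (bigD1 k)//= eqxx big1 ?addr0.
    by rewrite /neumann_kap mul1r; lra.
  by move=> l; rewrite -val_eqE /= eq_sym => /negbTE ->; rewrite !mul0r.
have cI : (fun K => \sum_(k < K) coef u k ^+ 2) @ \oo --> I (fun x => u x ^+ 2).
  have h := seq_cvgD (cvg_cst (I (fun x => u x ^+ 2))) (seq_cvgN (H10_expansion Hu)).
  rewrite subr0 in h.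
  have -> : (fun K => \sum_(k < K) coef u k ^+ 2) = (fun K => I (fun x => u x ^+ 2) +
      - (I (fun x => u x ^+ 2) - \sum_(k < K) coef u k ^+ 2)).
    by apply/funext => K; ring.
  exact: h.
have cq2 : (fun K => I (fun x => q x * S K x ^+ 2)) @ \oo --> I (fun x => q x * u x ^+ 2).
  have [M M0 qM] := continuous_bounded cq.
  pose U := I (fun x => u x ^+ 2).
  have : (fun K => I (fun x => (u x - S K x) * (q x * (u x + S K x)))) @ \oo --> (0 : R).
    apply: (@sqr_dominated_cvg0 _ _ _ (4 * M ^+ 2 * U) _ (H10_expansion Hu)) => K.
    have Lq : L2 (fun x => q x * (u x + S K x)) by exact/L2_continuous_mul/L2D.
    apply: le_trans (cauchy_schwarz (L2B Lu (LS K)) Lq) _.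
    rewrite (int_sub_partial_sum_sqr ce oe)// [X in _ + X]big1 ?addr0; last first.
      by move=> k _; rewrite subrr expr0n.
    rewrite mulrC ler_wpM2r ?subr_ge0 ?(bessel ce oe)//.
    apply: (@le_trans _ _ (I (fun x => 2 * M ^+ 2 * u x ^+ 2 + 2 * M ^+ 2 * S K x ^+ 2))).
      apply: le_int; [exact: L2_sqr|by apply: intbleD; exact/intbleZ/L2_sqr|].
      move=> x /andP[x0 xpi].
      have q2 : q x ^+ 2 <= M ^+ 2.
        rewrite -[leLHS]ger0_norm ?sqr_ge0// normrX ler_pXn2r ?nnegrE// qM//.
        by rewrite !ltW.
      rewrite exprMn.
      have h : (u x + S K x) ^+ 2 <= 2 * (u x ^+ 2 + S K x ^+ 2).
        by have := sqr_ge0 (u x - S K x); lra.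
      apply: (@le_trans _ _ (M ^+ 2 * (2 * (u x ^+ 2 + S K x ^+ 2)))).
        exact: (ler_pM (sqr_ge0 _) (sqr_ge0 _) q2 h).
      by rewrite le_eqVlt; apply/orP; left; apply/eqP; ring.
    rewrite intD; [|exact/intbleZ/L2_sqr..].
    rewrite !intZ; [|exact: L2_sqr..].
    rewrite int_partial_sum_sqr// -/U.
    have := bessel ce oe K Lu; rewrite -/U => hb.
    have : 2 * M ^+ 2 * \sum_(k < K) coef u k ^+ 2 <= 2 * M ^+ 2 * U.
      by rewrite ler_wpM2l// mulr_ge0// sqr_ge0.
    lra.
  move=> c; have h := seq_cvgD (cvg_cst (I (fun x => q x * u x ^+ 2))) (seq_cvgN c).
  rewrite subr0 in h.
  have -> : (fun K => I (fun x => q x * S K x ^+ 2)) = (fun K => I (fun x => q x * u x ^+ 2)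
      + - I (fun x => (u x - S K x) * (q x * (u x + S K x)))).
    apply/funext => K; rewrite -intB//; first by apply: int_eq => x _; ring.
    by apply: L2_mul; [exact: L2B|exact/L2_continuous_mul/L2D].
  exact: h.
have l1 := @seq_cvgZ R nu _ _ cI.
have c0 : (fun _ : nat => I (fun x => du x ^+ 2)) @ \oo --> I (fun x => du x ^+ 2).
  exact: cvg_cst.
have l2 := seq_cvgD c0 cq2.
apply: (ler_cvg_to l1 l2).
by apply: nearW => K; exact: bound.
Qed.

End rayleigh.

(** * Negative powers *)

Section powers.
Context {R : realType}.
Implicit Types s y z d : R.

Lemma powR_neg_nonincreasing s y z : 0 < s -> 0 < y -> y <= z ->
  z `^ (- s) <= y `^ (- s).
Proof.
move=> s0 y0 yz; have z0 : 0 < z by exact: lt_le_trans yz.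
rewrite /powR !gt_eqF// ler_expR !mulNr lerN2 ler_wpM2l ?(ltW s0)//.
by rewrite ler_ln.
Qed.

(** The tangent at d lies below, by 1 + t <= exp t and ln (1 + t) <= t. *)
Lemma powR_neg_supporting_lines s : 0 < s ->
  supporting_lines [set y | 0 < y] (fun y : R => y `^ (- s)).
Proof.
move=> s0 d /= d0; exists (- s * d^-1 * d `^ (- s)) => y y0.
have g0 : 0 <= d `^ (- s) by exact: powR_ge0.
have -> : y `^ (- s) = d `^ (- s) * expR (- s * (ln y - ln d)).
  by rewrite /powR !gt_eqF// -expRD; congr expR; ring.
have -> : d `^ (- s) + - s * d^-1 * d `^ (- s) * (y - d) =
    d `^ (- s) * (1 - s * (y / d - 1)) by field; rewrite gt_eqF.
rewrite ler_wpM2l//; apply: le_trans (expR_ge1Dx _).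
rewrite mulNr lerD2l lerN2 ler_wpM2l ?(ltW s0)//.
rewrite -ln_div//.
have yd : 0 < y / d by rewrite divr_gt0.
have := @le_ln1Dx R (y / d - 1).
by rewrite (_ : 1 + (y / d - 1) = y / d); [apply; lra|ring].
Qed.

Lemma powR_continuous_at s y : 0 < y -> {for y, continuous (fun z : R => z `^ s)}.
Proof.
move=> y0; apply/differentiable_continuous/derivable1_diffP.
by apply: derivable_powR; rewrite in_itv /= y0.
Qed.

Lemma powR_neg_midpoint s y z d : 0 < s -> 0 < y -> 0 < z -> y + z = 2 * d ->
  2 * d `^ (- s) <= y `^ (- s) + z `^ (- s).
Proof.
move=> s0 y0 z0 yz; have d0 : 0 < d by lra.
have [c h] := powR_neg_supporting_lines s0 d0.
have := lerD (h y y0) (h z z0).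
have -> : d `^ (- s) + c * (y - d) + (d `^ (- s) + c * (z - d)) = 2 * d `^ (- s) + c * (y + z - 2 * d) by ring.
by rewrite yz subrr mulr0 addr0.
Qed.

End powers.

(** * The trace inequality *)

Section assembly.
Context {R : realType}.
Local Notation I := (@int_I0pi R).

(** The cosine series defines a continuous function on the whole line, and a potential
   matters only on [0, pi]. *)
Lemma continuous_potential (q : R -> R) : abs_cvg_cos_expansion q ->
  exists qt : R -> R, [/\ continuous qt, forall x, 0 <= x <= pi -> q x = qt x &
    exists S, summable_by (fun j => I (fun x => qt x * cosn j x)) S].
Proof.
move=> [cq hq]; pose c := cos_fourier_coeff q.
pose f (k : nat) (x : R) := (if k == 0%N then c 0%N / 2 else c k) * cosn k x.
have [S cS] : exists S, summable_by c S.
  exists (lim ((series (fun k => `|c k|)) @ \oo)) => K.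
  have := @nondecreasing_cvgn_le R (series (fun k => `|c k|)) _ cq K.
  rewrite /series /= big_mkord; apply.
  by apply/nondecreasing_seqP => k; rewrite /series /= big_nat_recr//= lerDl.
have fc k x : `|f k x| <= `|c k|.
  rewrite /f normrM; case: eqP => [->|_]; last by rewrite ler_piMr// cosn_le1.
  rewrite cosn0 normr1 mulr1 normrM ler_piMr// ger0_norm// invf_le1//; lra.
have cf k : continuous (f k) by exact/contZ/cosn_continuous.
exists (fsum f); have qE x : 0 <= x <= pi -> q x = fsum f x.
  move=> x0; have xI : x \in `[0, pi] by rewrite in_itv.
  have h1 := hq x xI; have h2 := fsum_cvg cS fc (t := x).
  rewrite -cvg_shiftS in h1; rewrite -cvg_shiftS in h2.
  apply: (seq_lim_unique h1 h2) => n /=.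
  rewrite -(big_mkord xpredT (fun k => f k x)) [RHS]big_ltn// {1}/f cosn0 mulr1.
  congr (_ + _); apply: eq_big_nat => k /andP[k1 _].
  by rewrite /f gtn_eqF.
have cqt := fsum_continuous cS fc cf.
split=> //; exists (pi / 2 * S) => K.
have E j : I (fun x => fsum f x * cosn j x) = pi / 2 * c j.
  rewrite int_I0pi_closed; last exact/contM/cosn_continuous.
  rewrite /c /cos_fourier_coeff mulrA.
  have -> : pi / 2 * (2 / pi) = 1 :> R.
    have pin0 : (pi : R) != 0 by rewrite gt_eqF// pi_gt0.
    by move: (pi : R) pin0 => p p0; field.
  rewrite mul1r; apply: eq_Rintegral => x; rewrite inE /= in_itv /= => x0.
  by rewrite qE.
have pi2 : 0 <= pi / 2 :> R by rewrite divr_ge0 ?pi_ge0.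
under eq_bigr do rewrite E normrM (ger0_norm pi2).
by rewrite -mulr_sumr ler_wpM2l.
Qed.

Lemma eigenvalue_list_potential (V : set (R -> R)) (q qt : R -> R) m lam :
  (forall x, 0 <= x <= pi -> q x = qt x) ->
  eigenvalue_list V q m lam -> eigenvalue_list V qt m lam.
Proof.
move=> qE [mlam dlam]; split=> // t; have [d [cd dd]] := dlam t; exists d; split=> //.
have -> // : eigenspace_on V qt t = eigenspace_on V q t.
have qI (u v du dv : R -> R) : I (fun x => du x * dv x + qt x * u x * v x) =
    I (fun x => du x * dv x + q x * u x * v x).
  by apply: int_eq => x /andP[x0 xpi]; rewrite qE// !ltW.
by apply/seteqP; split=> u [Vu [du [udu ew]]]; split=> //; exists du; split=> // v dv Vv vdv;
  have := ew v dv Vv vdv; rewrite qI.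
Qed.

(** The weights 1 + kap k and 2 * kap k compare except at k = 0, where kap may vanish. *)
Lemma weighted_summable (kap x : nat -> R) (C : R) :
  (forall k, k%:R ^+ 2 <= kap k) -> (forall K, \sum_(k < K) kap k * `|x k| <= C) ->
  summable_by (fun k => (1 + kap k) * x k) (`|x 0%N| + 2 * C).
Proof.
move=> kap_ge xC K.
have kap0 k : 0 <= kap k by exact: le_trans (sqr_ge0 _) (kap_ge k).
apply: (@le_trans _ _ (\sum_(k < K) (`|x k| *+ (k == 0 :> nat) + 2 * (kap k * `|x k|)))).
  apply: ler_sum => k _; rewrite normrM ger0_norm ?addr_ge0//.
  have n0 := normr_ge0 (x k); have k0 := kap0 k; have h := mulr_ge0 k0 n0.
  case: eqVneq => [_|kn0]; first by rewrite mulr1n; lra.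
  have : 1 <= kap k.
    apply: le_trans (kap_ge k); rewrite -[leLHS](expr1n _ 2) ler_pXn2r ?nnegrE//.
    by rewrite ler1n lt0n.
  by move=> k1; rewrite mulr0n add0r mulrA ler_wpM2r//; lra.
rewrite big_split /= -mulr_sumr lerD//; last by rewrite ler_wpM2l ?xC.
case: K => [|K]; first by rewrite big_ord0.
by rewrite big_ord_recl big1 ?addr0.
Qed.

(** The numbers nu come from the Galerkin limit. Since y `^ (- s) decreases, the
   inequalities lam (m + k) <= nu k are all that is needed to pass from nu to the
   eigenvalues. *)
Lemma mode_eigenvalues (V : set (R -> R)) (beta : R) (kap : nat -> R)
    (e de : nat -> R -> R) (q : R -> R) (Q : nat -> nat -> R) (B : R) (m : nat)
    (lam : nat -> R) :
  mode_system V beta kap e de -> continuous q ->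
  (forall k l, Q k l = I (fun t => q t * e k t * e l t)) ->
  (forall k N, \sum_(l < N) `|Q k l| <= B) ->
  eigenvalue_list V q m lam ->
  exists nu : nat -> R, [/\ forall j, lam (m + j)%N <= nu j,
    forall K (y : nat -> R), nu 0%N * (\sum_(k < K) y k ^+ 2) <=
      \sum_(k < K) \sum_(l < K) galerkin_matrix kap Q k l * y k * y l &
    0 < nu 0%N -> 0 < lam m -> forall s n, 0 < s ->
      \sum_(k < n) galerkin_matrix kap Q k k `^ (- s) <=
      \sum_(k < n) lam (m + k)%N `^ (- s)].
Proof.
move=> ms cq QE QB llam.
have Qsym k l : Q k l = Q l k by rewrite !QE; apply: int_eq => t _; ring.
have [nu [x [mnu [xC [ox [ex [form pe]]]]]]] := galerkin_limit (mode_kap_ge ms) Qsym QB.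
have sx j : exists C, summable_by (fun k => (1 + kap k) * x j k) C.
  have [C jC] := xC j; exists (`|x j 0%N| + 2 * C).
  exact: weighted_summable (mode_kap_ge ms) jC.
have lamnu j : lam (m + j)%N <= nu j.
  apply: (eigenvalue_list_le (w := fun i => mode_sum (e := e) (x i)) llam mnu).
    by move=> i; have [C iC] := sx i; exact: (mode_sum_eigenspace ms cq QE iC (ex i)).
  move=> i k; have [C iC] := sx i; have [C' kC] := sx k.
  exact: (int_mode_sumM ms iC kC (ox i k)).
exists nu; split=> // nu0 lam0 s n s0.
apply: le_trans (pe nu0 (fun y => y `^ (- s)) _ _ _ n) _.
- by move=> y z y0; exact: powR_neg_nonincreasing.
- exact: powR_neg_supporting_lines.
- by move=> y y0; exact: powR_continuous_at.
apply: ler_sum => j _; apply: powR_neg_nonincreasing => //.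
by apply: lt_le_trans lam0 _; case: llam => + _; apply; rewrite leqnn leq_addr.
Qed.

(** A Dirichlet eigenfunction has its eigenvalue as Rayleigh quotient, and this
   quotient is at least the lowest Neumann level. *)
Lemma dirichlet_eigenvalue_ge (q : R -> R) (nu : R) (lam : nat -> R) (m : nat) :
  continuous q ->
  (forall K (y : nat -> R), nu * (\sum_(k < K) y k ^+ 2) <= \sum_(k < K) \sum_(l < K)
     galerkin_matrix (@neumann_kap R) (neumann_matrix q) k l * y k * y l) ->
  eigenvalue_list (@H10 R) q m lam -> nu <= lam m.
Proof.
move=> cq form [_ dlam]; have [d [cd [f [Ef find _]]]] := dlam (lam m).
have d0 : (0 < d)%N.
  rewrite lt0n; apply/eqP => dz; move: cd; rewrite dz II0 card_eq0 => /eqP h.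
  have : [set k : nat | (m <= k)%N /\ lam k = lam m] m by [].
  by rewrite h.
pose i0 := Ordinal d0; pose u := f i0.
have [Hu [du [udu ew]]] := Ef i0; have [Lu Ldu _] := udu.
have u2 : 0 < I (fun x => u x ^+ 2).
  rewrite lt0r int_sqr_ge0 andbT; apply/eqP => u0.
  have u0ae := int_eq0_ae (L2_sqr Lu) (fun x _ => sqr_ge0 (u x)) u0.
  have c0 : eq_ae (fun x => \sum_(i < d) (i == i0)%:R * f i x) (fun=> 0).
    apply: filterS u0ae => x h Dx; rewrite (bigD1 i0)// eqxx mul1r big1 /= ?addr0.
      by have := h Dx => /eqP; rewrite sqrf_eq0 => /eqP.
    by move=> i /negbTE ->; rewrite mul0r.
  by have /eqP := find _ c0 i0; rewrite /= ?eqxx oner_eq0.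
have r := rayleigh_H10 cq form Hu udu.
have ew1 := ew u du Hu udu; have E (g : R -> R) : I (fun x => g x * g x) = I (fun x => g x ^+ 2).
  by apply: int_eq => x _; rewrite expr2.
rewrite E in ew1; rewrite -(ler_pM2r u2) -ew1; apply: le_trans r _.
rewrite -intD; [|exact: L2_sqr|exact/continuous_mul_intble/L2_sqr].
rewrite le_eqVlt; apply/orP; left; apply/eqP.
by apply: int_eq => x _; rewrite /u; ring.
Qed.

End assembly.

Unset Implicit Arguments.

Theorem theorem3p6 (R : realType) (q : R -> R) (lam mu : nat -> R)
    (hq : abs_cvg_cos_expansion q)
    (hlam : dirichlet_eigenvalues q lam)
    (hmu : neumann_eigenvalues q mu)
    (mu0_gt0 : 0 < mu 0%N)
    (n : nat) (hn : (1 <= n)%N) (s : R) (hs : 0 < s) :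
  \sum_(1 <= k < n.+1) lam k `^ (- s) + \sum_(0 <= k < n.+1) mu k `^ (- s) >=
  2 * (\sum_(1 <= k < n.+1) (k%:R ^+ 2 + mean_value q) `^ (- s))
  + mean_value q `^ (- s).
Proof.
have [qt [cq qE [S cS]]] := continuous_potential hq.
have {}hlam := eigenvalue_list_potential qE hlam.
have {}hmu := eigenvalue_list_potential qE hmu.
have -> : mean_value q = pi^-1 * int_I0pi qt.
  rewrite /mean_value int_I0pi_closed//; congr (_ * _).
  by apply: eq_Rintegral => x; rewrite inE /= in_itv /= => x0; exact: qE.
have [nuN [muN formN powN]] := mode_eigenvalues (@neumann_modes R) cq
  (fun k l => erefl) (neumann_matrix_row cq cS) hmu.
have [nuD [lamD formD powD]] := mode_eigenvalues (@dirichlet_modes R) cq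
  (fun k l => erefl) (dirichlet_matrix_row cq cS) hlam.
have nuN0 : 0 < nuN 0%N by apply: lt_le_trans mu0_gt0 _; have := muN 0%N.
have lam1 : 0 < lam 1%N.
  exact: lt_le_trans nuN0 (dirichlet_eigenvalue_ge cq formN hlam).
have nuD0 : 0 < nuD 0%N by apply: lt_le_trans lam1 _; have := lamD 0%N.
have := lerD (powD nuD0 lam1 s n hs) (powN nuN0 mu0_gt0 s n.+1 hs).
rewrite !big_add1 /= !big_mkord; apply: le_trans.
rewrite big_ord_recl.
have -> : galerkin_matrix (@neumann_kap R) (neumann_matrix qt) (ord0 : 'I_n.+1) (ord0 : 'I_n.+1)
    = pi^-1 * int_I0pi qt.
  by rewrite /galerkin_matrix /neumann_kap /= expr0n mulr0 add0r neumann_matrix00.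
rewrite [leRHS]addrCA [leRHS]addrC lerD2r mulr_sumr -big_split; apply: ler_sum => k _ /=.
apply: powR_neg_midpoint => //.
- exact: lt_le_trans nuD0 (form_diagonal_ge k formD).
- exact: lt_le_trans nuN0 (form_diagonal_ge _ formN).
rewrite /galerkin_matrix !eqxx !mul1r /neumann_kap /dirichlet_kap /bump /= add1n.
rewrite addrACA diagonal_sum//; move: (pi^-1 * _) => c; ring.
Qed.
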